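(* Let $T^3=\mathbb{R}^3/\Lambda_3$ be a flat $3$-torus which admits a minimal isometric immersion into some sphere $\mathbb{S}^m$. Then the field $\mathbb{Q}(w)$ generated over $\mathbb{Q}$ by the entries of the Gram matrix of $\Lambda_3$ (so that this Gram matrix lies in $GL(3,\mathbb{Q}(w))$) is a finite extension of $\mathbb{Q}$ with $[\mathbb{Q}(w):\mathbb{Q}]\le 4$. Moreover, if the minimal isometric immersion of $T^3$ in $\mathbb{S}^m$ is full and $[\mathbb{Q}(w):\mathbb{Q}]=3$ or $4$, then $m=7$ and the immersion is homogeneous.
   Context: Spheres are unit round spheres; an immersion into $\mathbb{S}^m\subset\mathbb{R}^{m+1}$ is full if its image is not contained in a proper linear subspace of $\mathbb{R}^{m+1}$. Normalization: $\Lambda_3\subset\mathbb{R}^3$ is a lattice of rank $3$ and $T^3=\mathbb{R}^3/\Lambda_3$ carries the metric $\frac{4\pi^2}{3}(du_1^2+du_2^2+du_3^2)$. If the rows of $L$ form a basis of $\Lambda_3$, the Gram matrix of $\Lambda_3$ is $LL^t$ (computed with the standard inner product of the coordinates $u$). Homogeneity: let $\Lambda_3^*=\{\xi:\langle\xi,v\rangle\in\mathbb{Z}\ \forall v\in\Lambda_3\}$ and let $\pm\xi_1,\dots,\pm\xi_N$ be all vectors of length $1$ in $\Lambda_3^*$. Put $\theta_r=2\pi\langle\xi_r,u\rangle$, $\Theta_r=(\cos\theta_r,\sin\theta_r)$. Every minimal isometric immersion $x:T^3\to\mathbb{S}^m$ has the form $x=(\Theta_1,\dots,\Theta_N)A$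 for a unique real $2N\times(m+1)$ matrix $A$; $x$ is homogeneous if and only if $AA^t$ is diagonal, equivalently, up to an isometry of the sphere, $x=(\sqrt{a_1}e^{\mathrm{i}\theta_1},\dots,\sqrt{a_N}e^{\mathrm{i}\theta_N})$ with $a_r\ge0$. *)

(* Defs.v *)
From HB Require Import structures.
From mathcomp Require Import all_boot all_order all_algebra.
From mathcomp Require Import all_classical all_reals all_analysis.
Set Implicit Arguments.
Unset Strict Implicit.
Unset Printing Implicit Defensive.
Import Order.TTheory GRing.Theory Num.Theory.
Import numFieldNormedType.Exports.
Local Open Scope classical_set_scope.
Local Open Scope ring_scope.

Section Defs.
Variable R : realType.

Definition dot (n : nat) (v w : 'rV[R]_n) : R := \sum_(i < n) v 0 i * w 0 i.

(* The rows of L are the chosen basis of the lattice. *)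
Definition lattice (L : 'M[R]_3) : set 'rV[R]_3 :=
  [set v | exists z : 'rV[int]_3, v = map_mx intr z *m L].

Definition dual_lattice (L : 'M[R]_3) : set 'rV[R]_3 :=
  [set xi | forall v, lattice L v -> dot xi v \is a Num.int].

Definition gram (L : 'M[R]_3) : 'M[R]_3 := L *m L^T.

Section Immersions.
Variables (L : 'M[R]_3) (m : nat).

(* Maps of the torus into R^(m+1) are represented by their lifts to the
   universal cover R^3, that is, by lattice-periodic maps. *)
Implicit Types (x : 'rV[R]_3 -> 'rV[R]_m.+1) (u : 'rV[R]_3).

Definition periodic x := forall v, lattice L v -> forall u, x (u + v) = x u.

Definition partial (i : 'I_3) x : 'rV[R]_3 -> 'rV[R]_m.+1 :=
  'D_(delta_mx 0 i : 'rV[R]_3) x.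

(* C^oo: every iterated partial derivative is (Frechet) differentiable
   everywhere, hence in particular continuous. *)
Definition smooth x :=
  forall (s : seq 'I_3) u, differentiable (foldr partial x s) u.

Definition spherical x := forall u, dot (x u) (x u) = 1.

(* The metric of the torus is metric_coef * (du_1^2 + du_2^2 + du_3^2). *)
Definition metric_coef : R := 4 * pi ^+ 2 / 3.

Definition isometric x := forall u (i j : 'I_3),
  dot (partial i x u) (partial j x u) = if i == j then metric_coef else 0.

(* Component of w normal to the immersion inside the tangent space of the
   sphere at x u.  For an isometric x into the sphere, x u together with the
   vectors partial j x u / sqrt metric_coef is an orthonormal family. *)
Definition normal_part x u (w : 'rV[R]_m.+1) : 'rV[R]_m.+1 :=
  w - dot w (x u) *: x u
    - \sum_(j < 3) (dot w (partial j x u) / metric_coef) *: partial j x u.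

Definition second_fundamental_form x (i j : 'I_3) u : 'rV[R]_m.+1 :=
  normal_part x u (partial i (partial j x) u).

(* One third of the trace of the second fundamental form with respect to the
   metric of the torus. *)
Definition mean_curvature x u : 'rV[R]_m.+1 :=
  3^-1 *: \sum_(i < 3) metric_coef^-1 *: second_fundamental_form x i i u.

Definition minimal x := forall u, mean_curvature x u = 0.

(* Being an immersion is implied by isometric. *)
Definition minimal_isometric_immersion x :=
  [/\ smooth x, periodic x, spherical x, isometric x & minimal x].

Definition full x :=
  forall U : {vspace 'rV[R]_m.+1}, (forall u, x u \in U) -> U = fullv.

(* +- xi_0, ..., +- xi_(N-1) are, without repetition, all the vectors of
   length 1 of the dual lattice. *)
Definition unit_dual_vectors (N : nat) (xi : 'I_N -> 'rV[R]_3) :=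
  (forall r, dual_lattice L (xi r) /\ dot (xi r) (xi r) = 1) /\
  (forall eta, dual_lattice L eta -> dot eta eta = 1 ->
     exists! r, eta = xi r \/ eta = - xi r).

Definition theta (N : nat) (xi : 'I_N -> 'rV[R]_3) (r : 'I_N) u : R :=
  2 * pi * dot (xi r) u.

(* mxvec reads its argument row by row, so that this is the row
   (cos theta_0, sin theta_0, cos theta_1, sin theta_1, ...). *)
Definition Theta (N : nat) (xi : 'I_N -> 'rV[R]_3) u : 'rV[R]_(N * 2) :=
  mxvec (\matrix_(r < N, k < 2)
    if k == 0 then cos (theta xi r u) else sin (theta xi r u)).

Definition homogeneous x :=
  exists (N : nat) (xi : 'I_N -> 'rV[R]_3) (A : 'M[R]_(N * 2, m.+1)),
    [/\ unit_dual_vectors xi, forall u, x u = Theta xi u *m A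
      & is_diag_mx (A *m A^T)].

End Immersions.

(* The field Q(S): it automatically contains Q, as R has characteristic 0. *)
Definition subfield_generated (S : set R) : set R :=
  smallest (fun K : set R => divring_closed (mem K)) S.

Definition gram_field (L : 'M[R]_3) : set R :=
  subfield_generated [set a | exists i j, a = gram L i j].

Definition rat_comb (d : nat) (e : 'I_d -> R) (c : 'I_d -> rat) : R :=
  \sum_(i < d) ratr (c i) * e i.

(* [K : Q] = d: the rational vector space K has a basis with d elements. *)
Definition degree_over_rat (K : set R) (d : nat) :=
  exists e : 'I_d -> R,
    (forall c, rat_comb e c = 0 -> forall i, c i = 0) /\
    K = range (rat_comb e).

Definition in_GL (K : set R) (n : nat) (M : 'M[R]_n) :=
  (forall i j, K (M i j)) /\
  exists B : 'M[R]_n, [/\ forall i j, K (B i j), M *m B = 1%:M & B *m M = 1%:M].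

End Defs.

(* Main.v *)
(** The coordinates of a minimal isometric immersion are Laplace eigenfunctions
    with eigenvalue 4 pi^2 (Takahashi), so that the immersion is a sum of terms
    cos(theta_r) p_r + sin(theta_r) q_r over the unit dual vectors xi_r: the
    translations by L/n decompose an eigenfunction into finitely many modes on which
    they act by rotations, and by Bernstein's inequality such a mode is an exact
    exponential once n is large.  Averaging the metric over a grid of translations
    gives sum_r A_r xi_r^T xi_r = 1 with A_r = 3/2 (|p_r|^2 + |q_r|^2).

    Choose three independent xi_r with A_r <> 0 and let x, y, z be the off-diagonal
    entries of their Gram matrix.  The coordinates of every xi_r in this basis are
    rational, so |xi_r| = 1 is a linear equation in (x, y, z) over Q, and the
    averaged identity says that the gradient of the Gram determinant is a
    combination of the linear parts of these equations.  If two linear parts are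
    independent, (x, y, z) is rational or a nondegenerate critical point of the
    determinant on a rational line, and the degree is at most 2.  If all are
    proportional, the degree is at most 4, and it is at most 2 unless exactly four
    xi_r have A_r <> 0, three of them being independent and the fourth having
    nonzero coordinates.  Then the only constraint on the four phases is one linear
    relation with nonzero coefficients; translating them independently in the
    identity for the metric shows that all p_r, q_r are orthogonal with
    |p_r| = |q_r|.  This is homogeneity, and the image spans a space of
    dimension 8. *)
Require Import Defs.
From HB Require Import structures.
From mathcomp Require Import all_boot all_order all_algebra.
From mathcomp Require Import all_classical all_reals all_analysis.
From mathcomp Require Import ring lra zify.

Set Implicit Arguments.
Unset Strict Implicit.
Unset Printing Implicit Defensive.
Import Order.TTheory GRing.Theory Num.Theory.
Import numFieldNormedType.Exports.
Local Open Scope classical_set_scope.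
Local Open Scope ring_scope.

(** A Fourier series with its limit over frequencies is avoided. A finite group of translations
    splits an eigenfunction exactly into finitely many pieces, and the maximum principle supplies
    the only estimate: a piece that turns faster than Bernstein's inequality permits must vanish.

    The gradient enters as follows. Let G be the Gram matrix of the three chosen vectors and [C] the
    matrix of the coordinates of all xi_r. The averaged identity says that [M], the product of the
    transpose of [C], the diagonal matrix of [A] and [C], is the inverse of G. The off-diagonal
    cofactors yz - x, xz - y, xy - z of G are half the partial derivatives of det G, while the
    off-diagonal entries of [M] combine products of two coordinates of xi_r. Up to a factor 2 these
    products are the coefficients of x, y, z in |xi_r| = 1. The Gram matrix of the lattice is K^T M
    K with [K] rational, so its entries lie in Q(x, y, z).

    The bounds 2 and 4 need no minimal polynomial: a spanning family of that size, possibly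
    dependent, is shown to span a field. *)

Section InnerProduct.
Variable R : realType.

Lemma dotC n (v w : 'rV[R]_n) : dot v w = dot w v.
Proof. by apply: eq_bigr => i _; rewrite mulrC. Qed.

Lemma dotN n (v w : 'rV[R]_n) : dot (- v) w = - dot v w.
Proof. by rewrite /dot -sumrN; apply: eq_bigr => i _; rewrite mxE mulNr. Qed.

Lemma dotDl n (a b c : 'rV[R]_n) : dot (a + b) c = dot a c + dot b c.
Proof. by rewrite /dot -big_split; apply: eq_bigr => i _; rewrite mxE mulrDl. Qed.

Lemma dotZl n (k : R) (a c : 'rV[R]_n) : dot (k *: a) c = k * dot a c.
Proof. by rewrite /dot mulr_sumr; apply: eq_bigr => i _; rewrite mxE mulrA. Qed.

Lemma dotDr n (a b c : 'rV[R]_n) : dot c (a + b) = dot c a + dot c b.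
Proof. by rewrite !(dotC c) dotDl. Qed.

Lemma dotZr n (k : R) (a c : 'rV[R]_n) : dot c (k *: a) = k * dot c a.
Proof. by rewrite !(dotC c) dotZl. Qed.

Lemma dot_suml n (I : finType) (a : I -> 'rV[R]_n) c : dot (\sum_k a k) c = \sum_k dot (a k) c.
Proof.
rewrite /dot exchange_big /=; apply: eq_bigr => i _.
by rewrite summxE mulr_suml.
Qed.

Lemma dot_sumr n (I : finType) (a : I -> 'rV[R]_n) c : dot c (\sum_k a k) = \sum_k dot c (a k).
Proof. by rewrite dotC dot_suml; apply: eq_bigr => k _; rewrite dotC. Qed.

Lemma dot0l n (v : 'rV[R]_n) : dot 0 v = 0.
Proof. by rewrite /dot big1// => i _; rewrite mxE mul0r. Qed.

Lemma dot_delta n (v : 'rV[R]_n) i : dot v (delta_mx 0 i) = v 0 i.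
Proof.
rewrite /dot (bigD1 i)//= mxE !eqxx mulr1 big1 ?addr0// => j ji.
by rewrite mxE (negPf ji) andbF mulr0.
Qed.

Lemma dot_mulmx n m (v : 'rV[R]_n) (w : 'rV[R]_m) (M : 'M[R]_(m, n)) :
  dot v (w *m M) = dot (v *m M^T) w.
Proof.
have D k (x y : 'rV[R]_k) : dot x y = (x *m y^T) 0 0.
  by rewrite mxE; apply: eq_bigr => i _; rewrite mxE.
by rewrite !D trmx_mul mulmxA.
Qed.

Lemma dot_ge0 n (v : 'rV[R]_n) : 0 <= dot v v.
Proof. by apply: sumr_ge0 => i _; rewrite -expr2 sqr_ge0. Qed.

Lemma dot_eq0 n (v : 'rV[R]_n) : dot v v = 0 -> v = 0.
Proof.
move=> v0; apply/rowP => i; rewrite mxE; apply/eqP; rewrite -sqrf_eq0 expr2.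
by move/eqP: v0; rewrite psumr_eq0 => [/allP /(_ i)|j _]; [rewrite mem_index_enum; exact|rewrite -expr2 sqr_ge0].
Qed.

Lemma norm_coord_le1 n (v : 'rV[R]_n) i : dot v v = 1 -> `|v 0 i| <= 1.
Proof.
move=> v1; rewrite -(expr_le1 (n := 2))// -normrX ger0_norm ?sqr_ge0//.
rewrite -v1 /dot (bigD1 i)//= -expr2 lerDl sumr_ge0// => j _.
by rewrite -expr2 sqr_ge0.
Qed.

End InnerProduct.

(** * Partial derivatives *)

(* Locked, because unification would otherwise unfold derivatives when it
   compares iterated partial derivatives. *)
HB.lock Definition pder (R : realType) (n : nat) (i : 'I_n) (f : 'rV[R]_n -> R) :
  'rV[R]_n -> R := 'D_(delta_mx 0 i : 'rV[R]_n) f.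
Arguments pder {R n} i f _.

Section Calculus.
Variables (R : realType) (n : nat).
Implicit Types (f g : 'rV[R]_n -> R) (u v : 'rV[R]_n).

Lemma pderE i f u : pder i f u = 'D_(delta_mx 0 i : 'rV[R]_n) f u.
Proof. by rewrite unlock. Qed.

Definition smoothr f := forall (s : seq 'I_n) u, differentiable (foldr pder f s) u.

Lemma is_derive_line f u v (t : R) : differentiable f (u + t *: v) ->
  is_derive t 1 (fun t => f (u + t *: v)) ('D_v f (u + t *: v)).
Proof.
move=> df; have := diff_derivable (v := v) df.
have E : (fun h : R => h^-1 *: (f (u + (h *: 1 + t) *: v) - f (u + t *: v))) =
    (fun h : R => h^-1 *: (f (h *: v + (u + t *: v)) - f (u + t *: v))).
  apply/funext => h; have A : u + (h + t) *: v = h *: v + (u + t *: v).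
    by rewrite scalerDl addrCA.
  by rewrite -A; congr (_ *: (f (_ + _ *: _) - _)); rewrite /GRing.scale /= mulr1.
by split; rewrite /derivable /derive /= E.
Qed.

Lemma derive_dir f u v : differentiable f u ->
  'D_v f u = \sum_i v 0 i * pder i f u.
Proof.
move=> df; rewrite deriveE // {1}(row_sum_delta v) linear_sum.
by apply: eq_bigr => i _; rewrite linearZ /= pderE deriveE.
Qed.

Lemma MVT_line f u v t : (forall u, differentiable f u) -> 0 < t ->
  exists2 c, 0 < c < t & f (u + t *: v) - f u = 'D_v f (u + c *: v) * t.
Proof.
move=> df t0.
have [| |c c0t E] := @MVT R (fun s => f (u + s *: v)) (fun s => 'D_v f (u + s *: v)) 0 t t0.
- by move=> s _; apply: is_derive_line.
- apply: derivable_within_continuous => s _.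
  by have := @is_derive_line f u v s (df _) => -[].
- exists c; first by rewrite in_itv in c0t.
  by move: E; rewrite scale0r addr0 subr0.
Qed.

Lemma smoothr_differentiable f u : smoothr f -> differentiable f u.
Proof. by move=> sf; apply: (sf [::]). Qed.

Lemma smoothr_pder i f : smoothr f -> smoothr (pder i f).
Proof. by move=> sf s u; have := sf (rcons s i) u; rewrite foldr_rcons. Qed.

Lemma differentiable_lin (a b : R) f g u : differentiable f u -> differentiable g u ->
  differentiable (fun u => a * f u + b * g u) u.
Proof. by move=> df dg; apply: differentiableD; apply: differentiableM. Qed.

Lemma pder_lin i (a b : R) f g :
  (forall u, differentiable f u) -> (forall u, differentiable g u) ->
  pder i (fun u => a * f u + b * g u) = (fun u => a * pder i f u + b * pder i g u).
Proof.
move=> df dg; apply/funext => u; rewrite !pderE.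
have -> : (fun u => a * f u + b * g u) = a *: f + b *: g by [].
have hf : derivable f u (delta_mx 0 i) by exact: diff_derivable.
have hg : derivable g u (delta_mx 0 i) by exact: diff_derivable.
rewrite (deriveD (derivableZ (k := a) hf) (derivableZ (k := b) hg)).
by rewrite (deriveZ _ hf) (deriveZ _ hg).
Qed.

Lemma pder_sum i m (h : 'I_m -> 'rV[R]_n -> R) :
  (forall j u, differentiable (h j) u) ->
  pder i (fun u => \sum_j h j u) = (fun u => \sum_j pder i (h j) u).
Proof.
move=> dh; apply/funext => u; rewrite pderE.
have -> : (fun u => \sum_j h j u) = \sum_j h j by apply/funext => x; rewrite fct_sumE.
rewrite derive_sum; last by move=> j; apply: diff_derivable.
by apply: eq_bigr => j _; rewrite pderE.
Qed.

Lemma smoothr_lin (a b : R) f g : smoothr f -> smoothr g ->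
  smoothr (fun u => a * f u + b * g u).
Proof.
move=> sf sg s.
suff -> : foldr pder (fun u => a * f u + b * g u) s =
    (fun u => a * foldr pder f s u + b * foldr pder g s u).
  by move=> u; apply: differentiable_lin.
elim: s => //= i s ->; rewrite pder_lin//.
Qed.

Lemma pder_shift i f w : pder i (fun u => f (u + w)) = (fun u => pder i f (u + w)).
Proof.
apply/funext => u; rewrite !pderE /derive.
by under eq_fun do rewrite /= -addrA.
Qed.

Lemma differentiable_shift f u w : differentiable f (u + w) ->
  differentiable (fun u => f (u + w)) u.
Proof.
by move=> df; apply: (@differentiable_comp _ _ _ _ (fun u => u + w) f).
Qed.

Lemma smoothr_shift f w : smoothr f -> smoothr (fun u => f (u + w)).
Proof.
move=> sf s u.
suff -> : foldr pder (fun u => f (u + w)) s = (fun u => foldr pder f s (u + w)).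
  by apply: differentiable_shift.
by elim: s => //= i s ->; rewrite pder_shift.
Qed.

Lemma smoothr_cst (c : R) : smoothr (fun=> c).
Proof.
move=> s u; suff [d ->] : exists d, foldr pder (fun=> c) s = fun=> d by exact: differentiable_cst.
elim: s => [|i s [d /= ->]]; first by exists c.
by exists 0; apply/funext => w; rewrite pderE derive_cst.
Qed.

(** The mean value theorem is used twice: along [v] for the difference of [f] in the direction [w],
    then along [w] for [pder i f]. *)
Lemma second_difference f u i j t (v := delta_mx 0 i : 'rV[R]_n)
    (w := delta_mx 0 j : 'rV[R]_n) : 0 < t -> smoothr f ->
  exists c : R * R, [/\ 0 < c.1 < t, 0 < c.2 < t &
   f (u + t *: v + t *: w) - f (u + t *: v) - (f (u + t *: w) - f u) =
   pder j (pder i f) (u + c.1 *: v + c.2 *: w) * t ^+ 2].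
Proof.
move=> t0 sf; have df x : differentiable f x := sf [::] x.
have dDf x : differentiable (pder i f) x := sf [:: i] x.
pose g x := 1 * f (x + t *: w) + (-1) * f x.
have dg x : differentiable g x.
  by apply: differentiable_lin => //; apply: differentiable_shift.
have [c1 c10 E1] := MVT_line u v dg t0.
have [c2 c20 E2] := MVT_line (u + c1 *: v) w dDf t0.
exists (c1, c2); split => //=.
have Dg x : pder i g x = pder i f (x + t *: w) - pder i f x.
  rewrite /g pder_lin//; last first.
    by move=> y; apply: differentiable_shift.
  by rewrite pder_shift mul1r mulN1r.
move: E1; rewrite -pderE Dg E2 -pderE /g !mul1r !mulN1r => ->.
by rewrite expr2 mulrA.
Qed.

Lemma continuous_near_ball f u e : differentiable f u -> 0 < e ->
  exists2 d : R, 0 < d & forall x, `|u - x| < d -> `|f u - f x| < e.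
Proof.
move=> df e0; have /differentiable_continuous/cvgrPdist_lt /(_ e e0) := df.
by case/nbhs_ballP => d /= d0 H; exists d => // x ux; apply: H; rewrite -ball_normE.
Qed.

(** A second difference does not depend on the order of its two directions. Hence some value of one
    mixed derivative near [u] equals some value of the other near [u], and continuity at [u] does
    the rest. *)
Lemma pderC i j f : smoothr f -> pder i (pder j f) = pder j (pder i f).
Proof.
move=> sf; apply/funext => u; apply/eqP/negPn/negP => neq.
pose e := `|pder i (pder j f) u - pder j (pder i f) u| / 2.
have e0 : 0 < e by rewrite divr_gt0// normr_gt0 subr_eq0.
have [d1 d10 H1] := continuous_near_ball (sf [:: i; j] u) e0.
have [d2 d20 H2] := continuous_near_ball (sf [:: j; i] u) e0.
pose vi : 'rV[R]_n := delta_mx 0 i; pose vj : 'rV[R]_n := delta_mx 0 j.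
(* The summand 1 makes [K] positive and the distance estimate [bnd] strict. *)
pose K := `|vi| + `|vj| + 1.
have K0 : 0 < K by rewrite ltr_wpDl// addr_ge0.
pose t : R := Num.min d1 d2 / K.
have t0 : 0 < t by rewrite divr_gt0// lt_min d10.
have bnd (a b : 'rV[R]_n) (c1 c2 : R) : `|a| + `|b| + 1 = K -> 0 < c1 < t -> 0 < c2 < t ->
    `|u - (u + c1 *: a + c2 *: b)| < Num.min d1 d2.
  move=> EK /andP[c10 c1t] /andP[c20 c2t].
  have -> : u - (u + c1 *: a + c2 *: b) = - (c1 *: a + c2 *: b).
    by rewrite -addrA opprD addNKr.
  rewrite normrN; apply: (@le_lt_trans _ _ (t * (`|a| + `|b|))).
    rewrite mulrDr (le_trans (ler_normD _ _))// !normrZ lerD// ler_wpM2r//.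
      by rewrite gtr0_norm// ltW.
    by rewrite gtr0_norm// ltW.
  have -> : Num.min d1 d2 = t * K by rewrite /t divfK// gt_eqF.
  by rewrite ltr_pM2l// -EK ltrDl.
clearbody t.
have tn0 : t ^+ 2 != 0 by rewrite expf_neq0// gt_eqF.
have [c [c1 c2 Ec]] := second_difference u j i t0 sf.
have [c' [c1' c2' Ec']] := second_difference u i j t0 sf.
rewrite -/vi -/vj in Ec Ec'.
have E : pder i (pder j f) (u + c.1 *: vj + c.2 *: vi) =
    pder j (pder i f) (u + c'.1 *: vi + c'.2 *: vj).
  have inj (a b x : R) : x = a * t ^+ 2 -> x = b * t ^+ 2 -> a = b.
    by move=> -> /(mulIf tn0).
  apply: (inj _ _ _ Ec); apply: etrans Ec'; rewrite (addrAC u).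
  by ring.
have := H1 _ (lt_le_trans (bnd vj vi c.1 c.2 _ c1 c2) _).
rewrite (addrC `|vj|) ge_min lexx => /(_ erefl erefl) {}H1.
have := H2 _ (lt_le_trans (bnd vi vj c'.1 c'.2 _ c1' c2') _).
rewrite ge_min lexx orbT => /(_ erefl erefl) {}H2.
have := ler_distD (pder i (pder j f) (u + c.1 *: vj + c.2 *: vi))
  (pder i (pder j f) u) (pder j (pder i f) u).
rewrite leNgt => /negP; apply.
rewrite [X in _ < X](_ : _ = e + e); last by rewrite /e -splitr.
by apply: ltrD; [exact: H1|rewrite E distrC; exact: H2].
Qed.

Lemma is_derive_fsum m (h : 'I_m -> R -> R) (t : R) (dh : 'I_m -> R) :
  (forall j, is_derive t 1 (h j) (dh j)) ->
  is_derive t 1 (fun t => \sum_j h j t) (\sum_j dh j).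
Proof.
move=> H; have -> : (fun t => \sum_j h j t) = \sum_j h j.
  by apply/funext => s; rewrite fct_sumE.
exact: is_derive_sum.
Qed.

Lemma is_derive_fmul (h k : R -> R) (t dh dk : R) :
  is_derive t 1 h dh -> is_derive t 1 k dk ->
  is_derive t 1 (fun t => h t * k t) (dh * k t + h t * dk).
Proof.
move=> H K; have -> : (fun t => h t * k t) = h * k by [].
apply: is_derive_eq.
by rewrite addrC /GRing.scale /= mulrC.
Qed.

Lemma is_derive_fadd (h k : R -> R) (t dh dk : R) :
  is_derive t 1 h dh -> is_derive t 1 k dk ->
  is_derive t 1 (fun t => h t + k t) (dh + dk).
Proof. by move=> H K; have -> : (fun t => h t + k t) = h + k by []; exact: is_deriveD. Qed.

Lemma is_derive_fcmul (c : R) (h : R -> R) (t dh : R) :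
  is_derive t 1 h dh -> is_derive t 1 (fun t => c * h t) (c * dh).
Proof. by move=> H; have -> : (fun t => c * h t) = c *: h by []; exact: is_deriveZ. Qed.

(** At the maximum [phi'] vanishes; if [d] were positive, [phi'] would be positive just to the right
    of 0 and [phi] would increase there. *)
Lemma second_derivative_max (phi phi' : R -> R) (d : R) :
  (forall t : R, is_derive t 1 phi (phi' t)) -> is_derive (0 : R) 1 phi' d ->
  (forall t, phi t <= phi 0) -> d <= 0.
Proof.
move=> dphi [dv dE] phimax; rewrite leNgt; apply/negP => d0.
have p0 : phi' 0 = 0.
  have a1 : (-1 : R) <= 1 by lra.
  have c1 : (0 : R) \in `](-1), 1[ by rewrite in_itv/= ltrN10 ltr01.
  have [|_ E0] := @derive1_at_max R phi (-1) 1 0 a1 _ c1 (fun t _ => phimax t).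
    by move=> t _; have [] := dphi t.
  by have [_ E1] := dphi 0; rewrite -E1 E0.
have : h^-1 *: (phi' (h *: 1 + 0) - phi' 0) @[h --> 0^'] --> d by rewrite -dE.
move=> /cvgrPdist_lt /(_ d d0); rewrite near_withinE /= => /nbhs_ballP[e /= e0 He].
have e20 : 0 < e / 2 by rewrite divr_gt0.
have [|c] := @MVT R phi phi' 0 (e / 2) e20 (fun t _ => dphi t).
  apply: derivable_within_continuous => s _.
  by have [] := dphi s.
rewrite in_itv /= => /andP[c0 ce] E.
have cb : ball (0 : R) e c.
  rewrite /ball /= sub0r normrN gtr0_norm//.
  by rewrite (lt_trans ce)// ltr_pdivrMr// mulr2n mulrDr mulr1 ltrDl.
have := He c cb (lt0r_neq0 c0); rewrite p0 addr0 subr0.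
have -> : c *: (1 : R) = c by rewrite /GRing.scale /= mulr1.
move=> H.
have : 0 < phi' c.
  have : 0 < c^-1 * phi' c.
    by have := le_lt_trans (ler_norm _) H; rewrite ltrBlDr ltrDl.
  by rewrite pmulr_rgt0// invr_gt0.
move=> pc; have : 0 < phi (e / 2) - phi 0 by rewrite E subr0 mulr_gt0.
by rewrite subr_gt0 ltNge phimax.
Qed.

End Calculus.

(** * Laplace eigenfunctions on a torus *)

Section Eigenfunctions.
Variables (R : realType) (L : 'M[R]_3).
Implicit Types (f g : 'rV[R]_3 -> R) (u v : 'rV[R]_3).

Definition lperiodic f := forall v, lattice L v -> forall u, f (u + v) = f u.

Definition eigen (lam : R) f :=
  [/\ smoothr f, lperiodic f & forall u, \sum_i pder i (pder i f) u = - lam * f u].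

(** Compactness of the torus: subtracting the floors of the coordinates in the basis [L] brings any
    point into the image of the closed unit cube. *)
Lemma lperiodic_max f : L \in unitmx -> (forall u, differentiable f u) ->
  lperiodic f -> exists u0, forall u, f u <= f u0.
Proof.
move=> Lu df pf.
pose A := [set t : 'rV[R]_3 | forall i, [set` `[(0 : R), (1 : R)]] (t ord0 i)].
have cA : compact A
  by apply: (@rV_compact R 3 (fun=> [set` `[(0 : R), (1 : R)]])) => i; exact: segment_compact.
have A0 : A !=set0 by exists 0 => i /=; rewrite mxE in_itv/= lexx ler01.
pose l (t : 'rV[R]_3) : 'rV[R]_3 := t *m L.
have lE : l = \sum_i (fun t : 'rV[R]_3 => t 0 i *: row i L).
  by apply/funext => t; rewrite /l fct_sumE mulmx_sum_row.
have dl t : differentiable l t.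
  rewrite lE; apply: differentiable_sum => i; apply: differentiableZl.
  exact: differentiable_coord.
have cg : {within A, continuous (f \o l)}.
  apply: continuous_subspaceT => t.
  by apply: differentiable_continuous; apply: differentiable_comp.
have [c cin cmax] := EVT_max_rV A0 cA cg.
exists (l c) => u; pose t := u *m invmx L.
pose z : 'rV[int]_3 := \row_i Num.floor (t 0 i).
pose s : 'rV[R]_3 := t - map_mx intr z.
have -> : f u = f (l s).
  rewrite -[RHS](pf (map_mx intr z *m L)); last by exists z.
  by rewrite /l -mulmxDl subrK /t mulmxKV.
apply: cmax; rewrite inE => i; clearbody t; rewrite /= !mxE in_itv/=.
have /andP[H1 H2] := floor_itv (t 0 i).
by rewrite subr_ge0 H1 /= lerBlDr (le_trans (ltW H2))// intrD addrC.
Qed.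

Lemma lperiodic_shift f w : lperiodic f -> lperiodic (fun u => f (u + w)).
Proof. by move=> pf v Lv u; rewrite addrAC (pf v). Qed.

Lemma lperiodic_pder f i : lperiodic f -> lperiodic (pder i f).
Proof.
move=> pf v Lv u; rewrite -[LHS]/((fun u => pder i f (u + v)) u) -pder_shift.
have -> // : (fun u => f (u + v)) = f by apply/funext => w; rewrite (pf v).
Qed.

Lemma eigen_lin lam (a b : R) f g : eigen lam f -> eigen lam g ->
  eigen lam (fun u => a * f u + b * g u).
Proof.
move=> [sf pf ef] [sg pg eg]; split; first exact: smoothr_lin.
  by move=> v Lv u; rewrite pf// pg.
move=> u; have -> : - lam * (a * f u + b * g u) = a * (- lam * f u) + b * (- lam * g u).
  by ring.
rewrite -ef -eg !mulr_sumr -big_split /=.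
apply: eq_bigr => i _; rewrite !pder_lin//.
- by move=> x; apply: smoothr_differentiable; apply: smoothr_pder.
- by move=> x; apply: smoothr_differentiable; apply: smoothr_pder.
- by move=> x; apply: smoothr_differentiable.
- by move=> x; apply: smoothr_differentiable.
Qed.

Lemma eigen0 lam : eigen lam (fun=> 0).
Proof.
split => [||u]; [exact: smoothr_cst|by []|].
rewrite mulr0 big1// => i _.
have -> : pder i (fun=> 0 : R) = (fun=> 0 : R).
  by apply/funext => w; rewrite pderE derive_cst.
by rewrite pderE derive_cst.
Qed.

Lemma eigen_sum lam m (c : 'I_m -> R) (h : 'I_m -> 'rV[R]_3 -> R) :
  (forall j, eigen lam (h j)) -> eigen lam (fun u => \sum_j c j * h j u).
Proof.
elim: m c h => [|m IH] c h H.
  have -> : (fun u => \sum_(j < 0) c j * h j u) = fun=> 0.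
    by apply/funext => u; rewrite big_ord0.
  exact: eigen0.
have -> : (fun u => \sum_j c j * h j u) =
    (fun u => 1 * (\sum_(j < m) c (widen_ord (leqnSn m) j) * h (widen_ord (leqnSn m) j) u)
              + c ord_max * h ord_max u).
  by apply/funext => u; rewrite big_ord_recr /= mul1r.
by apply: eigen_lin; [apply: IH|].
Qed.

Lemma eigen_shift lam f w : eigen lam f -> eigen lam (fun u => f (u + w)).
Proof.
move=> [sf pf ef]; split; [exact: smoothr_shift|exact: lperiodic_shift|].
by move=> u; rewrite -ef; apply: eq_bigr => i _; rewrite !pder_shift.
Qed.

Lemma eigen_pder lam f i : eigen lam f -> eigen lam (pder i f).
Proof.
move=> [sf pf ef]; split; [exact: smoothr_pder|exact: lperiodic_pder|].
move=> u; transitivity (pder i (fun u => \sum_j pder j (pder j f) u) u).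
  rewrite pder_sum => [|j x]; last first.
    by apply: smoothr_differentiable; do 2!apply: smoothr_pder.
  apply: eq_bigr => j _; rewrite (pderC j i)// (pderC j i)//.
  exact: smoothr_pder.
have -> : (fun u => \sum_j pder j (pder j f) u) = (fun u => - lam * f u + 0 * f u).
  by apply/funext => w; rewrite ef mul0r addr0.
by rewrite pder_lin ?mul0r ?addr0// => x; apply: smoothr_differentiable.
Qed.

(* Bernstein's inequality, from the maximum principle: at a maximum of
   |grad f|^2 + 2 lam f^2 the Laplacian of this function is nonpositive, and the
   eigenvalue equation turns this into |grad f|^2 <= 2 lam f^2 there. *)
Lemma eigen_pder_bound (lam : R) f (M : R) : L \in unitmx -> 0 < lam -> eigen lam f ->
  (forall u, `|f u| <= M) -> forall i u, pder i f u ^+ 2 <= 4 * lam * M ^+ 2.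
Proof.
move=> Lu lam0 ef fM.
have [sf pf lf] := ef.
have df s x : differentiable (foldr pder f s) x by [].
(* The weight of [f u * f u] has to exceed [lam]: half the Laplacian of the first sum contains
   [- lam] times |grad f|^2, which the second term must outweigh. *)
pose w u := \sum_j pder j f u * pder j f u + 2 * lam * (f u * f u).
have dw u : differentiable w u.
  have -> : w = (\sum_j (pder j f * pder j f)) + (2 * lam) *: (f * f).
    by apply/funext => x; rewrite /w !fctE fct_sumE.
  apply: differentiableD; last by apply: differentiableZ; apply: differentiableM; exact: (df [::]).
  by apply: differentiable_sum => j; apply: differentiableM; exact: (df [:: j]).
have pw : lperiodic w.
  move=> v Lv u; rewrite /w (pf v)//; congr (_ + _); apply: eq_bigr => j _.
  by have /(_ v Lv u) -> := lperiodic_pder j pf.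
have [u0 maxw] := lperiodic_max Lu dw pw.
pose p j := pder j f u0; pose q i j := pder i (pder j f) u0.
have Hd i : \sum_j (2 * (q i j ^+ 2 + p j * pder i (pder i (pder j f)) u0)) +
    4 * lam * (p i ^+ 2 + f u0 * q i i) <= 0.
  pose e : 'rV[R]_3 := delta_mx 0 i.
  have dline g (t : R) : (forall x, differentiable g x) ->
      is_derive t 1 (fun t => g (u0 + t *: e)) (pder i g (u0 + t *: e)).
    by move=> dg; rewrite pderE; apply: is_derive_line.
  pose phi' (t : R) : R := \sum_j (pder i (pder j f) (u0 + t *: e) * pder j f (u0 + t *: e) +
      pder j f (u0 + t *: e) * pder i (pder j f) (u0 + t *: e)) +
    2 * lam * (pder i f (u0 + t *: e) * f (u0 + t *: e) + f (u0 + t *: e) * pder i f (u0 + t *: e)).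
  apply: (@second_derivative_max R (fun t => w (u0 + t *: e)) phi') => [t||t].
  - apply: is_derive_fadd; last first.
      by apply: is_derive_fcmul; apply: is_derive_fmul; apply: dline; apply: (df [::]).
    by apply: is_derive_fsum => j; apply: is_derive_fmul; apply: dline; apply: (df [:: j]).
  - have d0 : is_derive (0 : R) 1 phi' (
      \sum_j ((pder i (pder i (pder j f)) (u0 + 0 *: e) * pder j f (u0 + 0 *: e) +
         pder i (pder j f) (u0 + 0 *: e) * pder i (pder j f) (u0 + 0 *: e)) +
       (pder i (pder j f) (u0 + 0 *: e) * pder i (pder j f) (u0 + 0 *: e) +
        pder j f (u0 + 0 *: e) * pder i (pder i (pder j f)) (u0 + 0 *: e))) +
      2 * lam * ((pder i (pder i f) (u0 + 0 *: e) * f (u0 + 0 *: e) +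
                   pder i f (u0 + 0 *: e) * pder i f (u0 + 0 *: e)) +
                 (pder i f (u0 + 0 *: e) * pder i f (u0 + 0 *: e) +
                  f (u0 + 0 *: e) * pder i (pder i f) (u0 + 0 *: e)))).
      apply: is_derive_fadd.
        apply: is_derive_fsum => j; apply: is_derive_fadd; apply: is_derive_fmul; apply: dline.
        - exact: (df [:: i; j]).
        - exact: (df [:: j]).
        - exact: (df [:: j]).
        - exact: (df [:: i; j]).
      apply: is_derive_fcmul; apply: is_derive_fadd; apply: is_derive_fmul; apply: dline.
      - exact: (df [:: i]).
      - exact: (df [::]).
      - exact: (df [::]).
      - exact: (df [:: i]).
    apply: (is_derive_eq d0); rewrite scale0r addr0 -/(p i) -/(q i i).
    congr (_ + _); last by ring.
    by apply: eq_bigr => j _; rewrite -/(p j) -/(q i j); ring.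
  - by rewrite scale0r addr0.
have H1 : \sum_i \sum_j (2 * (q i j ^+ 2 + p j * pder i (pder i (pder j f)) u0)) +
    4 * lam * \sum_i (p i ^+ 2 + f u0 * q i i) <= 0.
  by rewrite mulr_sumr -big_split /=; apply: sumr_le0 => i _; apply: Hd.
(* Each [pder j f] is again an eigenfunction, so the third derivatives in [H1] sum to [- lam * p j];
   the squared Hessian is dropped because of its sign. *)
have H2 : 2 * lam * \sum_i p i ^+ 2 <= 4 * lam ^+ 2 * f u0 ^+ 2.
  have E1 : \sum_i \sum_j (2 * (q i j ^+ 2 + p j * pder i (pder i (pder j f)) u0)) =
      2 * (\sum_i \sum_j q i j ^+ 2) - 2 * lam * \sum_j p j ^+ 2.
    rewrite exchange_big /= [in X in 2 * X]exchange_big /= !mulr_sumr -sumrB.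
    apply: eq_bigr => j _; rewrite -mulr_sumr big_split /= -mulr_sumr.
    by have [_ _ ->] := eigen_pder j ef; rewrite -/(p j); ring.
  have E2 : \sum_i (p i ^+ 2 + f u0 * q i i) = \sum_i p i ^+ 2 - lam * f u0 ^+ 2.
    by rewrite big_split /= -mulr_sumr lf; ring.
  have q0 : 0 <= \sum_i \sum_j q i j ^+ 2.
    by apply: sumr_ge0 => i _; apply: sumr_ge0 => j _; apply: sqr_ge0.
  by move: H1; rewrite E1 E2; nra.
move=> i u.
have fM2 x : f x ^+ 2 <= M ^+ 2.
  by rewrite -[f x ^+ 2]real_normK ?num_real// lerXn2r// nnegrE (le_trans _ (fM x)).
have wu0 : w u0 <= 4 * lam * M ^+ 2.
  have -> : w u0 = \sum_i p i ^+ 2 + 2 * lam * f u0 ^+ 2 by [].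
  have H3 : \sum_i p i ^+ 2 <= 2 * lam * f u0 ^+ 2.
    by rewrite -(ler_pM2l (mulr_gt0 (ltr0n R 2) lam0)); nra.
  apply: le_trans (lerD H3 (lexx _)) _.
  have := fM2 u0; nra.
apply: le_trans wu0; apply: le_trans (maxw u).
rewrite /w (bigD1 i)//= -addrA lerDl addr_ge0//.
  by apply: sumr_ge0 => j _; rewrite -expr2 sqr_ge0.
by rewrite -expr2 mulr_ge0 ?sqr_ge0// mulr_ge0// ltW.
Qed.

Definition dirder v f : 'rV[R]_3 -> R := fun u => \sum_i v 0 i * pder i f u.

Lemma eigen_dirder lam v f : eigen lam f -> eigen lam (dirder v f).
Proof. by move=> ef; apply: eigen_sum => i; apply: eigen_pder. Qed.

Lemma is_derive_dir f u v (t : R) : smoothr f ->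
  is_derive t 1 (fun t : R => f (u + t *: v)) (dirder v f (u + t *: v)).
Proof.
move=> sf; have df x : differentiable f x := sf [::] x.
by rewrite /dirder -derive_dir//; apply: is_derive_line.
Qed.

Lemma dirder_lin (a b : R) v f g : smoothr f -> smoothr g ->
  dirder v (fun u => a * f u + b * g u) = (fun u => a * dirder v f u + b * dirder v g u).
Proof.
move=> sf sg; apply/funext => u; rewrite /dirder !mulr_sumr -big_split /=.
apply: eq_bigr => i _; rewrite pder_lin//; last 2 first.
- by move=> x; apply: smoothr_differentiable.
- by move=> x; apply: smoothr_differentiable.
by ring.
Qed.

(** The constant depends on [v] and [lam] alone, so one grid size will serve all modes, and the
    bound also applies to the defects built from a mode. The summand 1 in the witness keeps it
    positive for [v = 0]. *)
Lemma eigen_dirder_bound (lam : R) v : L \in unitmx -> 0 < lam ->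
  exists2 C, 0 < C & forall f (M : R), eigen lam f -> (forall u, `|f u| <= M) ->
    forall u, `|dirder v f u| <= C * M.
Proof.
move=> Lu lam0; exists (\sum_i `|v 0 i| * (2 * Num.sqrt lam) + 1).
  by rewrite ltr_wpDl// sumr_ge0// => i _; rewrite !mulr_ge0// sqrtr_ge0.
move=> f M ef fM u; have M0 : 0 <= M by apply: le_trans (fM 0).
rewrite mulrDl mul1r mulr_suml ler_wpDr// (le_trans (ler_norm_sum _ _ _))//.
apply: ler_sum => i _; rewrite normrM -mulrA ler_wpM2l//.
have s0 : 0 <= 2 * Num.sqrt lam * M by rewrite !mulr_ge0// sqrtr_ge0.
rewrite -(ger0_norm s0) -[leLHS]sqrtr_sqr -[leRHS]sqrtr_sqr ler_wsqrtr//.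
apply: le_trans (eigen_pder_bound Lu lam0 ef fM i u) _.
by rewrite !exprMn sqr_sqrtr; [rewrite -natrX lexx|exact: ltW].
Qed.

(** A common bound that can always be halved is at most [M0 / 2 ^+ n] for every [n], hence 0. *)
Lemma halving (a b : 'rV[R]_3 -> R) (M0 : R) :
  (forall u, `|a u| <= M0) -> (forall u, `|b u| <= M0) ->
  (forall M : R, (forall u, `|a u| <= M) -> (forall u, `|b u| <= M) ->
     forall u, `|a u| <= M / 2 /\ `|b u| <= M / 2) ->
  forall u, a u = 0 /\ b u = 0.
Proof.
move=> a0 b0 H.
have Hn (n : nat) : (forall u, `|a u| <= M0 / 2 ^+ n) /\ (forall u, `|b u| <= M0 / 2 ^+ n).
  elim: n => [|n [IHa IHb]]; first by split => u; rewrite expr0 divr1.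
  by split => u; have [Ha Hb] := H _ IHa IHb u; rewrite exprSr invfM mulrA.
have M00 : 0 <= M0 by apply: le_trans (a0 0).
have lim0 (x : R) : 0 <= x -> (forall n : nat, x <= M0 / 2 ^+ n) -> x = 0.
  rewrite le_eqVlt => /orP[/eqP <- //|x0] Hx; exfalso.
  have := Hx (Num.truncn (M0 / x)).+1; rewrite leNgt => /negP; apply.
  rewrite ltr_pdivrMr ?exprn_gt0// mulrC -ltr_pdivrMr//.
  apply: lt_le_trans (truncnS_gt _) _.
  by rewrite -natrX ler_nat ltnW// ltn_expl.
by move=> u; split; apply/eqP; rewrite -normr_eq0; apply/eqP; apply: lim0 => // n;
  have [Ha Hb] := Hn n.
Qed.

(** For positive [x], sin x = x cos c with c between 0 and x, and cos c >= cos x >= 1/2 because the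
    cosine decreases on [0, pi]. *)
Lemma norm_le_sin (x : R) : `|x| <= pi -> 2^-1 <= cos x -> `|x| <= 2 * `|sin x|.
Proof.
wlog x0 : x / 0 <= x => [W|].
  have [x0|x0] := leP 0 x; first exact: W.
  by rewrite -normrN -cosN -(normrN (sin x)) -sinN; apply: W; rewrite oppr_ge0 ltW.
rewrite ger0_norm// => xpi cx.
move: x0; rewrite le_eqVlt => /orP[/eqP <-|x0]; first by rewrite mulr_ge0.
have [|c] := @MVT R sin cos 0 x x0 (fun t _ => is_derive_sin t).
  by apply: continuous_subspaceT => t; apply: continuous_sin.
rewrite in_itv/= => /andP[c0 cx0]; rewrite sin0 !subr0 => E.
have cc : 2^-1 <= cos c.
  apply: le_trans cx _.
  rewrite leNgt ltr_cos ?in_itv/= ?(ltW x0) ?xpi ?(ltW c0) ?(le_trans (ltW cx0))//.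
  by rewrite -leNgt ltW.
have s0 : 0 <= sin x by rewrite E mulr_ge0 ?ltW// (lt_le_trans _ cc).
by rewrite ger0_norm// E; nra.
Qed.

Lemma MVT_dirder f u v (h K : R) : smoothr f -> 0 < h ->
  (forall u, `|dirder v f u| <= K) -> `|f (u + h *: v) - f u| <= h * K.
Proof.
move=> sf h0 HK; have df x : differentiable f x := sf [::] x.
have [c _ ->] := MVT_line u v df h0.
rewrite derive_dir// normrM mulrC gtr0_norm// ler_pM2l//; exact: HK.
Qed.

Definition rotates v (h alpha : R) (a b : 'rV[R]_3 -> R) :=
  (forall u, a (u + h *: v) = cos alpha * a u - sin alpha * b u) /\
  (forall u, b (u + h *: v) = sin alpha * a u + cos alpha * b u).

Lemma eigen_bounded (lam : R) f : L \in unitmx -> eigen lam f ->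
  exists M : R, forall u, `|f u| <= M.
Proof.
move=> Lu ef; have [sf pf _] := ef.
have [u1 H1] := lperiodic_max Lu (sf [::]) pf.
have [sg pg _] := eigen_lin (-1) 0 ef ef.
have [u2 H2] := lperiodic_max Lu (sg [::]) pg.
exists (Num.max (f u1) (- f u2)) => u; rewrite ler_norml le_max H1 /= andbT.
have {}H2 : - f u <= - f u2 by have := H2 u; rewrite /= !mul0r !addr0 !mulN1r.
by rewrite lerNl le_max H2 orbT.
Qed.

(* The translation by h v multiplies a + i b by exp (i alpha).  As h C is small,
   Bernstein's inequality bounds the change of a and b; for a larger alpha the
   bound improves itself by a factor 2 and forces a = b = 0. *)
Lemma rotates_small (lam C h alpha : R) v a b : L \in unitmx ->
  (forall f (M : R), eigen lam f -> (forall u, `|f u| <= M) ->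
    forall u, `|dirder v f u| <= C * M) ->
  0 < h -> 0 < C -> h * C <= 8^-1 -> `|alpha| <= pi ->
  eigen lam a -> eigen lam b -> rotates v h alpha a b ->
  (forall u, a u = 0 /\ b u = 0) \/ `|alpha| <= 6 * (h * C).
Proof.
move=> Lu HC h0 C0 hC api ea eb [ra rb].
have [Ma HMa] := eigen_bounded Lu ea.
have [Mb HMb] := eigen_bounded Lu eb.
have := cos2Dsin2 alpha; set c := cos alpha in ra rb *; set s := sin alpha in ra rb * => cs.
have c1 : c <= 1 by exact: cos_le1.
have hC0 : 0 < h * C by exact: mulr_gt0.
(* In the case [big] the bound on [a] and [b] halves. In the case [small], [h * C <= 8^-1] gives 1 -
   c <= (8/7) h C |s|, hence s^2 <= 2 (1 - c) <= 3 h C |s|, and [norm_le_sin] turns |s| <= 3 h C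
   into the bound with constant 6. *)
have [big|small] := leP (h * C * ((1 - c) + `|s|)) (1 - c); last first.
  right; have s1 : `|s| <= 1 by rewrite /s ler_norml sin_geN1 sin_le1.
  have s0 : 0 <= `|s| by [].
  have ss : `|s| ^+ 2 = s ^+ 2 by rewrite real_normK ?num_real.
  have := norm_le_sin api; rewrite -/c -/s => H; apply: le_trans (H _) _.
    nra.
  have [->|sn0] := eqVneq `|s| 0; first by rewrite mulr0; nra.
  have sp : 0 < `|s| by rewrite lt0r sn0.
  have H2 : `|s| ^+ 2 <= 3 * (h * C) * `|s| by nra.
  by move: H2; rewrite expr2 ler_pM2r//; nra.
have [c_eq1|cn1] := eqVneq c 1.
  right; have s0 : s = 0 by apply/eqP; rewrite -sqrf_eq0; apply/eqP; move: cs; rewrite c_eq1; lra.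
  have := norm_le_sin api; rewrite -/c -/s s0 c_eq1 normr0 mulr0 => H.
  by apply: le_trans (H _) _; [lra|nra].
have c1' : 0 < 1 - c by rewrite subr_gt0 lt_neqAle cn1.
left; apply: (@halving a b (Num.max Ma Mb)) => [u|u|M HaM HbM u].
- by rewrite le_max HMa.
- by rewrite le_max HMb orbT.
have [sa _ _] := ea; have [sb _ _] := eb.
have Ha := MVT_dirder u sa h0 (HC a M ea HaM).
have Hb := MVT_dirder u sb h0 (HC b M eb HbM).
have M0 : 0 <= M by apply: le_trans (HaM 0).
(* The increments of [a] and [b] are the image of (a, b) under the matrix of exp(i alpha) - 1, whose
   determinant is 2 (1 - c); the first premise expresses its inversion. *)
have key (x p q : R) : 2 * (1 - c) * x = (c - 1) * p + s * q -> `|p| <= h * (C * M) ->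
    `|q| <= h * (C * M) -> `|x| <= M / 2.
  move=> E Hp Hq; rewrite -(ler_pM2l (mulr_gt0 (ltr0n R 2) c1')).
  rewrite -[X in X * `|x|](gtr0_norm (mulr_gt0 (ltr0n R 2) c1')) -normrM E.
  apply: le_trans (ler_normD _ _) _; rewrite !normrM.
  have -> : `|c - 1| = 1 - c by rewrite distrC gtr0_norm.
  apply: (@le_trans _ _ ((1 - c) * (h * (C * M)) + `|s| * (h * (C * M)))).
    by apply: lerD; apply: ler_wpM2l => //; apply: ltW.
  have : h * C * (1 - c + `|s|) * M <= (1 - c) * M by apply: ler_wpM2r.
  by move: (`|s|) => s'; lra.
split.
  apply: key Ha Hb; rewrite ra rb.
  rewrite [RHS](_ : _ = (c ^+ 2 + s ^+ 2 + 1 - 2 * c) * a u); last by ring.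
  by rewrite cs; ring.
apply: (key _ (b (u + h *: v) - b u) (- (a (u + h *: v) - a u))) => //; last by rewrite normrN.
rewrite ra rb [RHS](_ : _ = (c ^+ 2 + s ^+ 2 + 1 - 2 * c) * b u); last by ring.
by rewrite cs; ring.
Qed.

(** The function is the real part of exp(-i k t) (a + i b) along the line. It is constant if a + i b
    has derivative i k (a + i b) along [v]. *)
Lemma is_derive_rot v (k : R) a b u (t : R) : smoothr a -> smoothr b ->
  is_derive t 1 (fun t : R => cos (k * t) * a (u + t *: v) + sin (k * t) * b (u + t *: v))
    (cos (k * t) * (dirder v a (u + t *: v) + k * b (u + t *: v)) +
     sin (k * t) * (dirder v b (u + t *: v) - k * a (u + t *: v))).
Proof.
move=> sa sb.
have dk : is_derive t 1 (fun t : R => k * t) k.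
  by have := @is_derive_fcmul R k id t 1 (is_derive_id _ _); rewrite mulr1.
have dc : is_derive t 1 (fun t : R => cos (k * t)) (- sin (k * t) * k).
  exact: (@is_derive1_comp _ cos (fun t : R => k * t)).
have ds : is_derive t 1 (fun t : R => sin (k * t)) (cos (k * t) * k).
  exact: (@is_derive1_comp _ sin (fun t : R => k * t)).
have H := is_derive_fadd (is_derive_fmul dc (is_derive_dir u v t sa))
  (is_derive_fmul ds (is_derive_dir u v t sb)).
by apply: (is_derive_eq H); ring.
Qed.

(** The real part of the defect (D_v - i k)(a + i b); its imaginary part is [dev v (- k) b a]. The
    factor 1 matches the shape of [eigen_lin]. *)
Definition dev v (k : R) a b : 'rV[R]_3 -> R := fun u => 1 * dirder v a u + k * b u.

Lemma eigen_dev (lam : R) v k a b : eigen lam a -> eigen lam b -> eigen lam (dev v k a b).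
Proof. by move=> ea eb; apply: eigen_lin => //; apply: eigen_dirder. Qed.

(** The function [A] takes equal values at 0 and [h], so [A'] vanishes at some c < h, and the defect
    at [u], which is [A'] at 0, is at most h sup|A''|. Each of the two terms of [A''] is at most C M
    + 6 C M, so h C <= 1/28 yields 14 h C M <= M / 2. *)
Lemma rotates_dev_half (lam C h k M : R) v a b :
  (forall f (M : R), eigen lam f -> (forall u, `|f u| <= M) ->
    forall u, `|dirder v f u| <= C * M) ->
  0 < h -> 0 < C -> h * C <= 28^-1 -> `|k| <= 6 * C ->
  eigen lam a -> eigen lam b -> rotates v h (k * h) a b ->
  (forall u, `|dev v k a b u| <= M) -> (forall u, `|dev v (- k) b a u| <= M) ->
  forall u, `|dev v k a b u| <= M / 2.
Proof.
move=> HC h0 C0 hC kC ea eb [ra rb] pM qM u.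
set p := dev v k a b in pM *; set q := dev v (- k) b a in qM.
have ep : eigen lam p by apply: eigen_dev.
have eq : eigen lam q by apply: eigen_dev.
have [sa _ _] := ea; have [sb _ _] := eb; have [sp _ _] := ep; have [sq _ _] := eq.
have M0 : 0 <= M by apply: le_trans (pM 0).
pose A (t : R) := cos (k * t) * a (u + t *: v) + sin (k * t) * b (u + t *: v).
pose A' (t : R) := cos (k * t) * p (u + t *: v) + sin (k * t) * q (u + t *: v).
pose A'' (t : R) := cos (k * t) * (dirder v p (u + t *: v) + k * q (u + t *: v)) +
     sin (k * t) * (dirder v q (u + t *: v) - k * p (u + t *: v)).
have dA (t : R) : is_derive t 1 A (A' t).
  apply: (is_derive_eq (is_derive_rot v k u t sa sb)).
  by rewrite /A' /p /q /dev !mul1r mulNr.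
have dA' (t : R) : is_derive t 1 A' (A'' t) by apply: is_derive_rot.
have cA (g g' : R -> R) (x y : R) : (forall t : R, is_derive t 1 g (g' t)) ->
    {within `[x, y], continuous g}.
  move=> dg; apply: derivable_within_continuous => s _.
  by have [] := dg s.
have AhA0 : A h = A 0.
  rewrite /A ra rb !mulr0 cos0 sin0 scale0r addr0 mul0r mul1r addr0.
  rewrite [LHS](_ : _ = (cos (k * h) ^+ 2 + sin (k * h) ^+ 2) * a u); last by ring.
  by rewrite cos2Dsin2 mul1r.
have [c /itvP c0h] := MVT h0 (fun t _ => dA t) (cA _ _ _ _ dA).
rewrite AhA0 subrr subr0 => /esym/eqP; rewrite mulf_eq0 (gt_eqF h0) orbF => /eqP Ac.
have c0 : 0 < c by rewrite c0h.
have [d _] := MVT c0 (fun t _ => dA' t) (cA _ _ _ _ dA').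
rewrite Ac sub0r subr0 {1}/A' mulr0 cos0 sin0 scale0r addr0 mul0r mul1r addr0 => E.
have A''M : `|A'' d| <= 14 * C * M.
  have kq x : `|k * q x| <= 6 * C * M by rewrite normrM ler_pM.
  have kp x : `|k * p x| <= 6 * C * M by rewrite normrM ler_pM.
  rewrite (_ : 14 * C * M = (C * M + 6 * C * M) + (C * M + 6 * C * M)); last by ring.
  rewrite /A''; apply: le_trans (ler_normD _ _) _; apply: lerD; rewrite normrM.
    apply: le_trans (_ : 1 * _ <= _).
      by apply: ler_wpM2r => //; rewrite ler_norml cos_geN1 cos_le1.
    rewrite mul1r; apply: le_trans (ler_normD _ _) _.
    by apply: lerD => //; exact: (HC _ _ ep).
  apply: le_trans (_ : 1 * _ <= _).
    by apply: ler_wpM2r => //; rewrite ler_norml sin_geN1 sin_le1.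
  rewrite mul1r; apply: le_trans (ler_normB _ _) _.
  by apply: lerD => //; exact: (HC _ _ eq).
rewrite -normrN E normrM (gtr0_norm c0).
apply: le_trans (_ : 14 * C * M * h <= _).
  by apply: ler_pM => //; [exact: ltW|rewrite c0h].
have : h * C * M <= 28^-1 * M by apply: ler_wpM2r.
lra.
Qed.

(* If the translation by h v multiplies a + i b by exp (i k h), then the
   derivative of a + i b along v is exactly i k (a + i b): the defect satisfies
   the same hypotheses, and Rolle's theorem and Bernstein's inequality halve any
   bound on it. *)
Lemma rotates_dev0 (lam C h k : R) v a b : L \in unitmx ->
  (forall f (M : R), eigen lam f -> (forall u, `|f u| <= M) ->
    forall u, `|dirder v f u| <= C * M) ->
  0 < h -> 0 < C -> h * C <= 28^-1 -> `|k| <= 6 * C ->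
  eigen lam a -> eigen lam b -> rotates v h (k * h) a b ->
  forall u, dirder v a u = - k * b u /\ dirder v b u = k * a u.
Proof.
move=> Lu HC h0 C0 hC kC ea eb rab u.
have [Mp HMp] := eigen_bounded Lu (eigen_dev v k ea eb).
have [Mq HMq] := eigen_bounded Lu (eigen_dev v (- k) eb ea).
have eNa : eigen lam (fun u => (-1) * a u + 0 * a u) by apply: eigen_lin.
have rba : rotates v h (k * h) b (fun u => (-1) * a u + 0 * a u).
  by have [ra rb] := rab; split => w; rewrite ?ra ?rb; ring.
have [sa _ _] := ea.
have E1 w : dev v k b (fun u => (-1) * a u + 0 * a u) w = dev v (- k) b a w.
  by rewrite /dev; ring.
have E2 w : dev v (- k) (fun u => (-1) * a u + 0 * a u) b w = - dev v k a b w.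
  by rewrite /dev dirder_lin//; ring.
have [|||D1 D2] := @halving (dev v k a b) (dev v (- k) b a) (Num.max Mp Mq) _ _ _ u.
- by move=> w; rewrite le_max HMp.
- by move=> w; rewrite le_max HMq orbT.
- move=> M pM qM w; split.
    exact: (rotates_dev_half HC h0 C0 hC kC ea eb rab).
  rewrite -E1.
  apply: (rotates_dev_half HC h0 C0 hC kC eb eNa rba) => x; first by rewrite E1.
  by rewrite E2 normrN.
by move: D1 D2; rewrite /dev; lra.
Qed.

End Eigenfunctions.

(** * Character sums over a finite grid *)

Section Grid.
Variable R : realType.

Lemma cosD2piz (x : R) (z : int) : cos (x + 2 * pi * z%:~R) = cos x.
Proof.
have Hn y (n : nat) : cos (y + 2 * pi * n%:R) = cos y :> R.
  by rewrite mulr_natr (mulrC 2) mulr_natr (periodicn (@cosD2pi R)).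
case: z => n; first exact: Hn.
by rewrite NegzE mulrNz mulrN -(Hn _ n.+1) subrK.
Qed.

Lemma sinD2piz (x : R) (z : int) : sin (x + 2 * pi * z%:~R) = sin x.
Proof.
have Hn y (n : nat) : sin (y + 2 * pi * n%:R) = sin y :> R.
  by rewrite mulr_natr (mulrC 2) mulr_natr (periodicn (@sinD2pi R)).
case: z => n; first exact: Hn.
by rewrite NegzE mulrNz mulrN -(Hn _ n.+1) subrK.
Qed.

Lemma cos_neq1 (n : nat) (z : int) : z != 0 -> (`|z|%N < n)%N ->
  cos (2 * pi * z%:~R / n%:R) != 1 :> R.
Proof.
move=> z0 zn; have n0 : (0 : R) < n%:R by rewrite ltr0n (leq_ltn_trans _ zn).
suff H : (0 : R) < `|z|%N%:R / n%:R -> cos (2 * pi * `|z|%N%:R / n%:R) != 1 :> R.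
  have {}H : cos (2 * pi * `|z|%N%:R / n%:R) != 1 :> R.
    by apply: H; rewrite divr_gt0// ltr0n absz_gt0.
  case: z z0 zn H => m _ _ //.
  by rewrite NegzE mulrNz mulrN mulNr cosN.
move=> q0; pose x : R := pi * (`|z|%:R / n%:R).
have -> : 2 * pi * `|z|%N%:R / n%:R = x *+ 2 :> R by rewrite /x -mulr_natl; field; exact: lt0r_neq0.
have sx : 0 < sin x.
  apply: sin_gt0_pi; rewrite mulr_gt0 ?pi_gt0//=.
  by rewrite /x -[ltRHS]mulr1 ltr_pM2l ?pi_gt0// ltr_pdivrMr// mul1r ltr_nat.
rewrite cos_mulr2n; apply/eqP => H.
have := cos2Dsin2 x; nra.
Qed.

Definition incr (i : 'I_3) (w : 'I_3 -> nat) : 'I_3 -> nat := fun k => ((k == i) + w k)%N.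

(** Translation invariance of sums over (Z/n)^3: the cyclic successor permutes the indices, and
    periodicity of [F] identifies its values at n and at 0. *)
Lemma grid_incr n (F : ('I_3 -> nat) -> R) (i : 'I_3) :
  (forall w, F (fun k => w k %% n)%N = F w) ->
  \sum_(j : {ffun 'I_3 -> 'I_n}) F (incr i (fun k => j k)) =
  \sum_(j : {ffun 'I_3 -> 'I_n}) F (fun k => j k).
Proof.
move=> HF.
pose s (j : {ffun 'I_3 -> 'I_n}) := [ffun k => if k == i then ordS (j k) else j k].
pose s' (j : {ffun 'I_3 -> 'I_n}) := [ffun k => if k == i then ord_pred (j k) else j k].
have sK : cancel s s'.
  by move=> j; apply/ffunP => k; rewrite !ffunE; case: eqP => // _; rewrite ordSK.
have s'K : cancel s' s.
  by move=> j; apply/ffunP => k; rewrite !ffunE; case: eqP => // _; rewrite ord_predK.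
rewrite [RHS](reindex s); last by exists s' => j _; rewrite ?sK ?s'K.
apply: eq_bigr => j _; rewrite -HF; congr F; apply/funext => k.
rewrite /incr ffunE; case: eqP => _ /=; first by rewrite add1n.
by rewrite add0n modn_small.
Qed.

(** The argument of the character with frequency [z] of (Z/n)^3, evaluated on natural number
    representatives. *)
Definition gphase n (z : 'I_3 -> int) (w : 'I_3 -> nat) : R :=
  2 * pi / n%:R * \sum_k (z k)%:~R * (w k)%:R.

Lemma gphase_mod n z w : (0 < n)%N ->
  exists m : int, gphase n z w = gphase n z (fun k => w k %% n)%N + 2 * pi * m%:~R.
Proof.
move=> n0; exists (\sum_k z k * (w k %/ n)%:Z); rewrite /gphase.
have nR : n%:R != 0 :> R by rewrite pnatr_eq0 -lt0n.
rewrite rmorph_sum /= !mulr_sumr -big_split /=; apply: eq_bigr => k _.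
rewrite {1}(divn_eq (w k) n) natrD natrM intrM.
by rewrite -[(w k %/ n)%N%:~R]/((w k %/ n)%:R); field.
Qed.

Lemma gphase_incr n z i w : gphase n z (incr i w) = gphase n z w + 2 * pi * (z i)%:~R / n%:R.
Proof.
rewrite /gphase /incr (bigD1 i)//= [in RHS](bigD1 i)//= eqxx natrD.
rewrite [in LHS](eq_bigr (fun k => (z k)%:~R * (w k)%:R)) => [|k /negPf ->//].
by rewrite -[(true : nat)%:R]/(1 : R); ring.
Qed.

(** A step in direction [i] multiplies S + i S' by exp(i b), which differs from 1, yet leaves the
    sum unchanged. The offset [g] later converts cosines into sines. *)
Lemma grid_sum0 n (z : 'I_3 -> int) i (g : R) : (0 < n)%N ->
  cos (2 * pi * (z i)%:~R / n%:R) != 1 :> R ->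
  \sum_(j : {ffun 'I_3 -> 'I_n}) cos (gphase n z (fun k => j k) + g) = 0.
Proof.
move=> n0 c1; set b := 2 * pi * _ / _ in c1.
set S := \sum_j _; pose S' := \sum_(j : {ffun 'I_3 -> 'I_n}) sin (gphase n z (fun k => j k) + g).
have E1 : S = cos b * S - sin b * S'.
  rewrite {1}/S -(@grid_incr n (fun w => cos (gphase n z w + g)) i); last first.
    by move=> w; have [m ->] := gphase_mod z w n0; rewrite addrAC cosD2piz.
  rewrite !mulr_sumr -sumrB; apply: eq_bigr => j _.
  rewrite gphase_incr -/b -(addrA (gphase _ _ _)) (addrC b) addrA (cosD (_ + g) b); ring.
have E2 : S' = sin b * S + cos b * S'.
  rewrite {1}/S' -(@grid_incr n (fun w => sin (gphase n z w + g)) i); last first.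
    by move=> w; have [m ->] := gphase_mod z w n0; rewrite addrAC sinD2piz.
  rewrite !mulr_sumr -big_split; apply: eq_bigr => j _ /=.
  rewrite gphase_incr -/b -(addrA (gphase _ _ _)) (addrC b) addrA (sinD (_ + g) b); ring.
have cs := cos2Dsin2 b.
have : (2 * (1 - cos b)) * S = 0.
  have -> : 2 * (1 - cos b) = (1 - cos b) ^+ 2 + sin b ^+ 2.
    by rewrite [RHS](_ : _ = cos b ^+ 2 + sin b ^+ 2 + 1 - 2 * cos b); [rewrite cs|]; ring.
  have -> : ((1 - cos b) ^+ 2 + sin b ^+ 2) * S =
    (1 - cos b) * (S - (cos b * S - sin b * S')) - sin b * (S' - (sin b * S + cos b * S')) by ring.
  by rewrite -E1 -E2 !subrr !mulr0 subr0.
move/eqP; rewrite mulf_eq0 mulf_eq0 pnatr_eq0 /= subr_eq0 eq_sym (negPf c1) => /eqP.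
by [].
Qed.

End Grid.

(** * Finite Fourier decomposition *)

Section Fourier.
Variables (R : realType) (L : 'M[R]_3).
Hypothesis Lu : L \in unitmx.
Implicit Types (f a b : 'rV[R]_3 -> R) (u v : 'rV[R]_3).

Definition gridpt n (w : 'I_3 -> nat) : 'rV[R]_3 := (\row_i ((w i)%:R / n%:R)) *m L.

Lemma gridpt_mod n f u w : (0 < n)%N -> lperiodic L f ->
  f (u + gridpt n (fun k => w k %% n)%N) = f (u + gridpt n w).
Proof.
move=> n0 pf; have nR : n%:R != 0 :> R by rewrite pnatr_eq0 -lt0n.
pose m : 'rV[int]_3 := \row_k (w k %/ n)%:Z.
rewrite -[LHS](pf (map_mx intr m *m L)); last by exists m.
rewrite -addrA -mulmxDl; congr (f (_ + _ *m _)); apply/rowP => k; rewrite !mxE.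
rewrite [in RHS](divn_eq (w k) n) natrD natrM.
by rewrite -[(w k %/ n)%N%:~R]/((w k %/ n)%:R); field.
Qed.

Lemma gridpt_incr n w i : gridpt n (incr i w) = gridpt n w + n%:R^-1 *: row i L.
Proof.
rewrite rowE scalemxAl -mulmxDl; congr (_ *m _); apply/rowP => k; rewrite !mxE.
by rewrite /incr natrD; case: eqVneq => _;
  [rewrite -[(true : nat)%:R]/(1 : R)|rewrite -[(false : nat)%:R]/(0 : R)]; ring.
Qed.

(** With [gmode_sin], the real and imaginary parts of the grid average of exp(-i gphase) f(u +
    gridpt), that is, of the projection of [f] to the character [z] of the grid translations. *)
Definition gmode_cos n z f u : R := \sum_(j : {ffun 'I_3 -> 'I_n})
  (#|{ffun 'I_3 -> 'I_n}|%:R)^-1 * cos (gphase R n z (fun k => j k)) * f (u + gridpt n (fun k => j k)).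

Definition gmode_sin n z f u : R := \sum_(j : {ffun 'I_3 -> 'I_n})
  - (#|{ffun 'I_3 -> 'I_n}|%:R)^-1 * sin (gphase R n z (fun k => j k)) * f (u + gridpt n (fun k => j k)).

Lemma eigen_fsum (lam : R) (I : finType) (c : I -> R) (h : I -> 'rV[R]_3 -> R) :
  (forall j, eigen L lam (h j)) -> eigen L lam (fun u => \sum_j c j * h j u).
Proof.
move=> H.
have -> : (fun u => \sum_j c j * h j u) =
    (fun u => \sum_(j < #|I|) c (enum_val j) * h (enum_val j) u).
  by apply/funext => u; rewrite (big_enum_val (A := I)).
by apply: eigen_sum => j; apply: H.
Qed.

Lemma eigen_gmode_cos (lam : R) n z f : eigen L lam f -> eigen L lam (gmode_cos n z f).
Proof. by move=> ef; apply: eigen_fsum => j; apply: eigen_shift. Qed.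

Lemma eigen_gmode_sin (lam : R) n z f : eigen L lam f -> eigen L lam (gmode_sin n z f).
Proof. by move=> ef; apply: eigen_fsum => j; apply: eigen_shift. Qed.

Lemma gmode_rotates n z f i : (0 < n)%N -> lperiodic L f ->
  rotates (row i L) n%:R^-1 (2 * pi * (z i)%:~R * n%:R^-1) (gmode_cos n z f) (gmode_sin n z f).
Proof.
move=> n0 pf; set al := _ * _; pose q : R := (#|{ffun 'I_3 -> 'I_n}|%:R)^-1.
have E u w : f (u + n%:R^-1 *: row i L + gridpt n w) = f (u + gridpt n (incr i w)).
  by rewrite gridpt_incr -addrA (addrC (_ *: _)).
have G w : gphase R n z w = gphase R n z (incr i w) - al.
  by rewrite gphase_incr -/al addrK.
have Pc u w : q * cos (gphase R n z (fun k => w k %% n)%N - al) * f (u + gridpt n (fun k => w k %% n)%N)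
    = q * cos (gphase R n z w - al) * f (u + gridpt n w).
  by rewrite gridpt_mod//; have [m ->] := gphase_mod R z w n0; rewrite (addrAC (gphase _ _ _ _)) cosD2piz.
have Ps u w : - q * sin (gphase R n z (fun k => w k %% n)%N - al) * f (u + gridpt n (fun k => w k %% n)%N)
    = - q * sin (gphase R n z w - al) * f (u + gridpt n w).
  by rewrite gridpt_mod//; have [m ->] := gphase_mod R z w n0; rewrite (addrAC (gphase _ _ _ _)) sinD2piz.
split => u.
  rewrite {1}/gmode_cos -/q.
  under eq_bigr do rewrite E G.
  rewrite (@grid_incr R n (fun w => q * cos (gphase R n z w - al) * f (u + gridpt n w)) i (Pc u)).
  rewrite /gmode_cos /gmode_sin -/q !mulr_sumr -sumrB; apply: eq_bigr => j _.
  by rewrite cosB; ring.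
rewrite {1}/gmode_sin -/q.
under eq_bigr do rewrite E G.
rewrite (@grid_incr R n (fun w => - q * sin (gphase R n z w - al) * f (u + gridpt n w)) i (Ps u)).
rewrite /gmode_cos /gmode_sin -/q !mulr_sumr -big_split; apply: eq_bigr => j _ /=.
by rewrite sinB; ring.
Qed.

(** Representatives of the frequencies modulo n in (-n/2, n/2]: the rotation angle of a mode is then
    at most pi, as [rotates_small] requires. *)
Definition centered n (k : {ffun 'I_3 -> 'I_n}) : 'I_3 -> int :=
  fun i => if ((k i).*2 <= n)%N then (k i)%:Z else (k i)%:Z - n%:Z.

Lemma centered_pi n k i : (0 < n)%N ->
  `|2 * pi * (@centered n k i)%:~R * n%:R^-1| <= pi :> R.
Proof.
move=> n0; have nR : 0 < n%:R :> R by rewrite ltr0n.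
rewrite !normrM (ger0_norm (pi_ge0 R)) normr_nat normfV (gtr0_norm nR).
rewrite ler_pdivrMr// -intr_norm (mulrC 2) -mulrA ler_pM2l ?pi_gt0//.
have : ((`|centered k i|%N).*2 <= n)%N.
  rewrite /centered; have := ltn_ord (k i); case: ifP => [//|/negbT]; rewrite -ltnNge => H1 H2.
  rewrite distnC distnEl; last exact: ltnW.
  by rewrite doubleB leq_subLR -addnn leq_add2r ltnW.
by rewrite -(ler_nat R) -muln2 mulnC natrM -abszE.
Qed.

(* Finite Fourier inversion on the grid n^-1 L / L; no limit n -> oo is needed. *)
Lemma gmode_inversion n f u : (0 < n)%N ->
  f u = \sum_(k : {ffun 'I_3 -> 'I_n}) gmode_cos n (centered k) f u.
Proof.
move=> n0; have nR : n%:R != 0 :> R by rewrite pnatr_eq0 -lt0n.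
rewrite /gmode_cos exchange_big /=.
(* Reduction modulo n is undone and the roles of [j] and [k] are exchanged: for a fixed grid point
   [j] the sum over all frequencies [k] becomes a character sum, which vanishes unless [j] is 0. *)
have cE (j k : {ffun 'I_3 -> 'I_n}) : cos (gphase R n (centered k) (fun i => j i)) =
    cos (gphase R n (fun i => (j i)%:Z) (fun i => k i) + 0).
  rewrite -(cosD2piz (gphase R n (centered k) _)
     (\sum_i if ((k i).*2 <= n)%N then 0 else (j i)%:Z)) addr0; congr cos.
  rewrite /gphase rmorph_sum /= !mulr_sumr -big_split /=; apply: eq_bigr => i _.
  rewrite /centered; case: ifP => _; first by rewrite mulr0 addr0 (mulrC (_%:~R)).
  rewrite intrB -[(n%:Z)%:~R]/(n%:R : R) -[((k i)%:Z)%:~R]/((k i)%:R : R).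
  by rewrite -[((j i)%:Z)%:~R]/((j i)%:R : R); field.
pose j0 : {ffun 'I_3 -> 'I_n} := [ffun=> Ordinal n0].
rewrite (bigD1 j0)//= [X in _ + X]big1 ?addr0 => [|j jn0].
  have -> : gridpt n (fun k => j0 k) = 0.
    rewrite /gridpt [X in X *m _](_ : _ = 0) ?mul0mx//.
    by apply/rowP => k; rewrite !mxE ffunE mul0r.
  rewrite (eq_bigr (fun=> (#|{ffun 'I_3 -> 'I_n}|%:R)^-1 * f u)) => [|k _].
    rewrite sumr_const -[RHS]mulr_natl mulrA divff ?mul1r//.
    by rewrite pnatr_eq0 -lt0n; apply/card_gt0P; exists j0.
  rewrite addr0 /gphase big1 ?mulr0 ?cos0 ?mulr1// => i _.
  by rewrite ffunE mulr0.
have [i ji] : exists i, (j i : nat) != 0%N.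
  apply/existsP; apply: contraNT jn0 => /existsPn H; apply/eqP/ffunP => i.
  by rewrite ffunE; apply/val_inj/eqP; have := H i; rewrite negbK.
rewrite -mulr_suml -mulr_sumr.
under eq_bigr do rewrite cE.
rewrite (@grid_sum0 R n (fun i => (j i)%:Z) i 0 n0) ?mulr0 ?mul0r//.
by apply: cos_neq1 => //=; exact: ltn_ord.
Qed.

Lemma const_of_is_derive0 (g : R -> R) : (forall t : R, is_derive t 1 g 0) -> g 1 = g 0.
Proof.
move=> dg.
have cg : {within `[0 : R, 1], continuous g}.
  by apply: derivable_within_continuous => s _; have [] := dg s.
have [c _] := MVT (ltr01 : (0 : R) < 1) (fun t _ => dg t) cg.
by rewrite mul0r => /eqP; rewrite subr_eq0 => /eqP.
Qed.

(* a + i b is multiplied by exp (i k u) along each direction u. *)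
Lemma rotation_trig (k : 'rV[R]_3 -> R) a b : smoothr a -> smoothr b ->
  (forall v u, dirder v a u = - k v * b u) -> (forall v u, dirder v b u = k v * a u) ->
  forall u, a u = a 0 * cos (k u) - b 0 * sin (k u).
Proof.
move=> sa sb da db u.
have E (a' b' : 'rV[R]_3 -> R) : smoothr a' -> smoothr b' ->
    (forall v u, dirder v a' u = - k v * b' u) -> (forall v u, dirder v b' u = k v * a' u) ->
    cos (k u) * a' u + sin (k u) * b' u = a' 0.
  move=> sa' sb' da' db'.
  have := @const_of_is_derive0 (fun t : R => cos (k u * t) * a' (0 + t *: u) + sin (k u * t) * b' (0 + t *: u)).
  rewrite !mulr1 !mulr0 scale1r scale0r !add0r cos0 sin0 mul1r mul0r addr0; apply => t.
  by apply: (is_derive_eq (is_derive_rot u (k u) 0 t sa' sb')); rewrite da' db'; ring.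
have E1 := E a b sa sb da db.
have sN : smoothr (fun u => (-1) * a u + 0 * a u) by apply: smoothr_lin.
have E2 : cos (k u) * b u + sin (k u) * (-1 * a u + 0 * a u) = b 0.
  apply: (E b (fun u => (-1) * a u + 0 * a u)) => // v x; first by rewrite db; ring.
  by rewrite dirder_lin// da; ring.
rewrite -E1 -E2.
rewrite [RHS](_ : _ = (cos (k u) ^+ 2 + sin (k u) ^+ 2) * a u); last by ring.
by rewrite cos2Dsin2 mul1r.
Qed.

Definition trig_form N (xi : 'I_N -> 'rV[R]_3) f := exists p q : 'I_N -> R,
  forall u, f u = \sum_r (p r * cos (theta xi r u) + q r * sin (theta xi r u)).

(** The integers [z i] are the pairings of a dual lattice vector [eta] with the rows of [L], and
    along every direction the mode turns with speed 2 pi <eta, v>. If it is nonzero, the eigenvalue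
    forces |eta| = 1, so [eta] is some [xi r] up to a sign, which the sine absorbs. *)
Lemma rotation_mode_trig N (xi : 'I_N -> 'rV[R]_3) (z : 'I_3 -> int) a b :
  unit_dual_vectors L xi -> eigen L (4 * pi ^+ 2) a -> eigen L (4 * pi ^+ 2) b ->
  (forall i u, dirder (row i L) a u = - (2 * pi * (z i)%:~R) * b u /\
               dirder (row i L) b u = 2 * pi * (z i)%:~R * a u) ->
  trig_form xi a.
Proof.
move=> [_ uxi] ea eb H; have [sa _ la] := ea; have [sb _ _] := eb.
pose zv : 'rV[int]_3 := \row_i z i.
pose eta : 'rV[R]_3 := map_mx intr zv *m invmx L^T.
have LTu : L^T \in unitmx by rewrite unitmx_tr.
have etaL (w : 'rV[R]_3) : dot eta (w *m L) = dot (map_mx intr zv) w.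
  by rewrite dot_mulmx /eta mulmxKV.
pose k (v : 'rV[R]_3) : R := 2 * pi * dot eta v.
have dirE v f u : dirder v f u = \sum_i (v *m invmx L) 0 i * dirder (row i L) f u.
  rewrite /dirder; under [RHS]eq_bigr do rewrite mulr_sumr.
  rewrite exchange_big /=; apply: eq_bigr => j _.
  rewrite -{1}(mulmxKV Lu v) mxE mulr_suml; apply: eq_bigr => i _.
  by rewrite !mxE mulrA.
have kE v : k v = \sum_i (v *m invmx L) 0 i * (2 * pi * (z i)%:~R).
  rewrite /k -{1}(mulmxKV Lu v) etaL /dot mulr_sumr; apply: eq_bigr => i _.
  by rewrite !mxE; ring.
have da v u : dirder v a u = - k v * b u.
  rewrite dirE kE -sumrN mulr_suml; apply: eq_bigr => i _.
  by rewrite (H i u).1; ring.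
have db v u : dirder v b u = k v * a u.
  rewrite dirE kE mulr_suml; apply: eq_bigr => i _.
  by rewrite (H i u).2; ring.
have aE := rotation_trig sa sb da db.
have [az|/existsNP[u0 /eqP au0]] := pselect (forall u, a u = 0).
  exists (fun=> 0), (fun=> 0) => u; rewrite az big1// => r _.
  by rewrite !mul0r addr0.
have pE i f u : pder i f u = dirder (delta_mx 0 i) f u.
  rewrite /dirder (bigD1 i)//= big1 ?addr0 ?mxE ?eqxx ?mul1r// => j ji.
  by rewrite mxE (negPf ji) andbF mul0r.
have kd i : k (delta_mx 0 i) = 2 * pi * eta 0 i by rewrite /k dot_delta.
have eta1 : dot eta eta = 1.
  have pp i : pder i (pder i a) u0 = - (2 * pi * eta 0 i) ^+ 2 * a u0.
    have -> : pder i a = fun u => - k (delta_mx 0 i) * b u + 0 * b u.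
      by apply/funext => u; rewrite pE da mul0r addr0.
    rewrite pE dirder_lin// db kd; ring.
  have := la u0; under eq_bigr do rewrite pp.
  rewrite -mulr_suml => /(mulIf au0); under eq_bigr do rewrite exprMn.
  rewrite sumrN -mulr_sumr => /oppr_inj.
  have P0 : (2 * pi) ^+ 2 != 0 :> R by rewrite sqrf_eq0 mulf_eq0 pnatr_eq0 /= gt_eqF// pi_gt0.
  have -> : 4 * pi ^+ 2 = (2 * pi) ^+ 2 * 1 :> R by ring.
  by move=> /(mulfI P0); under eq_bigr do rewrite expr2.
have etad : dual_lattice L eta.
  move=> v [w ->]; rewrite etaL /dot.
  apply: rpred_sum => i _; apply: rpredM; rewrite mxE; exact: intr_int.
have [r [[Er|Er] _]] := uxi eta etad eta1.
  exists (fun s => if s == r then a 0 else 0), (fun s => if s == r then - b 0 else 0) => u.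
  rewrite (bigD1 r)//= eqxx big1 ?addr0 => [|s /negPf ->]; last by rewrite !mul0r addr0.
  by rewrite aE /theta -Er mulNr.
exists (fun s => if s == r then a 0 else 0), (fun s => if s == r then b 0 else 0) => u.
rewrite (bigD1 r)//= eqxx big1 ?addr0 => [|s /negPf ->]; last by rewrite !mul0r addr0.
by rewrite aE /theta /k Er dotN mulrN cosN sinN mulrN opprK.
Qed.

Lemma trig_form_sum N (xi : 'I_N -> 'rV[R]_3) (I : finType) (h : I -> 'rV[R]_3 -> R) :
  (forall k, trig_form xi (h k)) -> trig_form xi (fun u => \sum_k h k u).
Proof.
move=> /choice[p] /choice[q] H.
exists (fun r => \sum_k p k r), (fun r => \sum_k q k r) => u.
under eq_bigr do rewrite H.
rewrite exchange_big /=; apply: eq_bigr => r _.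
by rewrite big_split /= -!mulr_suml.
Qed.

(** By [rotates_small] a nonzero mode satisfies |2 pi z_i| / n <= 6 C_i / n, which is the bound on
    the speed assumed by [rotates_dev0]. *)
Lemma eigen_trig N (xi : 'I_N -> 'rV[R]_3) f :
  unit_dual_vectors L xi -> eigen L (4 * pi ^+ 2) f -> trig_form xi f.
Proof.
move=> uxi ef; have [_ pf _] := ef.
have lam0 : 0 < 4 * pi ^+ 2 :> R by rewrite mulr_gt0// exprn_gt0// pi_gt0.
have /choice[C HC] : forall i, exists C, 0 < C /\ forall f (M : R), eigen L (4 * pi ^+ 2) f ->
    (forall u, `|f u| <= M) -> forall u, `|dirder (row i L) f u| <= C * M.
  by move=> i; have [C C0 HC] := eigen_dirder_bound (row i L) Lu lam0; exists C.
(* Chosen so that the step 1/n meets the condition [h * C <= 28^-1] in all three lattice directions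
   at once. *)
pose n := (Num.truncn (28 * \sum_i C i)).+1.
have n0 : (0 < n)%N by [].
have nR : 0 < n%:R :> R by rewrite ltr0n.
have hC i : n%:R^-1 * C i <= 28^-1.
  rewrite mulrC ler_pdivrMr// -ler_pdivrMl ?invr_gt0// invrK.
  apply: le_trans (ltW (truncnS_gt _)); rewrite ler_pM2l//.
  by rewrite (bigD1 i)//= lerDl sumr_ge0// => j _; rewrite ltW// (HC j).1.
have -> : f = fun u => \sum_(k : {ffun 'I_3 -> 'I_n}) gmode_cos n (centered k) f u.
  by apply/funext => u; exact: gmode_inversion.
apply: trig_form_sum => k; set z := centered k.
have ea := eigen_gmode_cos n z ef; have eb := eigen_gmode_sin n z ef.
have rab i := @gmode_rotates n z f i n0 pf.
have [az|/existsNP[u0 au0]] := pselect (forall u, gmode_cos n z f u = 0).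
  by exists (fun=> 0), (fun=> 0) => u; rewrite az big1// => r _; rewrite !mul0r addr0.
apply: (rotation_mode_trig uxi ea eb (z := z)) => i u.
apply: (rotates_dev0 Lu (HC i).2 _ (HC i).1 (hC i) _ ea eb (rab i)); first by rewrite invr_gt0.
have hn : 0 < n%:R^-1 :> R by rewrite invr_gt0.
have h8 : n%:R^-1 * C i <= 8^-1 by apply: le_trans (hC i) _; lra.
have [/(_ u0)[]//|] :=
  rotates_small Lu (HC i).2 hn (HC i).1 h8 (centered_pi k i n0) ea eb (rab i).
rewrite normrM [`|n%:R^-1|]gtr0_norm//.
have -> : 6 * (n%:R^-1 * C i) = 6 * C i * n%:R^-1 by ring.
by rewrite ler_pM2r.
Qed.

End Fourier.

(** * Minimal immersions as trigonometric maps *)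

Section Immersion.
Variables (R : realType) (L : 'M[R]_3) (m : nat) (x : 'rV[R]_3 -> 'rV[R]_m.+1).

Definition coordf (j : 'I_m.+1) : 'rV[R]_3 -> R := fun u => x u 0 j.

Lemma partial_coord (y : 'rV[R]_3 -> 'rV[R]_m.+1) i j u : differentiable y u ->
  partial i y u 0 j = pder i (fun u => y u 0 j) u.
Proof.
move=> dy; rewrite pderE /partial derive_mx ?mxE//.
exact: diff_derivable.
Qed.

Lemma differentiable_coordf (y : 'rV[R]_3 -> 'rV[R]_m.+1) j u : differentiable y u ->
  differentiable (fun u => y u 0 j) u.
Proof.
move=> dy; apply: (@differentiable_comp _ _ _ _ y (fun M : 'rV[R]_m.+1 => M 0 j)) => //.
exact: differentiable_coord.
Qed.

Lemma foldr_partial_coord s j : smooth x ->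
  foldr pder (coordf j) s = (fun u => foldr (@partial R m) x s u 0 j).
Proof.
move=> sx; elim: s => //= i s ->.
by apply/funext => u; rewrite partial_coord.
Qed.

Lemma smooth_coordf j : smooth x -> smoothr (coordf j).
Proof.
move=> sx s u; rewrite foldr_partial_coord//; apply: differentiable_coordf.
exact: sx.
Qed.

Lemma pder_dot_cst (f g : 'I_m.+1 -> 'rV[R]_3 -> R) (c : R) i u :
  (forall j, smoothr (f j)) -> (forall j, smoothr (g j)) ->
  (forall u, \sum_j f j u * g j u = c) ->
  \sum_j (pder i (f j) u * g j u + f j u * pder i (g j) u) = 0.
Proof.
move=> sf sg E.
have d (h : 'I_m.+1 -> 'rV[R]_3 -> R) j y : (forall j, smoothr (h j)) -> differentiable (h j) y.
  by move=> sh; exact: (sh j [::] y).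
transitivity (pder i (fun u => \sum_j (f j u * g j u)) u); last first.
  rewrite (_ : (fun u => _) = fun=> c); last by apply/funext.
  by rewrite pderE derive_cst.
rewrite pder_sum => [|j y]; last by apply: differentiableM; apply: d.
apply: eq_bigr => j _; rewrite !pderE.
have df : derivable (f j) u (delta_mx 0 i) by apply: diff_derivable; apply: d.
have dg : derivable (g j) u (delta_mx 0 i) by apply: diff_derivable; apply: d.
rewrite -[X in _ = 'D_ _ X u]/(f j * g j) (deriveM df dg) addrC /GRing.scale /=.
by rewrite (mulrC _ (g j u)).
Qed.

(* Takahashi's theorem; the eigenvalue is the dimension 3 times metric_coef. *)
Lemma minimal_eigen : minimal_isometric_immersion L x ->
  forall j, eigen L (4 * pi ^+ 2) (coordf j).
Proof.
move=> [sx px spx ix mx] j.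
have sc k := smooth_coordf k sx.
have sd i k : smoothr (pder i (coordf k)) by apply: smoothr_pder.
split => // [v Lv u|u]; first by rewrite /coordf (px v).
have p1 i u' k : partial i x u' 0 k = pder i (coordf k) u'.
  by rewrite partial_coord//; exact: (sx [::]).
have p2 i l k u' : partial i (partial l x) u' 0 k = pder i (pder l (coordf k)) u'.
  by have /= := foldr_partial_coord [:: i; l] k sx => ->.
set mu : R := metric_coef R in ix.
have S0 w : \sum_k coordf k w * coordf k w = 1 by exact: spx.
have S1 i w : \sum_k pder i (coordf k) w * coordf k w = 0.
  have := pder_dot_cst i w sc sc S0; rewrite big_split /=.
  rewrite [X in _ + X](eq_bigr (fun k => pder i (coordf k) w * coordf k w)) => [|k _].
    by lra.
  by rewrite mulrC.
have I0 i l w : \sum_k pder i (coordf k) w * pder l (coordf k) w = if i == l then mu else 0.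
  by rewrite -(ix w i l); apply: eq_bigr => k _; rewrite !p1.
have S2 i w : \sum_k pder i (pder i (coordf k)) w * coordf k w = - mu.
  have := pder_dot_cst i w (sd i) sc (S1 i); rewrite big_split /= I0 eqxx.
  by move/eqP; rewrite addr_eq0 => /eqP.
(* The argument that makes the Christoffel symbols of a constant metric vanish: [T] is symmetric in
   its first two indices and antisymmetric in the last two. So the second derivatives used below
   have no tangential part. *)
pose T i l k w := \sum_n pder i (pder l (coordf n)) w * pder k (coordf n) w.
have T1 i l k w : T i l k w + T i k l w = 0.
  have := pder_dot_cst i w (sd l) (sd k) (I0 l k); rewrite big_split /= => H.
  rewrite -[RHS]H; congr (_ + _); apply: eq_bigr => n _; exact: mulrC.
have T2 i l k w : T i l k w = T l i k w.
  by apply: eq_bigr => n _; rewrite pderC.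
have T3 i k w : T i i k w = 0.
  have := T1 k i i w; have := T1 i i k w; rewrite (T2 i k i); lra.
have N i : second_fundamental_form x i i u = partial i (partial i x) u + mu *: x u.
  rewrite /second_fundamental_form /normal_part.
  have -> : dot (partial i (partial i x) u) (x u) = - mu.
    by rewrite -(S2 i u); apply: eq_bigr => k _; rewrite p2.
  rewrite big1 ?subr0 ?scaleNr ?opprK// => l _.
  have -> : dot (partial i (partial i x) u) (partial l x u) = 0.
    by rewrite -(T3 i l u); apply: eq_bigr => k _; rewrite p2 p1.
  by rewrite mul0r scale0r.
have mu0 : mu != 0.
  by rewrite /mu /metric_coef gt_eqF// divr_gt0// mulr_gt0// exprn_gt0// pi_gt0.
have := mx u; rewrite /mean_curvature => /eqP.
rewrite scaler_eq0 invr_eq0 pnatr_eq0 /= -scaler_sumr scaler_eq0 invr_eq0.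
rewrite -/mu (negPf mu0) /= => /eqP/rowP/(_ j).
rewrite summxE mxE.
rewrite (eq_bigr (fun i => pder i (pder i (coordf j)) u + mu * coordf j u)) => [|i _]; last first.
  by rewrite N mxE p2 mxE.
rewrite big_split /= sumr_const card_ord => /eqP; rewrite addr_eq0 => /eqP ->.
rewrite -/(coordf j u) mulNr; congr (- _).
by rewrite /mu /metric_coef; field.
Qed.

Lemma minimal_trig N (xi : 'I_N -> 'rV[R]_3) : L \in unitmx ->
  unit_dual_vectors L xi -> minimal_isometric_immersion L x ->
  exists p q : 'I_N -> 'rV[R]_m.+1,
    forall u, x u = \sum_r (cos (theta xi r u) *: p r + sin (theta xi r u) *: q r).
Proof.
move=> Lu uxi mx.
have /choice[p /choice[q H]] : forall j, trig_form xi (coordf j).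
  by move=> j; apply: eigen_trig uxi (minimal_eigen mx j).
exists (fun r => \row_j p j r), (fun r => \row_j q j r) => u.
apply/rowP => j; rewrite -[LHS]/(coordf j u) H summxE; apply: eq_bigr => r _.
by rewrite !mxE mulrC (mulrC (q j r)).
Qed.

End Immersion.

(** * Unit vectors of the dual lattice *)

Section UnitDual.
Variables (R : realType) (L : 'M[R]_3).

(** The rows of [invmx L^T] are the basis dual to the rows of [L]. *)
Definition of_dual_coord (k : 'rV[int]_3) : 'rV[R]_3 := map_mx intr k *m invmx L^T.

Lemma of_dual_coord_dual k : L \in unitmx -> dual_lattice L (of_dual_coord k).
Proof.
move=> Lu v [w ->]; rewrite dot_mulmx mulmxKV ?unitmx_tr// /dot.
apply: rpred_sum => i _; apply: rpredM; rewrite mxE; exact: intr_int.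
Qed.

Lemma dual_coord xi : L \in unitmx -> dual_lattice L xi ->
  exists k : 'rV[int]_3, xi = of_dual_coord k /\ forall i, (k 0 i)%:~R = dot xi (row i L).
Proof.
move=> Lu dxi.
have /choice[k Hk] : forall i, exists z : int, z%:~R = dot xi (row i L).
  move=> i; have /intrP[z ->] : dot xi (row i L) \is a Num.int; last by exists z.
  apply: dxi; exists (delta_mx 0 i); rewrite rowE; congr (_ *m _).
  by apply/rowP => j; rewrite !mxE; case: (_ && _).
exists (\row_i k i); split => [|i]; last by rewrite mxE Hk.
rewrite /of_dual_coord -[LHS](mulmxK (_ : L^T \in unitmx)) ?unitmx_tr//; congr (_ *m _).
apply/rowP => i; rewrite !mxE Hk; apply: eq_bigr => j _.
by rewrite !mxE.
Qed.

(** The integral coordinates of a dual vector are its pairings with the rows of [L], and the entries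
    of a unit vector are at most 1 in absolute value; [B] bounds these coordinates, which are
    shifted by [B] to become indices. *)
Lemma unit_dual_finite : L \in unitmx -> exists s : seq 'rV[R]_3,
  uniq s /\ forall xi, (xi \in s) <-> (dual_lattice L xi /\ dot xi xi = 1).
Proof.
move=> Lu.
pose B := (Num.truncn (\sum_i \sum_j `|L i j|)).+1.
pose vec (g : {ffun 'I_3 -> 'I_(B + B)}) := of_dual_coord (\row_i ((g i)%:Z - B%:Z)).
exists (undup [seq vec g | g <- enum {ffun 'I_3 -> 'I_(B + B)} & dot (vec g) (vec g) == 1]).
split=> [|xi]; first exact: undup_uniq.
rewrite mem_undup; split=> [/mapP[g]|[dxi xi1]].
  by rewrite mem_filter => /andP[/eqP g1 _] ->; split=> //; apply: of_dual_coord_dual.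
have [k [xiE kE]] := dual_coord Lu dxi.
have kB i : (absz (k 0%R i) < B)%N.
  rewrite -(ltr_nat R) natr_absz intr_norm kE.
  apply: le_lt_trans (truncnS_gt _).
  apply: le_trans (ler_norm_sum _ _ _) _.
  apply: le_trans (_ : \sum_j `|L i j| <= _); last first.
    by rewrite [leRHS](bigD1 i)//= lerDl sumr_ge0// => j _; rewrite sumr_ge0.
  apply: ler_sum => j _; rewrite normrM mxE ler_piMl//.
  exact: norm_coord_le1.
have gP i : (absz (k 0%R i + B%:Z)%R < B + B)%N by have := kB i; lia.
pose g := [ffun i => Ordinal (gP i)].
have gE : vec g = xi.
  rewrite xiE /vec; congr of_dual_coord; apply/rowP => i; rewrite !mxE ffunE /=.
  by have := kB i; lia.
by apply/mapP; exists g; rewrite ?gE// mem_filter gE xi1 eqxx mem_enum.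
Qed.

Lemma unit_dual_exists : L \in unitmx ->
  exists N (xi : 'I_N -> 'rV[R]_3), unit_dual_vectors L xi.
Proof.
move=> Lu; have [s [us sE]] := unit_dual_finite Lu.
have dN v : dual_lattice L v -> dual_lattice L (- v).
  by move=> dv w Lw; rewrite dotN rpredN; apply: dv.
have sN v : v \in s -> - v \in s.
  move=> /sE[dv v1]; apply/sE; split; first exact: dN.
  by rewrite dotN dotC dotN opprK.
have vNv v : v \in s -> v != - v.
  move=> /sE[_ v1]; apply/eqP => vN; have v0 : v = 0.
    have : 2%:R *: v = 0 by rewrite scaler_nat mulr2n {2}vN subrr.
    by move/eqP; rewrite scaler_eq0 pnatr_eq0 /= => /eqP.
  by move: v1; rewrite v0 /dot big1 => [/eqP|i _]; rewrite ?mxE ?mul0r// eq_sym oner_eq0.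
(* Of each pair v, -v the vector listed first is kept. *)
pose s' := [seq v <- s | (index v s < index (- v) s)%N].
have us' : uniq s' by apply: filter_uniq.
exists (size s'), (fun r => s'`_r); split=> [r|eta deta eta1].
  by apply/sE; have := mem_nth 0 (ltn_ord r); rewrite mem_filter => /andP[].
have eta_s : eta \in s by apply/sE.
have idx v : v \in s -> (index v s < index (- v) s)%N || (index (- v) s < index v s)%N.
  move=> vs; rewrite -neq_ltn; apply: contra (vNv _ vs) => /eqP H.
  by rewrite -[v in X in X == _](nth_index 0 vs) H nth_index// sN.
have inj (r1 r2 : 'I_(size s')) : s'`_r1 = s'`_r2 -> r1 = r2.
  by move=> /eqP; rewrite nth_uniq// => /eqP/val_inj.
have notboth v : v \in s' -> - v \in s' -> False.
  rewrite !mem_filter opprK => /andP[H1 _] /andP[H2 _].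
  by have := ltn_trans H1 H2; rewrite ltnn.
have [w [ws' wE]] : exists w, w \in s' /\ (eta = w \/ eta = - w).
  case/orP: (idx _ eta_s) => H; first by exists eta; rewrite mem_filter H eta_s; split=> //; left.
  by exists (- eta); rewrite mem_filter opprK H sN//; split=> //; right.
have rP : (index w s' < size s')%N by rewrite index_mem.
exists (Ordinal rP); split=> /=; first by rewrite nth_index.
move=> r' H; apply: inj; rewrite /= nth_index//.
have r's := mem_nth 0 (ltn_ord r').
case: wE H => -> [] // H.
- by case: (notboth _ r's); rewrite -H.
- by case: (notboth _ ws'); rewrite H.
- by apply: oppr_inj.
Qed.

End UnitDual.

(** * Averaging the metric over translations *)

Section Moments.
Variables (R : realType) (L : 'M[R]_3) (N m : nat) (xi : 'I_N -> 'rV[R]_3).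
Variables (p q : 'I_N -> 'rV[R]_m).
Hypothesis Lu : L \in unitmx.
Hypothesis uxi : unit_dual_vectors L xi.

Lemma unit_dual_neq r s : (xi r = xi s -> r = s) /\ xi r <> - xi s.
Proof.
have [d1 /(_ _)] := uxi; move=> U; have [dr r1] := d1 r; have [ds s1] := d1 s.
have [t [_ tU]] := U _ dr r1.
have trr : t = r by apply: tU; left.
split=> [E|E]; first by rewrite -trr; apply: tU; left.
have ts : t = s by apply: tU; right.
have rs : r = s by rewrite -trr ts.
move: E; rewrite -rs => E; have v0 : xi r = 0.
  have : 2%:R *: xi r = 0 by rewrite scaler_nat mulr2n {2}E subrr.
  by move/eqP; rewrite scaler_eq0 pnatr_eq0 /= => /eqP.
by move: r1; rewrite v0 /dot big1 => [/eqP|i _]; rewrite ?mxE ?mul0r// eq_sym oner_eq0.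
Qed.

(** The derivative of the r-th term of the immersion with respect to its phase [theta xi r u]. *)
Definition velocity r u : 'rV[R]_m := - sin (theta xi r u) *: p r + cos (theta xi r u) *: q r.

(** Products are turned into sums so that each term carries one of the frequencies xi_r + xi_s and
    xi_r - xi_s. *)
Lemma dot_velocity r s u : dot (velocity r u) (velocity s u) =
  (dot (p r) (p s) + dot (q r) (q s)) / 2 * cos (theta xi r u - theta xi s u)
  + (dot (q r) (q s) - dot (p r) (p s)) / 2 * cos (theta xi r u + theta xi s u)
  - (dot (p r) (q s) + dot (q r) (p s)) / 2 * sin (theta xi r u + theta xi s u)
  - (dot (p r) (q s) - dot (q r) (p s)) / 2 * sin (theta xi r u - theta xi s u).
Proof.
rewrite /velocity dotDl !dotDr !dotZl !dotZr sinB sinD cosB cosD.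
by field.
Qed.

Lemma grid_sum_trig n (z : 'I_3 -> int) : (0 < n)%N -> (exists i, z i != 0) ->
  (forall i, `|z i|%N < n)%N ->
  \sum_(j : {ffun 'I_3 -> 'I_n}) cos (gphase R n z (fun k => j k)) = 0 /\
  \sum_(j : {ffun 'I_3 -> 'I_n}) sin (gphase R n z (fun k => j k)) = 0.
Proof.
move=> n0 [i zi] zn; have c1 := cos_neq1 R zi (zn i).
split.
  by rewrite -[RHS](grid_sum0 0 n0 c1); apply: eq_bigr => j _; rewrite addr0.
by rewrite -[RHS](grid_sum0 (- (pi / 2)) n0 c1); apply: eq_bigr => j _; rewrite cosBpihalf.
Qed.

Lemma moment_identity :
  (forall u i j, \sum_r \sum_s xi r 0 i * xi s 0 j * dot (velocity r u) (velocity s u) =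
     (i == j)%:R / 3) ->
  forall i j, \sum_r 3 / 2 * (dot (p r) (p r) + dot (q r) (q r)) * xi r 0 i * xi r 0 j = (i == j)%:R.
Proof.
move=> H i j.
have /choice[k Hk] : forall r, exists k : 'rV[int]_3, xi r = of_dual_coord L k.
  by move=> r; have [k [-> _]] := dual_coord Lu (uxi.1 r).1; exists k.
(* So large that no nonzero sum or difference of two frequencies is trivial on the grid: all its
   coordinates are less than n in absolute value. *)
pose n := (\sum_r \sum_i absz (k r 0%R i) * 2).+1%N.
have n0 : (0 < n)%N by [].
have kn r l : (absz (k r 0%R l) * 2 < n)%N.
  by rewrite ltnS (bigD1 r)//= (bigD1 l)//= -addnA leq_addr.
have thE r w : theta xi r (gridpt L n w) = gphase R n (fun l => k r 0 l) w.
  rewrite /theta /gridpt dot_mulmx Hk /of_dual_coord mulmxKV ?unitmx_tr// /gphase /dot.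
  by rewrite !mulr_sumr; apply: eq_bigr => l _; rewrite !mxE; field; rewrite pnatr_eq0.
have thB r s w : theta xi r (gridpt L n w) - theta xi s (gridpt L n w) =
    gphase R n (fun l => k r 0 l - k s 0 l) w.
  by rewrite !thE /gphase -mulrBr -sumrB; congr (_ * _); apply: eq_bigr => l _; rewrite intrB mulrBl.
have thD r s w : theta xi r (gridpt L n w) + theta xi s (gridpt L n w) =
    gphase R n (fun l => k r 0 l + k s 0 l) w.
  by rewrite !thE /gphase -mulrDr -big_split; congr (_ * _); apply: eq_bigr => l _; rewrite intrD mulrDl.
pose G := {ffun 'I_3 -> 'I_n}.
have G0 : #|{: G}|%:R != 0 :> R.
  by rewrite pnatr_eq0 -lt0n; apply/card_gt0P; exists [ffun=> ord0].
(* The sum frequency is nonzero even for r = s; the difference frequency [zB] needs r and s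
   distinct. Only the terms of r = s with constant phase survive the average. *)
have zD r s : \sum_(w : G) cos (theta xi r (gridpt L n (fun l => w l)) + theta xi s (gridpt L n (fun l => w l))) = 0
    /\ \sum_(w : G) sin (theta xi r (gridpt L n (fun l => w l)) + theta xi s (gridpt L n (fun l => w l))) = 0.
  under eq_bigr do rewrite thD.
  under [X in _ /\ X = _]eq_bigr do rewrite thD.
  apply: grid_sum_trig => // [|l]; last by have := kn r l; have := kn s l; lia.
  apply/existsP; rewrite -[X in is_true X]negbK negb_exists; apply/negP => /forallP E.
  apply: (unit_dual_neq r s).2; rewrite !Hk /of_dual_coord -mulNmx; congr (_ *m _).
  apply/rowP => l; rewrite !mxE -mulrNz; congr (_%:~R).
  by have := E l; rewrite negbK addr_eq0 => /eqP.
have zB r s : r != s ->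
    \sum_(w : G) cos (theta xi r (gridpt L n (fun l => w l)) - theta xi s (gridpt L n (fun l => w l))) = 0
    /\ \sum_(w : G) sin (theta xi r (gridpt L n (fun l => w l)) - theta xi s (gridpt L n (fun l => w l))) = 0.
  move=> rs.
  under eq_bigr do rewrite thB.
  under [X in _ /\ X = _]eq_bigr do rewrite thB.
  apply: grid_sum_trig => // [|l]; last by have := kn r l; have := kn s l; lia.
  apply/existsP; rewrite -[X in is_true X]negbK negb_exists; apply/negP => /forallP E.
  move/eqP: rs; apply; apply: (unit_dual_neq r s).1; rewrite !Hk; congr of_dual_coord.
  by apply/rowP => l; have := E l; rewrite negbK subr_eq0 => /eqP.
have S r s : \sum_(w : G) dot (velocity r (gridpt L n (fun l => w l))) (velocity s (gridpt L n (fun l => w l))) =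
    (r == s)%:R * (#|{: G}|%:R * ((dot (p r) (p r) + dot (q r) (q r)) / 2)).
  under eq_bigr do rewrite dot_velocity.
  rewrite !sumrB big_split /= -!mulr_sumr (zD r s).1 (zD r s).2 !mulr0.
  have [<-|rs] := eqVneq r s.
    have -> : \sum_(w : G) cos (theta xi r (gridpt L n (fun l => w l)) -
        theta xi r (gridpt L n (fun l => w l))) = #|{: G}|%:R.
      by under eq_bigr do rewrite subrr cos0; rewrite sumr_const.
    have -> : \sum_(w : G) sin (theta xi r (gridpt L n (fun l => w l)) -
        theta xi r (gridpt L n (fun l => w l))) = 0.
      by rewrite big1 => // w _; rewrite subrr sin0.
    by rewrite -[(true : nat)%:R]/(1 : R); field.
  by rewrite (zB r s rs).1 (zB r s rs).2 -[(false : nat)%:R]/(0 : R); ring.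
have : \sum_(w : G) \sum_r \sum_s xi r 0 i * xi s 0 j *
    dot (velocity r (gridpt L n (fun l => w l))) (velocity s (gridpt L n (fun l => w l))) =
    #|{: G}|%:R * ((i == j)%:R / 3).
  rewrite (eq_bigr (fun=> (i == j)%:R / 3)) => [|w _]; last exact: H.
  by rewrite sumr_const [RHS]mulr_natl.
rewrite exchange_big /=; under eq_bigr do rewrite exchange_big /=.
under eq_bigr do under eq_bigr do rewrite -mulr_sumr S.
rewrite (eq_bigr (fun r => #|{: G}|%:R *
    (xi r 0 i * xi r 0 j * ((dot (p r) (p r) + dot (q r) (q r)) / 2)))); last first.
  move=> r _; rewrite (bigD1 r)//= eqxx [X in _ + X]big1 => [|s sr].
    by rewrite -[(true : nat)%:R]/(1 : R); ring.
  by rewrite eq_sym (negPf sr) mul0r mulr0.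
rewrite -mulr_sumr => /(mulfI G0) E.
have -> : (i == j)%:R = 3 * ((i == j)%:R / 3) :> R by field.
by rewrite -E mulr_sumr; apply: eq_bigr => r _; field.
Qed.

End Moments.

Section Velocity.
Variables (R : realType) (L : 'M[R]_3) (N m : nat) (xi : 'I_N -> 'rV[R]_3).
Variables (p q : 'I_N -> 'rV[R]_m.+1) (x : 'rV[R]_3 -> 'rV[R]_m.+1).
Hypothesis mx : minimal_isometric_immersion L x.
Hypothesis xE : forall u, x u = \sum_r (cos (theta xi r u) *: p r + sin (theta xi r u) *: q r).

Lemma partial_trig i u :
  partial i x u = (2 * pi) *: \sum_r xi r 0 i *: velocity xi p q r u.
Proof.
have [sx _ _ _ _] := mx.
apply/rowP => j; rewrite partial_coord; last exact: (sx [::]).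
have dth r (t : R) : theta xi r (u + t *: delta_mx 0 i) = theta xi r u + 2 * pi * xi r 0 i * t.
  by rewrite /theta dotDr dotZr dot_delta; ring.
have D1 : is_derive (0 : R) 1 (fun t : R => coordf x j (u + t *: delta_mx 0 i)) (pder i (coordf x j) u).
  have := @is_derive_line R 3 (coordf x j) u (delta_mx 0 i) 0.
  rewrite scale0r addr0 -pderE; apply.
  by apply: differentiable_coordf; exact: (sx [::]).
pose k r : R := 2 * pi * xi r 0 i.
have dk r : is_derive (0 : R) 1 (fun t : R => theta xi r u + k r * t) (k r).
  have H1 := is_derive_fcmul (k r) (is_derive_id (0 : R) 1).
  have := is_derive_fadd (is_derive_cst (theta xi r u) (0 : R) 1) H1.
  by rewrite add0r mulr1.
have D2 : is_derive (0 : R) 1 (fun t : R => coordf x j (u + t *: delta_mx 0 i))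
    (\sum_r (p r 0 j * (- sin (theta xi r u + k r * 0) * k r) + q r 0 j * (cos (theta xi r u + k r * 0) * k r))).
  have -> : (fun t : R => coordf x j (u + t *: delta_mx 0 i)) =
     (fun t : R => \sum_r (p r 0 j * cos (theta xi r u + k r * t) + q r 0 j * sin (theta xi r u + k r * t))).
    apply/funext => t; rewrite /coordf xE summxE; apply: eq_bigr => r _.
    by rewrite !mxE dth -/(k r) mulrC (mulrC (sin _)).
  apply: is_derive_fsum => r; apply: is_derive_fadd; apply: is_derive_fcmul.
rewrite -/(coordf x j).
have -> : pder i (coordf x j) u = \sum_r (p r 0 j * (- sin (theta xi r u + k r * 0) * k r) +
    q r 0 j * (cos (theta xi r u + k r * 0) * k r)).
  by have [_ <-] := D1; have [_ <-] := D2.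
rewrite mxE summxE mulr_sumr; apply: eq_bigr => r _.
by rewrite /velocity !mxE mulr0 addr0 /k; ring.
Qed.

(** The differential of [x] applied to [w] is 2 pi times the sum on the left, and the metric
    coefficient 4 pi^2 / 3 leaves 1/3. *)
Lemma velocity_metric u (w w' : 'rV[R]_3) :
  dot (\sum_r dot (xi r) w *: velocity xi p q r u) (\sum_r dot (xi r) w' *: velocity xi p q r u)
  = dot w w' / 3.
Proof.
have [_ _ _ ix _] := mx.
have E (v : 'rV[R]_3) : \sum_r dot (xi r) v *: velocity xi p q r u = (2 * pi)^-1 *: \sum_i v 0 i *: partial i x u.
  under [in RHS]eq_bigr do rewrite partial_trig scalerA mulrC -scalerA scaler_sumr.
  rewrite -scaler_sumr scalerA mulVf ?scale1r; last first.
    by rewrite mulf_neq0// ?pnatr_eq0// gt_eqF// pi_gt0.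
  rewrite exchange_big /=; apply: eq_bigr => r _.
  rewrite /dot scaler_suml; apply: eq_bigr => i _.
  by rewrite scalerA mulrC.
rewrite !E dotZl dotZr dot_suml.
have H i : dot (w 0 i *: partial i x u) (\sum_j w' 0 j *: partial j x u) =
    metric_coef R * (w 0 i * w' 0 i).
  rewrite dotZl dot_sumr (bigD1 i)//= [X in _ + X]big1 => [|j ji].
    by rewrite dotZr (ix u i i) eqxx; ring.
  by rewrite dotZr (ix u i j) eq_sym (negPf ji) mulr0.
rewrite (eq_bigr _ (fun i _ => H i)) -mulr_sumr /dot; move: (\sum_i _) => d.
have P0 : pi != 0 :> R by rewrite gt_eqF// pi_gt0.
by rewrite /metric_coef; move: (pi : R) P0 => P P0; field; rewrite P0.
Qed.

Lemma minimal_moment : L \in unitmx -> unit_dual_vectors L xi -> forall i j,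
  \sum_r 3 / 2 * (dot (p r) (p r) + dot (q r) (q r)) * xi r 0 i * xi r 0 j = (i == j)%:R.
Proof.
move=> Lu uxi; apply: (moment_identity Lu uxi) => u i j.
have := velocity_metric u (delta_mx 0 i) (delta_mx 0 j).
rewrite dot_delta mxE eqxx /= eq_sym => <-.
rewrite dot_suml; apply: eq_bigr => r _.
rewrite dotZl dot_sumr dot_delta mulr_sumr; apply: eq_bigr => s _.
by rewrite dotZr dot_delta mulrA.
Qed.

End Velocity.

(** * Rational spans and subfields *)

Section RationalSpan.
Variable R : realType.
Implicit Types (d s : nat).

Lemma rat_combD d (e : 'I_d -> R) c c' :
  rat_comb e (fun i => c i + c' i) = rat_comb e c + rat_comb e c'.
Proof. by rewrite /rat_comb -big_split; apply: eq_bigr => i _; rewrite rmorphD mulrDl. Qed.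

Lemma rat_combZ d (e : 'I_d -> R) c a :
  rat_comb e (fun i => a * c i) = ratr a * rat_comb e c.
Proof. by rewrite /rat_comb mulr_sumr; apply: eq_bigr => i _; rewrite rmorphM mulrA. Qed.

Lemma rat_comb_delta d (e : 'I_d -> R) i : rat_comb e (fun j => (j == i)%:R) = e i.
Proof.
rewrite /rat_comb (bigD1 i)//= eqxx rmorph1 mul1r big1 ?addr0// => j /negPf ->.
by rewrite rmorph0 mul0r.
Qed.

Lemma rat_comb_mx d s (e : 'I_d -> R) (g : 'I_s -> R) (M : 'M[rat]_(d, s)) (c : 'rV[rat]_d) :
  (forall i, e i = rat_comb g (M i)) ->
  rat_comb e (c 0) = rat_comb g ((c *m M) 0).
Proof.
move=> eM; rewrite /rat_comb; under eq_bigr do rewrite eM /rat_comb mulr_sumr.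
rewrite exchange_big /=; apply: eq_bigr => j _.
rewrite mxE rmorph_sum mulr_suml; apply: eq_bigr => i _ /=.
by rewrite rmorphM mulrA.
Qed.

Definition rat_free d (e : 'I_d -> R) := forall c, rat_comb e c = 0 -> forall i, c i = 0.

Lemma rat_free_leq d s (e : 'I_d -> R) (g : 'I_s -> R) : rat_free e ->
  (forall i, range (rat_comb g) (e i)) -> (d <= s)%N.
Proof.
move=> fe eg; have /choice[M HM] : forall i, exists c, rat_comb g c = e i.
  by move=> i; have [c _ H] := eg i; exists c.
pose A : 'M[rat]_(d, s) := \matrix_(i, j) M i j.
have eA i : e i = rat_comb g (A i).
  by rewrite -HM /rat_comb; apply: eq_bigr => j _; rewrite mxE.
rewrite leqNgt; apply/negP => sd.
have : kermx A != 0.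
  rewrite -mxrank_eq0 mxrank_ker -lt0n subn_gt0.
  exact: leq_ltn_trans (rank_leq_col A) sd.
move=> /rowV0Pn[v /sub_kermxP vA v0].
move/eqP: v0; apply; apply/rowP => i; rewrite mxE; apply: (fe (v 0)).
by rewrite (rat_comb_mx v eA) vA /rat_comb big1 // => j _; rewrite mxE rmorph0 mul0r.
Qed.

Lemma degree_over_rat_leq (K : set R) d s (g : 'I_s -> R) :
  K `<=` range (rat_comb g) -> degree_over_rat K d -> (d <= s)%N.
Proof.
move=> Kg [e [fe KE]]; apply: (rat_free_leq fe) => i; apply: Kg; rewrite KE.
by exists (fun j => (j == i)%:R) => //; exact: rat_comb_delta.
Qed.

(** A free family in [K] has at most [s] members; one of maximal size spans [K], because a vector
    outside its span could be appended. *)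
Lemma degree_over_rat_exists (K : set R) s (g : 'I_s -> R) :
  K `<=` range (rat_comb g) -> K 0 -> (forall a b, K a -> K b -> K (a + b)) ->
  (forall (a : rat) b, K b -> K (ratr a * b)) ->
  exists2 d, degree_over_rat K d & (d <= s)%N.
Proof.
move=> Kg K0 KD KZ.
have Kc d (e : 'I_d -> R) c : (forall i, K (e i)) -> K (rat_comb e c).
  move=> Ke; rewrite /rat_comb; elim/big_rec: _ => // i y _ Ky.
  by apply: KD => //; apply: KZ.
pose P d := `[< exists e : 'I_d -> R, rat_free e /\ forall i, K (e i) >].
have P0 : exists d, P d.
  by exists 0%N; apply/asboolP; exists (fun=> 0); split => [c _|] [].
have Ps d : P d -> (d <= s)%N.
  by move=> /asboolP[e [fe Ke]]; apply: (rat_free_leq fe) => i; apply: Kg.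
have [d /asboolP[e [fe Ke]] dmax] := ex_maxnP P0 Ps.
exists d; last by apply: Ps; apply/asboolP; exists e.
exists e; split => //; apply/seteqP; split => [v Kv|_ [c _ <-]]; last exact: Kc.
apply: contrapT => nv.
pose e' (i : 'I_d.+1) := if unlift ord_max i is Some j then e j else v.
suff : (d.+1 <= d)%N by rewrite ltnn.
apply: dmax; apply/asboolP; exists e'; split; last first.
  by move=> i; rewrite /e'; case: unliftP.
move=> c; rewrite /rat_comb big_ord_recr /= => H.
have e'w i : e' (widen_ord (leqnSn d) i) = e i.
  have -> : widen_ord (leqnSn d) i = lift ord_max i.
    by apply/val_inj/esym; exact: lift_max.
  by rewrite /e' liftK.
have e'm : e' ord_max = v by rewrite /e' unlift_none.
move: H; rewrite e'm; under eq_bigr do rewrite e'w.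
pose c' (i : 'I_d) := c (widen_ord (leqnSn d) i); rewrite -/(rat_comb e c') => H.
have cm : c ord_max = 0.
  apply/eqP/negPn/negP => cn0; apply: nv.
  exists (fun i => - (c ord_max)^-1 * c' i) => //; rewrite rat_combZ.
  move/eqP: H; rewrite addr_eq0 => /eqP ->.
  by rewrite rmorphN fmorphV mulrNN mulrA mulVf ?mul1r// fmorph_eq0.
move=> i; have [j ->|->] := unliftP ord_max i; last exact: cm.
have -> : lift ord_max j = widen_ord (leqnSn d) j by apply/val_inj; exact: lift_max.
by apply: (fe c'); rewrite -[LHS]addr0 -{2}H cm rmorph0 mul0r !addr0.
Qed.

(** Multiplication by a nonzero element is an injective linear map of a finite-dimensional rational
    space, hence surjective, so 1 is attained. As [g] may be dependent, a basis [e] is extracted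
    first. *)
Lemma rat_span_divring s (g : 'I_s -> R) :
  range (rat_comb g) 1 -> (forall i j, range (rat_comb g) (g i * g j)) ->
  divring_closed (mem (range (rat_comb g))).
Proof.
set K := range _ => K1 Kg.
have KD a b : K a -> K b -> K (a + b).
  by move=> [c _ <-] [c' _ <-]; exists (fun i => c i + c' i); rewrite ?rat_combD.
have KZ (a : rat) b : K b -> K (ratr a * b).
  by move=> [c _ <-]; exists (fun i => a * c i); rewrite ?rat_combZ.
have K0 : K 0 by exists (fun=> 0) => //; rewrite /rat_comb big1// => i _; rewrite rmorph0 mul0r.
have Ks (I : Type) (r : seq I) (F : I -> R) : (forall i, K (F i)) -> K (\sum_(i <- r) F i).
  by move=> KF; elim/big_rec: _ => // i y _ Ky; apply: KD.
have KM a b : K a -> K b -> K (a * b).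
  move=> [c _ <-] [c' _ <-]; rewrite /rat_comb mulr_suml.
  apply: (Ks) => i; rewrite mulr_sumr; apply: (Ks) => j.
  by rewrite mulrACA -rmorphM; apply: KZ.
have KN a : K a -> K (- a) by move=> Ka; rewrite -mulN1r -(rmorph1 (@ratr R)) -rmorphN; apply: KZ.
have [d [e [fe KE]] _] := degree_over_rat_exists (K := K) (g := g) (@subset_refl _ K) K0 KD KZ.
have Ke i : K (e i) by rewrite KE; exists (fun j => (j == i)%:R) => //; exact: rat_comb_delta.
have KV a : K a -> K a^-1.
  move=> Ka; have [->|a0] := eqVneq a 0; first by rewrite invr0.
  have /choice[M HM] : forall i, exists c, rat_comb e c = a * e i.
    by move=> i; have := KM _ _ Ka (Ke i); rewrite KE => -[c _ <-]; exists c.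
  pose A : 'M[rat]_d := \matrix_(i, j) M i j.
  have eA i : a * e i = rat_comb e (A i).
    by rewrite -HM /rat_comb; apply: eq_bigr => j _; rewrite mxE.
  have aE (c : 'rV[rat]_d) : a * rat_comb e (c 0) = rat_comb e ((c *m A) 0).
    rewrite -(rat_comb_mx (e := fun i => a * e i) c eA) /rat_comb mulr_sumr.
    by apply: eq_bigr => i _; rewrite mulrCA.
  have Au : A \in unitmx.
    rewrite -row_free_unit -kermx_eq0; apply/negPn/negP => /rowV0Pn[v /sub_kermxP vA v0].
    move/eqP: v0; apply; apply/rowP => i; rewrite mxE; apply: (fe (v 0)).
    apply: (mulfI a0); rewrite aE vA mulr0 /rat_comb big1 // => j _.
    by rewrite mxE rmorph0 mul0r.
  have [c _ c1] : range (rat_comb e) 1 by rewrite -KE.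
  pose cv : 'rV[rat]_d := \row_i c i.
  have -> : a^-1 = rat_comb e ((cv *m invmx A) 0).
    apply: (mulfI a0); rewrite mulfV// aE mulmxKV// -c1 /rat_comb.
    by apply: eq_bigr => i _; rewrite mxE.
  rewrite KE; by exists ((cv *m invmx A) 0).
split=> [|a b|a b]; rewrite !inE //.
  by move=> Ka Kb; apply: KD => //; apply: KN.
by move=> Ka Kb; apply: KM => //; apply: KV.
Qed.

End RationalSpan.

Section Subfield.
Variables (R : realType) (K : set R).
Hypothesis fK : divring_closed (mem K).

Definition subfield_pred : {pred R} := mem K.
HB.instance Definition _ := GRing.isDivringClosed.Build R subfield_pred fK.

Lemma subfieldE (a : R) : K a <-> a \in subfield_pred.
Proof. by rewrite /subfield_pred inE. Qed.

Lemma subfield0 : K 0.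
Proof. by apply/subfieldE; rewrite rpred0. Qed.

Lemma subfield1 : K 1.
Proof. by apply/subfieldE; rewrite rpred1. Qed.

Lemma subfieldD a b : K a -> K b -> K (a + b).
Proof. by move=> /subfieldE Ka /subfieldE Kb; apply/subfieldE; rewrite rpredD. Qed.

Lemma subfieldM a b : K a -> K b -> K (a * b).
Proof. by move=> /subfieldE Ka /subfieldE Kb; apply/subfieldE; rewrite rpredM. Qed.

Lemma subfieldV a : K a -> K a^-1.
Proof. by move=> /subfieldE Ka; apply/subfieldE; rewrite rpredV. Qed.

Lemma subfield_ratr (a : rat) : K (ratr a).
Proof. by apply/subfieldE; rewrite rpred_rat. Qed.

Definition subfield_mx n m (M : 'M[R]_(n, m)) := forall i j, K (M i j).

Lemma subfield_mulmx n m l (A : 'M[R]_(n, m)) (B : 'M[R]_(m, l)) :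
  subfield_mx A -> subfield_mx B -> subfield_mx (A *m B).
Proof.
move=> KA KB i j; apply/subfieldE; rewrite mxE rpred_sum// => k _.
by rewrite rpredM//; apply/subfieldE.
Qed.

Lemma subfield_trmx n m (A : 'M[R]_(n, m)) : subfield_mx A -> subfield_mx A^T.
Proof. by move=> KA i j; rewrite mxE. Qed.

Lemma subfield_ratmx n m (A : 'M[rat]_(n, m)) : subfield_mx (map_mx (@ratr R) A).
Proof. by move=> i j; rewrite mxE; exact: subfield_ratr. Qed.

Lemma subfield_det n (A : 'M[R]_n) : subfield_mx A -> K (\det A).
Proof.
move=> KA; apply/subfieldE; rewrite rpred_sum// => s _.
by rewrite rpredM ?rpred_sign// rpred_prod// => i _; apply/subfieldE.
Qed.

Lemma subfield_invmx n (A : 'M[R]_n) : subfield_mx A -> subfield_mx (invmx A).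
Proof.
(* The [invmx] of a singular matrix is the matrix itself; otherwise the cofactor formula applies. *)
move=> KA i j; rewrite /invmx; case: ifP => _ //.
rewrite !mxE; apply/subfieldE; rewrite rpredM// ?rpredV; last first.
  rewrite /cofactor rpredM ?rpred_sign//; apply/subfieldE.
  by apply: subfield_det => k l; rewrite !mxE.
by apply/subfieldE; apply: subfield_det.
Qed.

End Subfield.

Section GramField.
Variables (R : realType) (L : 'M[R]_3).

Lemma gram_field_divring : divring_closed (mem (gram_field L)).
Proof.
have H (P : R -> R -> R) : (forall K : set R, divring_closed (mem K) -> forall a b, K a -> K b -> K (P a b)) ->
    forall a b, gram_field L a -> gram_field L b -> gram_field L (P a b).
  move=> HP a b Ka Kb K [fK GK]; apply: HP => //; [exact: Ka|exact: Kb].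
split=> [|a b|a b]; rewrite ?inE.
- by move=> K [[K1 _ _] _]; move: K1; rewrite inE.
- apply: (H (fun a b => a - b)) => K [_ KB _] x y Kx Ky.
  by have := KB x y; rewrite !inE; apply.
- apply: (H (fun a b => a / b)) => K [_ _ KB] x y Kx Ky.
  by have := KB x y; rewrite !inE; apply.
Qed.

Lemma gram_field_sub (K : set R) : divring_closed (mem K) -> subfield_mx K (gram L) ->
  gram_field L `<=` K.
Proof. by move=> fK KG; apply: smallest_sub => // _ [i [j ->]]; exact: KG. Qed.

Lemma gram_in_GL : L \in unitmx -> in_GL (gram_field L) (gram L).
Proof.
move=> Lu; have KG : subfield_mx (gram_field L) (gram L).
  by move=> i j; apply: sub_gen_smallest; exists i, j.
have Gu : gram L \in unitmx by rewrite unitmx_mul Lu unitmx_tr.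
split=> //; exists (invmx (gram L)); split; [|exact: mulmxV|exact: mulVmx].
by apply: subfield_invmx => //; exact: gram_field_divring.
Qed.

Lemma gram_degree s (g : 'I_s -> R) : gram_field L `<=` range (rat_comb g) ->
  exists2 d, degree_over_rat (gram_field L) d & (d <= s)%N.
Proof.
move=> Kg; have fK := gram_field_divring.
apply: (degree_over_rat_exists Kg) => [|a b|a b].
- exact: (subfield0 fK).
- exact: (subfieldD fK).
- by apply: (subfieldM fK); exact: (subfield_ratr fK).
Qed.

End GramField.

(** * Fields spanned by two or four elements *)

Section NumberFields.
Variable R : realType.
Implicit Types (a b c x y z : R).

Definition rational a := exists q : rat, a = ratr q.

Lemma rational_rat (q : rat) : rational (ratr q). Proof. by exists q. Qed.
Lemma rational_nat n : rational n%:R. Proof. by exists n%:R; rewrite rmorph_nat. Qed.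
Lemma rational1 : rational 1. Proof. exact: (rational_nat 1). Qed.
Lemma rational0 : rational 0. Proof. exact: (rational_nat 0). Qed.
Lemma rationalD a b : rational a -> rational b -> rational (a + b).
Proof. by move=> [p ->] [q ->]; exists (p + q); rewrite rmorphD. Qed.
Lemma rationalM a b : rational a -> rational b -> rational (a * b).
Proof. by move=> [p ->] [q ->]; exists (p * q); rewrite rmorphM. Qed.
Lemma rationalN a : rational a -> rational (- a).
Proof. by move=> [p ->]; exists (- p); rewrite rmorphN. Qed.
Lemma rationalV a : rational a -> rational a^-1.
Proof. by move=> [p ->]; exists p^-1; rewrite fmorphV. Qed.
Lemma rationalX a n : rational a -> rational (a ^+ n).
Proof. by move=> [p ->]; exists (p ^+ n); rewrite rmorphXn. Qed.

Hint Resolve rational_rat rational_nat rational1 rational0 rationalD rationalM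
  rationalN rationalV rationalX : rational_db.

(** The generators 1 and [s] may be dependent, so a rational [s] is covered. *)
Lemma quadratic_field (s : R) : (exists a b, [/\ rational a, rational b & s ^+ 2 = a + b * s]) ->
  exists g : 'I_2 -> R, divring_closed (mem (range (rat_comb g))) /\ range (rat_comb g) s.
Proof.
move=> [_ [_ [[a ->] [b ->] E]]].
exists (fun i => s ^+ i).
have spanI p q : range (rat_comb (fun i : 'I_2 => s ^+ i)) (ratr p + ratr q * s).
  exists (fun i => if i == ord0 then p else q) => //.
  by rewrite /rat_comb !big_ord_recl big_ord0 /= addr0 expr0 mulr1 expr1.
have S1 : range (rat_comb (fun i : 'I_2 => s ^+ i)) s.
  by have := spanI 0 1; rewrite rmorph1 rmorph0 mul1r add0r.
have S0 : range (rat_comb (fun i : 'I_2 => s ^+ i)) 1.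
  have := spanI 1 0; by rewrite rmorph1 rmorph0 mul0r addr0.
split=> //; apply: rat_span_divring => // i j; rewrite -exprD.
have: (i + j < 3)%N by have := ltn_ord i; have := ltn_ord j; lia.
case: (i + j)%N => [|[|[|//]]] _; [by rewrite expr0|by rewrite expr1|by rewrite E].
Qed.

(* The equations let X^2 and X Y be expressed by 1, X, Y, Y^2, and then also Y^3. *)
Lemma quartic_field (X Y Z a b c c0 : R) :
  rational a -> rational b -> rational c -> rational c0 ->
  Y * Z - a * X = X * Z - b * Y -> X * Z - b * Y = X * Y - c * Z -> X + Y + Z = c0 ->
  exists g : 'I_4 -> R, [/\ divring_closed (mem (range (rat_comb g))),
    range (rat_comb g) X, range (rat_comb g) Y & range (rat_comb g) Z].
Proof.
move=> ra rb rc r0 E1 E2 E3.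
pose g (i : 'I_4) : R := [tuple 1; X; Y; Y ^+ 2]`_i.
exists g; set V := range _.
have VI p q r s : rational p -> rational q -> rational r -> rational s ->
    V (p + q * X + r * Y + s * Y ^+ 2).
  move=> [p' ->] [q' ->] [r' ->] [s' ->].
  exists (fun i : 'I_4 => [tuple p'; q'; r'; s']`_i) => //.
  by rewrite /rat_comb !big_ord_recl big_ord0 /g /= mulr1 addr0 !addrA.
have VE v : V v -> exists p q r s, [/\ rational p, rational q, rational r, rational s &
    v = p + q * X + r * Y + s * Y ^+ 2].
  move=> [f _ <-]; exists (ratr (f ord0)), (ratr (f (lift ord0 ord0))),
    (ratr (f (lift ord0 (lift ord0 ord0)))), (ratr (f (lift ord0 (lift ord0 (lift ord0 ord0))))).
  split; auto with rational_db.
  by rewrite /rat_comb !big_ord_recl big_ord0 /g /= mulr1 addr0 !addrA.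
have VD u v : V u -> V v -> V (u + v).
  move=> /VE[p [q [r [s [Hp Hq Hr Hs ->]]]]] /VE[p' [q' [r' [s' [Hp' Hq' Hr' Hs' ->]]]]].
  rewrite [X in V X](_ : _ = (p + p') + (q + q') * X + (r + r') * Y + (s + s') * Y ^+ 2); last by ring.
  by apply: VI; auto with rational_db.
have VZ k v : rational k -> V v -> V (k * v).
  move=> Hk /VE[p [q [r [s [Hp Hq Hr Hs ->]]]]].
  rewrite [X in V X](_ : _ = k * p + (k * q) * X + (k * r) * Y + (k * s) * Y ^+ 2); last by ring.
  by apply: VI; auto with rational_db.
have V1 : V 1.
  rewrite [X in V X](_ : _ = 1 + 0 * X + 0 * Y + 0 * Y ^+ 2); last by ring.
  by apply: VI; auto with rational_db.
have VX : V X.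
  rewrite [A in V A](_ : _ = 0 + 1 * X + 0 * Y + 0 * Y ^+ 2); last by ring.
  by apply: VI; auto with rational_db.
have VY : V Y.
  rewrite [A in V A](_ : _ = 0 + 0 * X + 1 * Y + 0 * Y ^+ 2); last by ring.
  by apply: VI; auto with rational_db.
have VYY : V (Y ^+ 2).
  rewrite [A in V A](_ : _ = 0 + 0 * X + 0 * Y + 1 * Y ^+ 2); last by ring.
  by apply: VI; auto with rational_db.
have ZE : Z = c0 - X - Y by rewrite -E3; ring.
(* Once [Z] is eliminated, X Y cancels from [E1], which leaves an expression for X^2; inserted into
   [E2], it yields X Y. *)
pose m1 := c0 + a; pose m2 := - (c0 + b).
have Hm1 : rational m1 by rewrite /m1; auto with rational_db.
have Hm2 : rational m2 by rewrite /m2; auto with rational_db.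
have XXE : X * X = Y ^+ 2 + m1 * X + m2 * Y.
  by move: E1; rewrite ZE /m1 /m2; lra.
pose l1 := (c0 - c - m1) / 2; pose l2 : R := - (b + c + m2) / 2; pose l3 := c * c0 / 2.
have Hl1 : rational l1 by rewrite /l1; auto 10 with rational_db.
have Hl2 : rational l2 by rewrite /l2; auto 10 with rational_db.
have Hl3 : rational l3 by rewrite /l3; auto 10 with rational_db.
have XYE : X * Y = - 2^-1 * Y ^+ 2 + l1 * X + l2 * Y + l3.
  by move: E2 XXE; rewrite ZE /l1 /l2 /l3 /m1 /m2; lra.
have H2 : rational (- 2^-1) by auto with rational_db.
have VXX : V (X * X) by rewrite XXE; do !apply: (VD) => //; apply: (VZ).
have VXY : V (X * Y).
  rewrite XYE -[l3]mulr1; do !apply: (VD) => //; apply: (VZ) => //.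
(* X^2 Y is reduced in two ways: through X Y twice, with leading term Y^3 / 4, and through X^2, with
   leading term Y^3. The difference has coefficient 3/4, whence the factor 4/3. *)
have YYYE : Y ^+ 2 * Y = (4 / 3) * ((- (l1 / 2) - m1) * (X * Y) + (- (l2 / 2) - m2) * Y ^+ 2
     + (- (l3 / 2)) * Y + l1 * (X * X) + l2 * (X * Y) + l3 * X).
  have T1 : X * (X * Y) = - 2^-1 * (X * Y * Y) + l1 * (X * X) + l2 * (X * Y) + l3 * X.
    by rewrite {1}XYE; ring.
  have T2 : X * Y * Y = - 2^-1 * (Y ^+ 2 * Y) + l1 * (X * Y) + l2 * Y ^+ 2 + l3 * Y.
    by rewrite {1}XYE; ring.
  have T3 : X * (X * Y) = Y ^+ 2 * Y + m1 * (X * Y) + m2 * Y ^+ 2.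
    by rewrite mulrA XXE; ring.
  by move: T1; rewrite T2 T3; lra.
have VYYY : V (Y ^+ 2 * Y).
  rewrite YYYE; apply: (VZ); first by auto with rational_db.
  by do !apply: (VD) => //; apply: (VZ) => //; auto 10 with rational_db.
have VmulY v : V v -> V (v * Y).
  move=> /VE[p [q [r [s [Hp Hq Hr Hs ->]]]]].
  rewrite [A in V A](_ : _ = p * Y + q * (X * Y) + r * Y ^+ 2 + s * (Y ^+ 2 * Y)); last by ring.
  by do !apply: (VD) => //; apply: (VZ).
have VmulX v : V v -> V (v * X).
  move=> /VE[p [q [r [s [Hp Hq Hr Hs ->]]]]].
  rewrite [A in V A](_ : _ = p * X + q * (X * X) + r * (X * Y) + s * (X * Y * Y)); last by ring.
  by do !apply: (VD) => //; apply: (VZ) => //; apply: (VmulY).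
have Vg i : V (g i) by case: i => [[|[|[|[|//]]]] Hi]; rewrite /g /=.
split => //; last first.
  rewrite [A in V A](_ : _ = c0 + (-1) * X + (-1) * Y + 0 * Y ^+ 2); last by rewrite ZE; ring.
  by apply: VI; auto with rational_db.
apply: rat_span_divring => // i [[|[|[|[|//]]]] Hj].
- by rewrite [g (Ordinal Hj)]/g /= mulr1; exact: Vg.
- by rewrite [g (Ordinal Hj)]/g /=; apply: (VmulX).
- by rewrite [g (Ordinal Hj)]/g /=; apply: (VmulY).
- by rewrite [g (Ordinal Hj)]/g /= expr2 mulrA; do 2!apply: (VmulY).
Qed.

End NumberFields.

#[local] Hint Resolve rational_rat rational_nat rational1 rational0 rationalD rationalM
  rationalN rationalV rationalX : rational_db.

(** * The field of a Gram matrix *)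

Section GramAlternative.
Variable R : realType.
Implicit Types (x y z d : R).

(* The matrix G with unit diagonal and entries G_12 = z, G_13 = y, G_23 = x has
   determinant 1 + 2xyz - x^2 - y^2 - z^2, half of whose gradient is
   (yz - x, xz - y, xy - z): if G is positive definite and its determinant is
   critical along a direction d <> 0, the second derivative along d is nonzero.
   The squares come from the LDL decomposition of G. *)
Lemma det_gram_concave x y z d1 d2 d3 :
  0 < 1 - z ^+ 2 -> 0 < 1 + 2 * x * y * z - x ^+ 2 - y ^+ 2 - z ^+ 2 ->
  d1 * (y * z - x) + d2 * (x * z - y) + d3 * (x * y - z) = 0 ->
  2 * (d1 * d2 * z + d1 * d3 * y + d2 * d3 * x) = d1 ^+ 2 + d2 ^+ 2 + d3 ^+ 2 ->
  [/\ d1 = 0, d2 = 0 & d3 = 0].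
Proof.
set w := 1 - z ^+ 2; set D := 1 + _ - _ - _ - _ => w0 D0 hd E.
have wn : w != 0 by rewrite gt_eqF.
have Dn : D != 0 by rewrite gt_eqF.
(* Let H be the symmetric matrix with zero diagonal and H_12 = d3, H_13 = d2, H_23 = d1, and U the
   inverse of the unit lower triangular factor of G. The numbers [t13], [t22], [t23], [t33] are
   entries of U H U^T. Then [tr] says that G^-1 H has trace 0, and the left side of [SOS] is the
   trace of (G^-1 H)^2. *)
pose l := (x - y * z) / w.
pose r := - y + l * z.
pose t13 := d2 - l * d3.
pose t22 := - 2 * z * d3.
pose t23 := d3 * r + l * z * d3 - z * d2 + d1.
pose t33 := 2 * (- (r * l * d3) + r * d2 - l * d1).
have tr : t22 * D + t33 * w ^+ 2 = 0.
  transitivity (2 * w * (d1 * (y * z - x) + d2 * (x * z - y) + d3 * (x * y - z))).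
    by rewrite /t33 /t22 /r /l /D; move: wn; rewrite /w => wn; field.
  by rewrite hd mulr0.
have SOS : t22 ^+ 2 / w ^+ 2 + t33 ^+ 2 * w ^+ 2 / D ^+ 2 + 2 * d3 ^+ 2 / w
   + 2 * t13 ^+ 2 * w / D + 2 * t23 ^+ 2 / D = 0.
  have F : 2 * (2 * (d1 * d2 * z + d1 * d3 * y + d2 * d3 * x) - (d1 ^+ 2 + d2 ^+ 2 + d3 ^+ 2)) / D =
     ((t22 * D + t33 * w ^+ 2) / (w * D)) ^+ 2 -
    (t22 ^+ 2 / w ^+ 2 + t33 ^+ 2 * w ^+ 2 / D ^+ 2 + 2 * d3 ^+ 2 / w
   + 2 * t13 ^+ 2 * w / D + 2 * t23 ^+ 2 / D).
    rewrite /t33 /t22 /t23 /t13 /r /l; move: wn Dn; rewrite /D /w => wn Dn; field.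
    by rewrite wn Dn.
  by move: F; rewrite tr E subrr mulr0 !mul0r expr0n /= sub0r => /esym/eqP; rewrite oppr_eq0 => /eqP.
have p1 : 0 <= t22 ^+ 2 / w ^+ 2 by rewrite divr_ge0 ?sqr_ge0.
have p2 : 0 <= t33 ^+ 2 * w ^+ 2 / D ^+ 2.
  by apply: divr_ge0; [apply: mulr_ge0; exact: sqr_ge0|exact: sqr_ge0].
have p3 : 0 <= 2 * d3 ^+ 2 / w by apply: divr_ge0; [apply: mulr_ge0 => //; exact: sqr_ge0|exact: ltW].
have p4 : 0 <= 2 * t13 ^+ 2 * w / D.
  apply: divr_ge0; last exact: ltW.
  by apply: mulr_ge0; [apply: mulr_ge0 => //; exact: sqr_ge0|exact: ltW].
have p5 : 0 <= 2 * t23 ^+ 2 / D by apply: divr_ge0; [apply: mulr_ge0 => //; exact: sqr_ge0|exact: ltW].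
have q3 : 2 * d3 ^+ 2 / w = 0 by lra.
have q4 : 2 * t13 ^+ 2 * w / D = 0 by lra.
have q5 : 2 * t23 ^+ 2 / D = 0 by lra.
have d30 : d3 = 0.
  move/eqP: q3; rewrite mulf_eq0 invr_eq0 (negPf wn) orbF mulf_eq0 pnatr_eq0 /= sqrf_eq0.
  by move/eqP.
have d20 : d2 = 0.
  move/eqP: q4; rewrite mulf_eq0 invr_eq0 (negPf Dn) orbF mulf_eq0 (negPf wn) orbF mulf_eq0 pnatr_eq0 /= sqrf_eq0.
  by rewrite /t13 d30 mulr0 subr0 => /eqP.
split=> //.
move/eqP: q5; rewrite mulf_eq0 invr_eq0 (negPf Dn) orbF mulf_eq0 pnatr_eq0 /= sqrf_eq0.
by rewrite /t23 d30 d20 !mulr0 mul0r addr0 subr0 add0r => /eqP.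
Qed.

Variables (I : finType) (A al be ga : I -> R) (x y z : R).
Hypothesis (ral : forall r, rational (al r)) (rbe : forall r, rational (be r)).
Hypothesis rga : forall r, rational (ga r).
Hypothesis unitE : forall r, A r != 0 ->
  2 * (be r * ga r * x + al r * ga r * y + al r * be r * z) =
  1 - al r ^+ 2 - be r ^+ 2 - ga r ^+ 2.
Hypothesis (hx : y * z - x = \sum_r A r * (be r * ga r)).
Hypothesis (hy : x * z - y = \sum_r A r * (al r * ga r)).
Hypothesis (hz : x * y - z = \sum_r A r * (al r * be r)).
Hypothesis (x1 : 0 < 1 - x ^+ 2) (y1 : 0 < 1 - y ^+ 2) (z1 : 0 < 1 - z ^+ 2).
Hypothesis D0 : 0 < 1 + 2 * x * y * z - x ^+ 2 - y ^+ 2 - z ^+ 2.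

Definition in_field_of_rank s := exists g : 'I_s -> R,
  [/\ divring_closed (mem (range (rat_comb g))),
    range (rat_comb g) x, range (rat_comb g) y & range (rat_comb g) z].

(** [c1], [c2], [c3] are the components of the cross product of the linear parts (be ga, al ga, al
    be) of the equations for [r] and [s]. *)
Let c1 r s := al r * ga r * (al s * be s) - al r * be r * (al s * ga s).
Let c2 r s := al r * be r * (be s * ga s) - be r * ga r * (al s * be s).
Let c3 r s := be r * ga r * (al s * ga s) - al r * ga r * (be s * ga s).

Lemma affine_field (s : R) p1 p2 p3 q1 q2 q3 a b :
  rational p1 -> rational p2 -> rational p3 -> rational q1 -> rational q2 -> rational q3 ->
  rational a -> rational b -> s ^+ 2 = a + b * s ->
  x = p1 + q1 * s -> y = p2 + q2 * s -> z = p3 + q3 * s -> in_field_of_rank 2.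
Proof.
move=> rp1 rp2 rp3 rq1 rq2 rq3 ra rb E xE yE zE; rewrite /in_field_of_rank xE yE zE.
have [g [fg gs]] : exists g : 'I_2 -> R, divring_closed (mem (range (rat_comb g))) /\ range (rat_comb g) s.
  by apply: quadratic_field; exists a, b.
exists g; have H p q : rational p -> rational q -> range (rat_comb g) (p + q * s).
  move=> [p' ->] [q' ->]; apply: (subfieldD fg); first exact: (subfield_ratr fg).
  by apply: (subfieldM fg) => //; exact: (subfield_ratr fg).
by split=> //; apply: H.
Qed.

Lemma rational_in_field : rational x -> rational y -> rational z -> in_field_of_rank 2.
Proof.
move=> rx ry rz.
by apply: (@affine_field 0 x y z 0 0 0 0 0); rewrite ?mul0r ?addr0 ?expr0n//; auto with rational_db.
Qed.

(** The gradient is a combination of the linear parts; if these are all parallel to that of [s], so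
    is the gradient. *)
Lemma sum_cross0 s : (forall r, A r != 0 -> [/\ c1 r s = 0, c2 r s = 0 & c3 r s = 0]) ->
  [/\ (x * z - y) * (al s * be s) = (x * y - z) * (al s * ga s),
      (x * y - z) * (be s * ga s) = (y * z - x) * (al s * be s) &
      (y * z - x) * (al s * ga s) = (x * z - y) * (be s * ga s)].
Proof.
move=> H; rewrite hx hy hz !mulr_suml.
split; apply: eq_bigr => r _; have [->|Ar] := eqVneq (A r) 0; rewrite ?mul0r//;
  have [E1 E2 E3] := H r Ar; rewrite -!mulrA; congr (_ * _); apply/eqP; rewrite -subr_eq0; apply/eqP.
- by rewrite -[RHS]E1 /c1; ring.
- by rewrite -[RHS]E2 /c2; ring.
- by rewrite -[RHS]E3 /c3; ring.
Qed.

(** Cramer's rule with the determinant written as l . (n x m). It serves for a third independent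
    equation and also with l = n x m, to parametrize a line. *)
Lemma cramer3 n1 n2 n3 m1 m2 m3 l1 l2 l3 (c c' c'' : R) :
  n1 * x + n2 * y + n3 * z = c -> m1 * x + m2 * y + m3 * z = c' -> l1 * x + l2 * y + l3 * z = c'' ->
  let det := l1 * (n2 * m3 - n3 * m2) + l2 * (n3 * m1 - n1 * m3) + l3 * (n1 * m2 - n2 * m1) in
  [/\ det * x = c * (m2 * l3 - m3 * l2) + c' * (l2 * n3 - l3 * n2) + c'' * (n2 * m3 - n3 * m2),
      det * y = c * (m3 * l1 - m1 * l3) + c' * (l3 * n1 - l1 * n3) + c'' * (n3 * m1 - n1 * m3) &
      det * z = c * (m1 * l2 - m2 * l1) + c' * (l1 * n2 - l2 * n1) + c'' * (n1 * m2 - n2 * m1)].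
Proof. by move=> <- <- <-; split; ring. Qed.

Let rhs r := (1 - al r ^+ 2 - be r ^+ 2 - ga r ^+ 2) / 2.

Lemma unit_lin r : A r != 0 -> be r * ga r * x + al r * ga r * y + al r * be r * z = rhs r.
Proof. by move=> Ar; rewrite /rhs -unitE//; field. Qed.

Lemma rational_rhs r : rational (rhs r).
Proof. by rewrite /rhs; auto 20 with rational_db. Qed.

Hint Resolve rational_rhs ral rbe rga : rational_db.

(* Two independent unit-length equations confine (x, y, z) to a rational line with
   direction d.  If a third one is independent, the point is rational; otherwise it
   is a critical point of the determinant on that line, and a nondegenerate one by
   det_gram_concave, hence a simple root of a rational polynomial of degree 2. *)
Lemma rank2_field r s : A r != 0 -> A s != 0 ->
  ~ [/\ c1 r s = 0, c2 r s = 0 & c3 r s = 0] -> in_field_of_rank 2.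
Proof.
move=> Ar As ncr; pose d1 := c1 r s; pose d2 := c2 r s; pose d3 := c3 r s.
have rd1 : rational d1 by rewrite /d1 /c1; auto 20 with rational_db.
have rd2 : rational d2 by rewrite /d2 /c2; auto 20 with rational_db.
have rd3 : rational d3 by rewrite /d3 /c3; auto 20 with rational_db.
have [[t At]|/forallNP H] := pselect (exists t, A t != 0 /\
    be t * ga t * d1 + al t * ga t * d2 + al t * be t * d3 != 0).
  case: At => At det0.
  have [E1 E2 E3] := cramer3 (unit_lin Ar) (unit_lin As) (unit_lin At).
  have Hdiv w v : rational v ->
      (be t * ga t * d1 + al t * ga t * d2 + al t * be t * d3) * w = v -> rational w.
    move=> rv E; rewrite -[w](mulKf det0) E.
    by apply: rationalM => //; apply: rationalV; auto 20 with rational_db.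
  apply: rational_in_field.
  - by apply: (Hdiv _ _ _ E1); do 2?apply: rationalD; apply: rationalM; auto 20 with rational_db.
  - by apply: (Hdiv _ _ _ E2); do 2?apply: rationalD; apply: rationalM; auto 20 with rational_db.
  - by apply: (Hdiv _ _ _ E3); do 2?apply: rationalD; apply: rationalM; auto 20 with rational_db.
have dz t : A t != 0 -> be t * ga t * d1 + al t * ga t * d2 + al t * be t * d3 = 0.
  by move=> At; apply/eqP/negPn/negP => H1; apply: (H t).
have hd : d1 * (y * z - x) + d2 * (x * z - y) + d3 * (x * y - z) = 0.
  rewrite hx hy hz !mulr_sumr -!big_split /= big1// => t _.
  have [->|At] := eqVneq (A t) 0; first by ring.
  by rewrite -[RHS](mulr0 (A t)) -(dz t At); ring.
(* The parameter on the line is the product with the direction d; taken as the third equation of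
   Cramer's rule, it has determinant [e] = |d|^2. *)
pose s0 := d1 * x + d2 * y + d3 * z; pose e := d1 ^+ 2 + d2 ^+ 2 + d3 ^+ 2.
have e0 : e != 0.
  apply/eqP => e0; apply: ncr.
  have := sqr_ge0 d1; have := sqr_ge0 d2; have := sqr_ge0 d3; move: e0; rewrite /e => e0 p3 p2 p1.
  have q1 : d1 ^+ 2 = 0 by lra.
  have q2 : d2 ^+ 2 = 0 by lra.
  have q3 : d3 ^+ 2 = 0 by lra.
  by split; apply/eqP; rewrite -sqrf_eq0; apply/eqP.
have re : rational e by rewrite /e; auto 20 with rational_db.
have [/=] := cramer3 (unit_lin Ar) (unit_lin As) (erefl s0).
rewrite -/(c1 r s) -/(c2 r s) -/(c3 r s) -/d1 -/d2 -/d3.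
have -> : d1 * d1 + d2 * d2 + d3 * d3 = e by rewrite /e; ring.
set k1 := _ + rhs s * _; set k2 := _ + rhs s * _; set k3 := _ + rhs s * _ => E1 E2 E3.
pose p1 := e^-1 * k1; pose p2 := e^-1 * k2; pose p3 := e^-1 * k3.
pose q1 := e^-1 * d1; pose q2 := e^-1 * d2; pose q3 := e^-1 * d3.
have rp1 : rational p1.
  rewrite /p1 /k1; apply: rationalM; first by auto with rational_db.
  by apply: rationalD; apply: rationalM; auto 20 with rational_db.
have rp2 : rational p2.
  rewrite /p2 /k2; apply: rationalM; first by auto with rational_db.
  by apply: rationalD; apply: rationalM; auto 20 with rational_db.
have rp3 : rational p3.
  rewrite /p3 /k3; apply: rationalM; first by auto with rational_db.
  by apply: rationalD; apply: rationalM; auto 20 with rational_db.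
have rq1 : rational q1 by rewrite /q1; auto with rational_db.
have rq2 : rational q2 by rewrite /q2; auto with rational_db.
have rq3 : rational q3 by rewrite /q3; auto with rational_db.
have xE : x = p1 + q1 * s0 by rewrite -[x](mulKf e0) E1 /p1 /q1; ring.
have yE : y = p2 + q2 * s0 by rewrite -[y](mulKf e0) E2 /p2 /q2; ring.
have zE : z = p3 + q3 * s0 by rewrite -[z](mulKf e0) E3 /p3 /q3; ring.
pose qa := d1 * q2 * q3 + d2 * q1 * q3 + d3 * q1 * q2.
pose qb := d1 * (p2 * q3 + p3 * q2 - q1) + d2 * (p1 * q3 + p3 * q1 - q2) + d3 * (p1 * q2 + p2 * q1 - q3).
pose qc := d1 * (p2 * p3 - p1) + d2 * (p1 * p3 - p2) + d3 * (p1 * p2 - p3).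
have rqa : rational qa by rewrite /qa; auto 20 with rational_db.
have rqb : rational qb by rewrite /qb; do 2?apply: rationalD; auto 20 with rational_db.
have rqc : rational qc by rewrite /qc; do 2?apply: rationalD; auto 20 with rational_db.
have s0E : d1 * x + d2 * y + d3 * z = s0 by [].
clearbody s0 p1 p2 p3.
have qE : qa * s0 ^+ 2 + qb * s0 + qc = 0.
  transitivity (d1 * ((p2 + q2 * s0) * (p3 + q3 * s0) - (p1 + q1 * s0)) +
    d2 * ((p1 + q1 * s0) * (p3 + q3 * s0) - (p2 + q2 * s0)) +
    d3 * ((p1 + q1 * s0) * (p2 + q2 * s0) - (p3 + q3 * s0))).
    by rewrite /qa /qb /qc; ring.
  by rewrite -xE -yE -zE.
(* The derivative of the quadratic at [s0] is a positive multiple of the second derivative of the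
   Gram determinant along d. *)
have der : 2 * qa * s0 + qb = (2 * (d1 * d2 * z + d1 * d3 * y + d2 * d3 * x) - e) / e.
  transitivity (d1 * ((p2 + q2 * s0) * q3 + (p3 + q3 * s0) * q2 - q1) +
    d2 * ((p1 + q1 * s0) * q3 + (p3 + q3 * s0) * q1 - q2) +
    d3 * ((p1 + q1 * s0) * q2 + (p2 + q2 * s0) * q1 - q3)).
    by rewrite /qa /qb; ring.
  by rewrite -xE -yE -zE /q1 /q2 /q3; move: e0; rewrite /e => e0; field.
have der0 : 2 * qa * s0 + qb != 0.
  apply/eqP; rewrite der => /eqP; rewrite mulf_eq0 invr_eq0 (negPf e0) orbF subr_eq0 => /eqP E.
  have [z1' z2' z3'] := det_gram_concave z1 D0 hd E.
  by move/eqP: e0; apply; rewrite /e z1' z2' z3' expr0n /= !addr0.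
(* Without quadratic term [s0] itself is rational; its square is then passed as the constant
   coefficient. *)
have [qa0|qan] := eqVneq qa 0.
  have qbn : qb != 0 by move: der0; rewrite qa0 mulr0 mul0r add0r.
  apply: (@affine_field s0 p1 p2 p3 q1 q2 q3 ((- (qc / qb)) ^+ 2) 0) => //; auto 10 with rational_db.
  rewrite mul0r addr0; congr (_ ^+ 2).
  move: qE; rewrite qa0 mul0r add0r => /eqP; rewrite addr_eq0 => /eqP qE.
  by rewrite -mulNr -qE mulrC mulKf.
apply: (@affine_field s0 p1 p2 p3 q1 q2 q3 (- (qc / qa)) (- (qb / qa))) => //; auto 10 with rational_db.
apply: (mulfI qan); transitivity (- qc - qb * s0); first by move: qE; lra.
by field.
Qed.

(* All linear parts are proportional to one with coordinates al s, be s, ga s; when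
   these do not vanish, X = be ga x, Y = al ga y, Z = al be z satisfy the equations
   of quartic_field. *)
Lemma rank1_field s : A s != 0 -> be s * ga s != 0 \/ al s * ga s != 0 \/ al s * be s != 0 ->
  (forall r, A r != 0 -> [/\ c1 r s = 0, c2 r s = 0 & c3 r s = 0]) ->
  in_field_of_rank 2 \/
  [/\ in_field_of_rank 4, al s != 0, be s != 0 & ga s != 0].
Proof.
move=> As ns H; have [F1 F2 F3] := sum_cross0 H; have ul := unit_lin As.
(* If one coordinate of [s] is 0, its linear part has one nonzero entry, so two components of the
   gradient vanish; this kills two of x, y, z, and the unit-length equation makes the third
   rational. *)
have deg (a b c : R) : 0 < 1 - a ^+ 2 -> a * c - b = 0 -> a * b - c = 0 -> b = 0 /\ c = 0.
  move=> a1 E1 E2; have b0 : b * (1 - a ^+ 2) = 0.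
    have -> : b * (1 - a ^+ 2) = - (a * c - b) - a * (a * b - c) by ring.
    by rewrite E1 E2; ring.
  move/eqP: b0; rewrite mulf_eq0 (gt_eqF a1) orbF => /eqP b0; split=> //.
  by move: E2; rewrite b0; lra.
have lin1 (v k : R) : rational k -> k != 0 -> k * v = rhs s -> rational v.
  by move=> rk k0 E; rewrite -[v](mulKf k0) E; auto with rational_db.
have [al0|aln] := eqVneq (al s) 0.
  left; have bg : be s * ga s != 0 by case: ns => // -[]; rewrite al0 mul0r eqxx.
  have E2 : x * z - y = 0.
    by apply: (mulIf bg); rewrite mul0r -F3 al0; ring.
  have E3 : x * y - z = 0.
    by apply: (mulIf bg); rewrite mul0r F2 al0; ring.
  have [y0 z0] := deg x y z x1 E2 E3.
  apply: rational_in_field; rewrite ?y0 ?z0; auto with rational_db.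
  by apply: lin1 bg _; [auto with rational_db|rewrite -ul al0; ring].
have [be0|ben] := eqVneq (be s) 0.
  left; have ag : al s * ga s != 0 by case: ns => [|[]//]; rewrite be0 ?mulr0 ?mul0r eqxx.
  have E2 : y * z - x = 0.
    by apply: (mulIf ag); rewrite mul0r F3 be0; ring.
  have E3 : y * x - z = 0.
    by rewrite mulrC; apply: (mulIf ag); rewrite mul0r -F1 be0; ring.
  have [x0 z0] := deg y x z y1 E2 E3.
  apply: rational_in_field; rewrite ?x0 ?z0; auto with rational_db.
  by apply: lin1 ag _; [auto with rational_db|rewrite -ul be0; ring].
have [ga0|gan] := eqVneq (ga s) 0.
  left; have ab : al s * be s != 0 by rewrite mulf_neq0.
  have E2 : z * y - x = 0.
    by rewrite mulrC; apply: (mulIf ab); rewrite mul0r -F2 ga0; ring.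
  have E3 : z * x - y = 0.
    by rewrite mulrC; apply: (mulIf ab); rewrite mul0r F1 ga0; ring.
  have [x0 y0] := deg z x y z1 E2 E3.
  apply: rational_in_field; rewrite ?x0 ?y0; auto with rational_db.
  by apply: lin1 ab _; [auto with rational_db|rewrite -ul ga0; ring].
right; split=> //.
pose X := be s * ga s * x; pose Y := al s * ga s * y; pose Z := al s * be s * z.
have [g [fg gX gY gZ]] : exists g : 'I_4 -> R, [/\ divring_closed (mem (range (rat_comb g))),
    range (rat_comb g) X, range (rat_comb g) Y & range (rat_comb g) Z].
  apply: (@quartic_field _ X Y Z (al s ^+ 2) (be s ^+ 2) (ga s ^+ 2) (rhs s)) => //; auto with rational_db.
  - apply/eqP; rewrite -subr_eq0; apply/eqP.
    transitivity (al s * be s * ((y * z - x) * (al s * ga s) - (x * z - y) * (be s * ga s))).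
      by rewrite /X /Y /Z; ring.
    by rewrite F3 subrr mulr0.
  - apply/eqP; rewrite -subr_eq0; apply/eqP.
    transitivity (be s * ga s * ((x * z - y) * (al s * be s) - (x * y - z) * (al s * ga s))).
      by rewrite /X /Y /Z; ring.
    by rewrite F1 subrr mulr0.
have Hd (k v : R) : rational k -> k != 0 -> range (rat_comb g) (k * v) -> range (rat_comb g) v.
  move=> [k' ->] k0 Hk; rewrite -[v](mulKf k0); apply: (subfieldM fg) => //.
  by apply: (subfieldV fg); exact: (subfield_ratr fg).
exists g; split=> //.
- by apply: Hd gX; [auto with rational_db|rewrite mulf_neq0].
- by apply: Hd gY; [auto with rational_db|rewrite mulf_neq0].
- by apply: Hd gZ; [auto with rational_db|rewrite mulf_neq0].
Qed.

(** The rank of the linear parts decides. In rank 0 the gradient is 0, which forces x = y = z = 0.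
    The second alternative retains the proportionality to the linear part of [s], from which the
    support is determined later. *)
Lemma gram_alternative : in_field_of_rank 2 \/
  exists s, [/\ A s != 0, al s != 0, be s != 0 & ga s != 0] /\
    [/\ in_field_of_rank 4 & forall r, A r != 0 ->
      [/\ al r * ga r * (al s * be s) = al r * be r * (al s * ga s),
          al r * be r * (be s * ga s) = be r * ga r * (al s * be s) &
          be r * ga r * (al s * ga s) = al r * ga r * (be s * ga s)]].
Proof.
have [[r [s [Ar As ncr]]]|H] := pselect (exists r s, [/\ A r != 0, A s != 0 &
    ~ [/\ c1 r s = 0, c2 r s = 0 & c3 r s = 0]]).
  by left; exact: (rank2_field Ar As ncr).
have {}H r s : A r != 0 -> A s != 0 -> [/\ c1 r s = 0, c2 r s = 0 & c3 r s = 0].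
  by move=> Ar As; apply: contrapT => ncr; apply: H; exists r, s.
have [[s [As ns]]|H0] := pselect (exists s, A s != 0 /\
    (be s * ga s != 0 \/ al s * ga s != 0 \/ al s * be s != 0)).
  have [F2|[F4 aln ben gan]] := rank1_field As ns (fun r Ar => H r s Ar As); first by left.
  right; exists s; split; first by split.
  split=> // r Ar; have [E1 E2 E3] := H r s Ar As.
  by split; apply/eqP; rewrite -subr_eq0; apply/eqP.
left; have n0 s : A s != 0 -> [/\ be s * ga s = 0, al s * ga s = 0 & al s * be s = 0].
  move=> As; split; apply/eqP/negPn/negP => E; apply: H0; exists s; split=> //.
  - by left.
  - by right; left.
  - by right; right.
have h0 (k : I -> R) : (forall r, A r != 0 -> k r = 0) -> \sum_r A r * k r = 0.
  move=> Hk; rewrite big1// => r _; have [->|Ar] := eqVneq (A r) 0; first by rewrite mul0r.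
  by rewrite Hk// mulr0.
move: hx hy hz; rewrite !h0; try by move=> r /n0[].
move=> E1 E2 E3.
have x0 : x * (1 - z ^+ 2) = 0.
  have -> : x * (1 - z ^+ 2) = - (y * z - x) - z * (x * z - y) by ring.
  by rewrite E1 E2; ring.
move/eqP: x0; rewrite mulf_eq0 (gt_eqF z1) orbF => /eqP x0.
move: E2 E3; rewrite x0 !mul0r !sub0r => /eqP; rewrite oppr_eq0 => /eqP y0 /eqP.
rewrite oppr_eq0 => /eqP z0.
by apply: rational_in_field; rewrite ?x0 ?y0 ?z0; auto with rational_db.
Qed.

End GramAlternative.

(** * Unit dual vectors supporting the immersion *)

Section Configuration.
Variables (R : realType) (L : 'M[R]_3) (N : nat) (xi : 'I_N -> 'rV[R]_3) (A : 'I_N -> R).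
Hypothesis Lu : L \in unitmx.
Hypothesis uxi : unit_dual_vectors L xi.
Hypothesis AE : forall i j, \sum_r A r * xi r 0 i * xi r 0 j = (i == j)%:R.

(** The averaged identity says that Y^T X is the identity, so [X] has rank 3. As its rows carry the
    factor [A r], three independent rows give independent vectors and nonzero weights together. *)
Lemma support_basis : exists f : 'I_3 -> 'I_N,
  (forall i, A (f i) != 0) /\ (\matrix_(i < 3) xi (f i)) \in unitmx.
Proof.
pose X : 'M[R]_(N, 3) := \matrix_r (A r *: xi r).
pose Y : 'M[R]_(N, 3) := \matrix_r xi r.
have YX : Y^T *m X = 1%:M.
  apply/matrixP => i j; rewrite !mxE -AE; apply: eq_bigr => r _.
  by rewrite !mxE; ring.
have fX : row_full X by apply/row_fullP; exists Y^T.
exists (fullrankfun fX).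
pose E := \matrix_(i < 3) xi (fullrankfun fX i).
pose d := \row_(i < 3) A (fullrankfun fX i).
have XE : rowsub (fullrankfun fX) X = diag_mx d *m E.
  rewrite mul_diag_mx; apply/matrixP => i j; rewrite !mxE.
  by [].
have : rowsub (fullrankfun fX) X \in unitmx by exact: fullrowsub_unit.
rewrite XE unitmx_mul => /andP[du Eu]; split=> // i.
move: du; rewrite unitmxE det_diag unitfE => /prodf_neq0 /(_ i isT).
by rewrite mxE.
Qed.

(** Pairing with the rows of [L] maps all [xi r] to integral vectors; in particular E L^T is an
    integral invertible matrix [K], and coordinates in the basis [E] are integral vectors times its
    inverse. *)
Lemma support_coordinates (f : 'I_3 -> 'I_N) (E := \matrix_(i < 3) xi (f i)) :
  E \in unitmx -> exists c : 'I_N -> 'rV[R]_3,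
    [/\ forall r i, rational (c r 0 i), forall r, xi r = c r *m E,
        forall i, c (f i) = delta_mx 0 i &
        exists K : 'M[rat]_3, map_mx ratr K = E *m L^T].
Proof.
move=> Eu; have LTu : L^T \in unitmx by rewrite unitmx_tr.
have /choice[k Hk] : forall r, exists k : 'rV[int]_3, xi r = of_dual_coord L k.
  by move=> r; have [k [-> _]] := dual_coord Lu (uxi.1 r).1; exists k.
have rZ n m (M : 'M[int]_(n, m)) : map_mx ratr (map_mx intr M : 'M[rat]_(n, m)) = map_mx intr M :> 'M[R]_(n, m).
  by apply/matrixP => i j; rewrite !mxE ratr_int.
pose K : 'M[rat]_3 := map_mx intr (\matrix_(i < 3) k (f i)).
have KE : map_mx ratr K = E *m L^T.
  rewrite rZ; apply/row_matrixP => i; rewrite row_mul rowK Hk /of_dual_coord mulmxKV//.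
  by apply/rowP => j; rewrite !mxE.
have Ku : K \in unitmx by rewrite -(map_unitmx (@ratr R)) KE unitmx_mul Eu.
pose c r : 'rV[R]_3 := map_mx ratr ((map_mx intr (k r) : 'rV[rat]_3) *m invmx K).
have cE r : xi r = c r *m E.
  have EK : E = map_mx ratr K *m invmx L^T by rewrite KE mulmxK.
  by rewrite EK /c map_mxM map_invmx rZ mulmxA mulmxKV ?map_unitmx// Hk.
exists c; split=> //; [|move=> i|by exists K].
  by move=> r i; rewrite mxE; exact: rational_rat.
apply: (can_inj (mulmxK Eu)); rewrite -cE -rowE.
by apply/rowP => j; rewrite !mxE.
Qed.

End Configuration.

(** * Three-dimensional index and cofactor formulas *)

Section ThreeByThree.
Variable R : realType.

Lemma sum3 (V : nmodType) (F : 'I_3 -> V) : \sum_i F i = F ord0 + F (lift ord0 ord0) + F (lift ord0 (lift ord0 ord0)).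
Proof. by rewrite !big_ord_recl big_ord0 addr0 addrA. Qed.

Lemma ord3 (P : 'I_3 -> Prop) : P ord0 -> P (lift ord0 ord0) -> P (lift ord0 (lift ord0 ord0)) -> forall i, P i.
Proof.
move=> H0 H1 H2 i; have [->|] := eqVneq i ord0 => //.
have [-> //|] := eqVneq i (lift ord0 ord0).
have [-> //|] := eqVneq i (lift ord0 (lift ord0 ord0)).
by case: i => [[|[|[|//]]]].
Qed.

(** The adjugate of G applied to the system G m = e; the off-diagonal cofactors are the gradient
    components. *)
Lemma gram_inverse_minors (x y z m1 m2 m3 e1 e2 e3 : R) :
  m1 + z * m2 + y * m3 = e1 -> z * m1 + m2 + x * m3 = e2 -> y * m1 + x * m2 + m3 = e3 ->
  let D := 1 + 2 * x * y * z - x ^+ 2 - y ^+ 2 - z ^+ 2 in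
  [/\ D * m1 = (1 - x ^+ 2) * e1 + (x * y - z) * e2 + (x * z - y) * e3,
      D * m2 = (x * y - z) * e1 + (1 - y ^+ 2) * e2 + (y * z - x) * e3 &
      D * m3 = (x * z - y) * e1 + (y * z - x) * e2 + (1 - z ^+ 2) * e3].
Proof. by move=> <- <- <-; split; ring. Qed.

End ThreeByThree.

Section Support.
Variables (R : realType) (L : 'M[R]_3) (N : nat) (xi : 'I_N -> 'rV[R]_3) (A : 'I_N -> R).
Hypothesis Lu : L \in unitmx.
Hypothesis uxi : unit_dual_vectors L xi.
Hypothesis A0 : forall r, 0 <= A r.
Hypothesis AE : forall i j, \sum_r A r * xi r 0 i * xi r 0 j = (i == j)%:R.

Lemma unit_parallel r s t : xi r = t *: xi s -> r = s.
Proof.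
move=> E; have r1 := (uxi.1 r).2; have s1 := (uxi.1 s).2.
have : t ^+ 2 = 1 by move: r1; rewrite E dotZl dotZr s1 mulr1 expr2.
move/eqP; rewrite sqrf_eq1 => /orP[] /eqP t1; move: E; rewrite t1.
  by rewrite scale1r => /(unit_dual_neq uxi r s).1.
by rewrite scaleN1r => /(unit_dual_neq uxi r s).2.
Qed.

(** The pairwise products of the coordinates of [r] are proportional to those of [s], which are
    nonzero. Either all vanish, so that [r] has a single coordinate and is a basis vector, or none
    does and the two coordinate vectors are proportional; unit length then gives r = s. *)
Lemma parallel_support (f : 'I_3 -> 'I_N) (c : 'I_N -> 'rV[R]_3) r s
    (i0 := ord0 : 'I_3) (i1 := lift ord0 ord0 : 'I_3) (i2 := lift ord0 (lift ord0 ord0) : 'I_3) :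
  (forall r, xi r = \sum_i c r 0 i *: xi (f i)) -> (forall i, c s 0 i != 0) ->
  c r 0 i0 * c r 0 i2 * (c s 0 i0 * c s 0 i1) = c r 0 i0 * c r 0 i1 * (c s 0 i0 * c s 0 i2) ->
  c r 0 i0 * c r 0 i1 * (c s 0 i1 * c s 0 i2) = c r 0 i1 * c r 0 i2 * (c s 0 i0 * c s 0 i1) ->
  c r 0 i1 * c r 0 i2 * (c s 0 i0 * c s 0 i2) = c r 0 i0 * c r 0 i2 * (c s 0 i1 * c s 0 i2) ->
  r = s \/ exists i, r = f i.
Proof.
move=> xiE cs.
set a := c r 0 i0; set b := c r 0 i1; set d := c r 0 i2.
set a' := c s 0 i0; set b' := c s 0 i1; set d' := c s 0 i2 => E1 E2 E3.
have an : a' != 0 by exact: cs.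
have bn : b' != 0 by exact: cs.
have dn : d' != 0 by exact: cs.
have cross (p q u q' u' v' : R) : v' != 0 -> p * u * (v' * q') = p * q * (v' * u') -> p = 0 \/ u * q' = q * u'.
  move=> vn Epq; have [->|pn] := eqVneq p 0; [by left|right].
  by apply: (mulfI pn); apply: (mulfI vn); lra.
have K1 := cross _ _ _ _ _ _ an E1.
have K2 : b = 0 \/ a * d' = d * a'.
  by apply: (cross b d a d' a' b' bn); lra.
have K3 : d = 0 \/ b * a' = a * b'.
  by apply: (cross d a b a' b' d' dn); lra.
have single i : (forall j, j != i -> c r 0 j = 0) -> r = s \/ exists i, r = f i.
  move=> H0; right; exists i; apply: (unit_parallel (t := c r 0 i)).
  by rewrite {1}xiE (bigD1 i)//= big1 ?addr0// => j ji; rewrite H0// scale0r.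
have n01 : i1 != i0 by []. have n02 : i2 != i0 by []. have n12 : i2 != i1 by [].
have [a0|an0] := eqVneq a 0.
  have [b0|bn0] := eqVneq b 0.
    by apply: (single i2) => j; elim/ord3: j.
  case: K2 => [/eqP|]; first by rewrite (negPf bn0).
  rewrite a0 mul0r => /esym/eqP; rewrite mulf_eq0 (negPf an) orbF => /eqP d0.
  by apply: (single i1) => j; elim/ord3: j.
case: K1 => [/eqP|K1]; first by rewrite (negPf an0).
have [b0|bn0] := eqVneq b 0.
  move: K1; rewrite b0 mul0r => /eqP; rewrite mulf_eq0 (negPf bn) orbF => /eqP d0.
  by apply: (single i0) => j; elim/ord3: j.
case: K2 => [/eqP|K2]; first by rewrite (negPf bn0).
have [d0|dn0] := eqVneq d 0.
  by move: K2; rewrite d0 mul0r => /eqP; rewrite mulf_eq0 (negPf an0) (negPf dn).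
case: K3 => [/eqP|K3]; first by rewrite (negPf dn0).
left; apply: (unit_parallel (t := a / a')).
rewrite !xiE scaler_sumr; apply: eq_bigr => i _; rewrite scalerA; congr (_ *: _).
elim/ord3: i; rewrite -/i0 -/i1 -/i2 -/a -/b -/d -/a' -/b' -/d'.
- by rewrite divfK.
- by apply: (mulIf an); rewrite K3 mulrAC divfK.
- by apply: (mulIf an); rewrite -K2 mulrAC divfK.
Qed.

(** The function [lam] records the relation that expands xi_s in the basis, with coefficient -1 at
    [s]. Three phases can be prescribed on the basis, and the relation then yields the fourth. [s]
    is no basis index, since it has no zero coordinate. *)
Lemma general_position_relation (f : 'I_3 -> 'I_N) (E := \matrix_(i < 3) xi (f i))
    (c : 'I_N -> 'rV[R]_3) s :
  E \in unitmx -> (forall i, A (f i) != 0) -> A s != 0 -> (forall r, xi r = c r *m E) ->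
  (forall i, c (f i) = delta_mx 0 i) -> (forall i, c s 0 i != 0) ->
  (forall r, A r != 0 -> r = s \/ exists i, r = f i) ->
  exists lam : 'I_N -> R, [/\ forall r, (lam r != 0) = (A r != 0),
    #|[pred r | A r != 0]| = 4%N &
    forall t : 'I_N -> R, \sum_r lam r * t r = 0 ->
      exists u, forall r, A r != 0 -> dot (xi r) u = t r].
Proof.
move=> Eu Af As cE cf cs supp.
have f_inj : injective f.
  move=> i j fij; have := cf i; rewrite fij cf => /rowP/(_ i); rewrite !mxE !eqxx /=.
  by case: eqVneq => // _ /eqP; rewrite eq_sym oner_eq0.
have sf i : s != f i.
  have [j ji] : exists j, j != i by elim/ord3: i; [exists (lift ord0 ord0)|exists ord0|exists ord0].
  apply/eqP => sfi; have := cs j; rewrite sfi cf mxE (negPf ji) andbF.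
  by rewrite eqxx.
pose lam r := (\sum_i (f i == r)%:R * c s 0 i) - (s == r)%:R.
have lamf i : lam (f i) = c s 0 i.
  rewrite /lam (negPf (sf i)) subr0 (bigD1 i)//= eqxx mul1r big1 ?addr0// => j ji.
  by rewrite (inj_eq f_inj) (negPf ji) mul0r.
have lams : lam s = -1.
  by rewrite /lam eqxx big1 ?sub0r// => i _; rewrite eq_sym (negPf (sf i)) mul0r.
exists lam; split=> [r||t lt].
- apply/idP/idP => [|Ar]; last first.
    by case: (supp r Ar) => [->|[i ->]]; rewrite ?lams ?lamf ?oppr_eq0 ?oner_eq0.
  apply: contraNT; rewrite negbK => /eqP Ar0; rewrite /lam big1 => [|i _].
    rewrite sub0r oppr_eq0; case: (eqVneq s r) => [sr|//].
    by move: As; rewrite sr Ar0 eqxx.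
  case: (eqVneq (f i) r) => [fr|_]; last by rewrite mul0r.
  by have := Af i; rewrite fr Ar0 eqxx.
- have -> : #|[pred r | A r != 0]| = #|s |: f @: 'I_3|.
    apply: eq_card => r; rewrite !inE; apply/idP/orP => [/supp[->|[i ->]]|[/eqP ->//|/imsetP[i _ ->]//]].
      by left.
    by right; apply/imsetP; exists i.
  rewrite cardsU1 card_imset// card_ord (_ : s \notin _)//.
  by apply/imsetP => -[i _ sfi]; have := sf i; rewrite sfi eqxx.
- have tE : t s = \sum_i c s 0 i * t (f i).
    move: lt; rewrite (eq_bigr (fun r => (\sum_i (f i == r)%:R * c s 0 i * t r) - (s == r)%:R * t r)); last first.
      by move=> r _; rewrite /lam mulrBl mulr_suml.
    have ts : \sum_r (s == r)%:R * t r = t s.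
      rewrite (bigD1 s)//= eqxx mul1r big1 ?addr0// => r rs.
      by rewrite eq_sym (negPf rs) mul0r.
    rewrite sumrB ts exchange_big /= => /eqP; rewrite subr_eq0 => /eqP <-.
    apply: eq_bigr => i _; rewrite (bigD1 (f i))//= eqxx mul1r big1 ?addr0// => r ri.
    by rewrite eq_sym (negPf ri) !mul0r.
  pose u := (invmx E *m \col_i t (f i))^T.
  have uE r : dot (xi r) u = \sum_i c r 0 i * t (f i).
    transitivity ((xi r *m u^T) 0 0).
      by rewrite mxE; apply: eq_bigr => i _; rewrite [u^T _ _]mxE.
    rewrite cE /u trmxK mulmxA mulmxK// mxE; apply: eq_bigr => i _.
    by rewrite mxE.
  exists u => r Ar; rewrite uE; case: (supp r Ar) => [->//|[i ->]].
  rewrite cf (bigD1 i)//= mxE !eqxx mul1r big1 ?addr0// => j ji.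
  by rewrite mxE (negPf ji) andbF mul0r.
Qed.

Lemma support_alternative :
  (exists g : 'I_2 -> R, gram_field L `<=` range (rat_comb g)) \/
  (exists g : 'I_4 -> R, gram_field L `<=` range (rat_comb g)) /\
  exists lam : 'I_N -> R, [/\ forall r, (lam r != 0) = (A r != 0),
    #|[pred r | A r != 0]| = 4%N &
    forall t : 'I_N -> R, \sum_r lam r * t r = 0 ->
      exists u, forall r, A r != 0 -> dot (xi r) u = t r].
Proof.
have [f [Af Eu]] := support_basis AE.
set E := \matrix_i _ in Eu.
have [c [cQ cE cf [K KE]]] := support_coordinates Lu uxi Eu.
rewrite -/E in cE KE.
pose i0 : 'I_3 := ord0; pose i1 : 'I_3 := lift ord0 ord0; pose i2 : 'I_3 := lift ord0 (lift ord0 ord0).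
pose G := E *m E^T.
have GE i j : G i j = dot (xi (f i)) (xi (f j)).
  by rewrite mxE; apply: eq_bigr => k _; rewrite !mxE.
have xiE r : xi r = \sum_i c r 0 i *: xi (f i).
  by rewrite {1}cE mulmx_sum_row; apply: eq_bigr => i _; rewrite rowK.
pose x := G i1 i2; pose y := G i0 i2; pose z := G i0 i1.
have Gd i : G i i = 1 by rewrite GE (uxi.1 (f i)).2.
have Gs i j : G i j = G j i by rewrite !GE dotC.
have unitE r : 2 * (c r 0 i1 * c r 0 i2 * x + c r 0 i0 * c r 0 i2 * y + c r 0 i0 * c r 0 i1 * z) =
    1 - c r 0 i0 ^+ 2 - c r 0 i1 ^+ 2 - c r 0 i2 ^+ 2.
  have := (uxi.1 r).2; rewrite {1 2}xiE dot_suml sum3 !dotZl !dot_sumr !sum3 !dotZr -!GE.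
  rewrite -/i0 -/i1 -/i2 !Gd (Gs i1 i0) (Gs i2 i0) (Gs i2 i1) -/x -/y -/z.
  by move: (c r 0 i0) (c r 0 i1) (c r 0 i2) => a b d; lra.
pose C := \matrix_r c r.
pose M := C^T *m (diag_mx (\row_r A r) *m C).
have EME : E^T *m M *m E = 1%:M.
  have -> : E^T *m M *m E = (C *m E)^T *m (diag_mx (\row_r A r) *m (C *m E)).
    by rewrite trmx_mul !mulmxA.
  have CE r k : (C *m E) r k = xi r 0 k.
    by rewrite cE !mxE; apply: eq_bigr => l _; rewrite !mxE.
  move: (C *m E) CE => X XE.
  apply/matrixP => i j; rewrite mul_diag_mx !mxE -AE; apply: eq_bigr => r _.
  by rewrite !mxE !XE; ring.
have GM : G *m M = 1%:M by rewrite /G -mulmxA; apply: mulmx1C.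
have ME i j : M i j = \sum_r A r * (c r 0 i * c r 0 j).
  rewrite /M mul_diag_mx mxE; apply: eq_bigr => r _.
  by rewrite !mxE; ring.
clearbody M.
have col j : [/\ M i0 j + z * M i1 j + y * M i2 j = (i0 == j)%:R,
    z * M i0 j + M i1 j + x * M i2 j = (i1 == j)%:R &
    y * M i0 j + x * M i1 j + M i2 j = (i2 == j)%:R].
  have H i : \sum_k G i k * M k j = (i == j)%:R by move/matrixP/(_ i j): GM; rewrite !mxE.
  have := H i0; have := H i1; have := H i2; rewrite !sum3 -/i0 -/i1 -/i2 !Gd !mul1r.
  by rewrite (Gs i1 i0) (Gs i2 i0) (Gs i2 i1) -/x -/y -/z.
pose D := 1 + 2 * x * y * z - x ^+ 2 - y ^+ 2 - z ^+ 2.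
have M00 : D * M i0 i0 = 1 - x ^+ 2.
  have [h1 h2 h3] := col i0; have [-> _ _] := gram_inverse_minors h1 h2 h3.
  by rewrite /=; ring.
have M01 : D * M i0 i1 = x * y - z.
  have [h1 h2 h3] := col i1; have [-> _ _] := gram_inverse_minors h1 h2 h3.
  by rewrite /=; ring.
have /= [M02 M12] : D * M i0 i2 = x * z - y /\ D * M i1 i2 = y * z - x.
  have [h1 h2 h3] := col i2; have [-> -> _] := gram_inverse_minors h1 h2 h3.
  by split=> //=; ring.
have G1 i j : i != j -> 0 < 1 - G i j ^+ 2.
  move=> ij; pose v : 'rV[R]_3 := delta_mx 0 i - G i j *: delta_mx 0 j.
  have vE : v *m E = xi (f i) + (- G i j) *: xi (f j).
    by rewrite mulmxBl -scalemxAl -!rowE !rowK scaleNr.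
  have -> : 1 - G i j ^+ 2 = dot (v *m E) (v *m E).
    by rewrite vE dotDl !dotDr !dotZl !dotZr -!GE !Gd (Gs j i); ring.
  rewrite lt_def dot_ge0 andbT; apply/eqP => /dot_eq0 v0.
  have : v = 0 by rewrite -[v](mulmxK Eu) v0 mul0mx.
  move/rowP/(_ i); rewrite !mxE (negPf ij) andbF mulr0 subr0 !eqxx => /eqP.
  by rewrite oner_eq0.
have x1 : 0 < 1 - x ^+ 2 by apply: G1.
have y1 : 0 < 1 - y ^+ 2 by apply: G1.
have z1 : 0 < 1 - z ^+ 2 by apply: G1.
have M00_gt0 : 0 < M i0 i0.
  rewrite ME (bigD1 (f i0))//= cf mxE eqxx mulr1 mulr1.
  apply: ltr_pwDl; first by rewrite lt_def Af A0.
  by apply: sumr_ge0 => r _; rewrite mulr_ge0// -expr2 sqr_ge0.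
(* The determinant is positive because its product with the positive entry [M i0 i0] is the positive
   minor 1 - x^2. *)
have D0 : 0 < D by rewrite -(pmulr_lgt0 _ M00_gt0) M00.
have Dn : D != 0 by rewrite gt_eqF.
(* The weights are rescaled by [D], which turns the entries of the inverse [M] into cofactors, as
   [gram_alternative] expects. *)
have DA r : (D * A r != 0) = (A r != 0) by rewrite mulf_eq0 (negPf Dn).
have DM i j : D * M i j = \sum_r D * A r * (c r 0 i * c r 0 j).
  by rewrite ME mulr_sumr; apply: eq_bigr => r _; rewrite mulrA.
(* Since [K] is rational and [M] is the inverse of [G], any field containing x, y, z contains the
   Gram matrix of the lattice. *)
have gramE : gram L = (map_mx ratr K)^T *m M *m map_mx ratr K.
  rewrite KE trmx_mul trmxK.
  have -> : L *m E^T *m M *m (E *m L^T) = L *m (E^T *m M *m E) *m L^T by rewrite !mulmxA.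
  by rewrite EME mulmx1.
have sub s : in_field_of_rank x y z s -> exists g : 'I_s -> R, gram_field L `<=` range (rat_comb g).
  move=> [g [fg gx gy gz]]; exists g; apply: (gram_field_sub fg).
  rewrite gramE; apply: (subfield_mulmx fg); last exact: (subfield_ratmx fg).
  apply: (subfield_mulmx fg); first by apply: subfield_trmx; exact: (subfield_ratmx fg).
  have [Gu _] := mulmx1_unit GM.
  have -> : M = invmx G by rewrite -[M](mulKmx Gu) GM mulmx1.
  apply: (subfield_invmx fg) => i j.
  have g1 := subfield1 fg.
  elim/ord3: i; elim/ord3: j; rewrite -/i0 -/i1 -/i2 ?Gd //; by rewrite Gs.
have := gram_alternative (I := 'I_N) (A := fun r => D * A r)
  (al := fun r => c r 0 i0) (be := fun r => c r 0 i1) (ga := fun r => c r 0 i2)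
  (fun r => cQ r i0) (fun r => cQ r i1) (fun r => cQ r i2) (fun r _ => unitE r).
rewrite -!DM M01 M02 M12 => /(_ erefl erefl erefl x1 y1 z1 D0) [/sub|]; first by left.
move=> [s [[As aln ben gan]] [/sub F4 Hs]]; right; split=> //.
have cs i : c s 0 i != 0 by elim/ord3: i.
apply: (general_position_relation Eu Af _ cE cf cs); first by rewrite -DA.
move=> r Ar; have [|E1 E2 E3] := Hs r; first by rewrite DA.
exact: (parallel_support xiE cs E1 E2 E3).
Qed.

End Support.

(** * Four frequencies in general position *)

Section FourFrequencies.
Variables (R : realType) (L : 'M[R]_3) (N m : nat) (xi : 'I_N -> 'rV[R]_3).
Variables (p q : 'I_N -> 'rV[R]_m.+1) (x : 'rV[R]_3 -> 'rV[R]_m.+1).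
Hypothesis mx : minimal_isometric_immersion L x.
Hypothesis xE : forall u, x u = \sum_r (cos (theta xi r u) *: p r + sin (theta xi r u) *: q r).
Variables (A lam : 'I_N -> R).
Hypothesis A0 : forall r, A r = 0 -> p r = 0 /\ q r = 0.
Hypothesis lamE : forall r, (lam r != 0) = (A r != 0).
Hypothesis cardA : #|[pred r | A r != 0]| = 4%N.
Hypothesis lamP : forall t : 'I_N -> R, \sum_r lam r * t r = 0 ->
  exists u, forall r, A r != 0 -> dot (xi r) u = t r.

Let J r u := velocity xi p q r u.

Lemma velocity_off r u : A r = 0 -> J r u = 0.
Proof. by move=> /A0[p0 q0]; rewrite /J /velocity p0 q0 !scaler0 addr0. Qed.

Lemma other_two a b : A a != 0 -> A b != 0 -> a != b ->
  exists c d, [/\ [/\ A c != 0, A d != 0 & c != d], [/\ c != a, c != b, d != a & d != b] &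
    forall r, A r != 0 -> [\/ r = a, r = b, r = c | r = d]].
Proof.
move=> Aa Ab ab; pose S := finset (fun r => A r != 0) :\ a :\ b.
have S2 : #|S| == 2%N.
  have cS : #|finset (fun r => A r != 0)| = 4%N.
    by rewrite -cardA; apply: eq_card => r; rewrite !inE.
  have ba : b != a by rewrite eq_sym.
  by move: cS; rewrite (cardsD1 a) inE Aa (cardsD1 b) !inE ba Ab /= => -[/eqP].
have /cards2P[c [d [cd SE]]] := S2.
have : c \in S by rewrite SE !inE eqxx.
have : d \in S by rewrite SE !inE eqxx orbT.
rewrite !inE => /and3P[db da Ad] /and3P[cb ca Ac].
exists c, d; split=> // r Ar.
have [->|ra] := eqVneq r a; first exact: Or41.
have [->|rb] := eqVneq r b; first exact: Or42.
have : r \in S by rewrite !inE ra rb.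
by rewrite SE !inE => /orP[] /eqP ->; [exact: Or43|exact: Or44].
Qed.

Section Distinct.
Variables a b c d : 'I_N.
Hypotheses (Aa : A a != 0) (Ab : A b != 0) (Ac : A c != 0) (Ad : A d != 0).
Hypotheses (ab : a != b) (cd : c != d) (ca : c != a) (cb : c != b) (da : d != a) (db : d != b).
Hypothesis supp : forall r, A r != 0 -> [\/ r = a, r = b, r = c | r = d].

Lemma frequencies_solve va vb vc vd :
  lam a * va + lam b * vb + lam c * vc + lam d * vd = 0 ->
  exists u, [/\ dot (xi a) u = va, dot (xi b) u = vb, dot (xi c) u = vc & dot (xi d) u = vd].
Proof.
move=> H; pose t r := va * (r == a)%:R + vb * (r == b)%:R + vc * (r == c)%:R + vd * (r == d)%:R.
have sd v e : \sum_r lam r * (v * (r == e)%:R) = lam e * v.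
  rewrite (bigD1 e)//= eqxx mulr1 big1 ?addr0// => r /negPf ->.
  by rewrite !mulr0.
have [|u Hu] := lamP (t := t).
  rewrite -[RHS]H -!sd -!big_split /=; apply: eq_bigr => r _.
  by rewrite /t !mulrDr.
exists u; rewrite !Hu// /t !eqxx (eq_sym b a) (eq_sym a c) (eq_sym a d) (eq_sym b c).
rewrite (eq_sym b d) (eq_sym d c) (negPf ab) (negPf cd) (negPf ca) (negPf cb) (negPf da) (negPf db).
by rewrite !mulr0 !mulr1 !addr0 !add0r.
Qed.

Lemma velocity_sum w u :
  \sum_r dot (xi r) w *: velocity xi p q r u = dot (xi a) w *: J a u + dot (xi b) w *: J b u
    + dot (xi c) w *: J c u + dot (xi d) w *: J d u.
Proof.
rewrite (bigD1 a)//= (bigD1 b)/=; last by rewrite eq_sym.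
rewrite (bigD1 c)/=; last by rewrite ca cb.
rewrite (bigD1 d)/=; last by rewrite da db eq_sym cd.
rewrite big1 ?addr0 ?addrA// => r /andP[/andP[/andP[ra rb] rc] rd].
have [Ar|Ar] := eqVneq (A r) 0; first by rewrite -/(J r u) velocity_off// scaler0.
by case: (supp Ar) => E; move: ra rb rc rd; rewrite E eqxx.
Qed.

(* The vector w with phases (lam b, - lam a, 0, 0) and the vector w' with phases
   (0, lam d, 0, - lam b) isolate few terms of the constant <dx w, dx w'>. *)
Lemma velocity_relation : exists K, forall u,
  dot (lam b *: J a u + (- lam a) *: J b u) (lam d *: J b u + (- lam b) *: J d u) = K.
Proof.
have [|w [wa wb wc wd]] := @frequencies_solve (lam b) (- lam a) 0 0; first by ring.
have [|w' [wa' wb' wc' wd']] := @frequencies_solve 0 (lam d) 0 (- lam b); first by ring.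
exists (dot w w' / 3) => u; rewrite -(velocity_metric mx xE u) !velocity_sum.
by rewrite wa wb wc wd wa' wb' wc' wd' !scale0r !addr0 add0r.
Qed.

Lemma velocity_shift r u v : velocity xi p q r (u + v) =
  - sin (theta xi r u + 2 * pi * dot (xi r) v) *: p r + cos (theta xi r u + 2 * pi * dot (xi r) v) *: q r.
Proof. by rewrite /velocity /theta dotDr mulrDr. Qed.

(** Flipping [J a] in the constant of [velocity_relation] isolates the terms with <J a, J b> and <J
    a, J d>; flipping [J d] separates these two. *)
Lemma velocity_orthogonal u : dot (J a u) (J b u) = 0.
Proof.
have [K HK] := velocity_relation.
have lc : lam c != 0 by rewrite lamE.
have lb : lam b != 0 by rewrite lamE.
have ld : lam d != 0 by rewrite lamE.
(* A translation can flip the sign of one of the velocities a, b, d and fix the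
   other two, as the phase of c absorbs the linear relation. *)
have fix0 r v y : dot (xi r) v = 0 -> J r (y + v) = J r y.
  by move=> E; rewrite /J velocity_shift E mulr0 addr0.
have flip r v y : dot (xi r) v = 2^-1 -> J r (y + v) = - J r y.
  move=> E; rewrite /J velocity_shift E mulrAC divff ?pnatr_eq0// mul1r sinDpi cosDpi.
  by rewrite opprD !scaleNr opprK.
have [|v [va vb _ vd]] := @frequencies_solve 2^-1 0 (- (lam a / lam c / 2)) 0; first by field.
have [|w [wa wb _ wd]] := @frequencies_solve 0 0 (- (lam d / lam c / 2)) 2^-1; first by field.
have H1 y : lam b * lam d * dot (J a y) (J b y) - lam b ^+ 2 * dot (J a y) (J d y) = 0.
  have := HK y; have := HK (y + v); rewrite (flip a)// (fix0 b)// (fix0 d)//.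
  move: (J a y) (J b y) (J d y) => ja jb jd.
  rewrite !dotDl !dotDr !dotZl !dotZr !dotN; lra.
have := H1 (u + w); have := H1 u; rewrite (fix0 a)// (fix0 b)// (flip d)//.
rewrite [dot (J a u) (- _)]dotC dotN (dotC (J d u)) => E1 E2.
have : lam b * lam d * dot (J a u) (J b u) = 0 by lra.
by move/eqP; rewrite mulf_eq0 mulf_eq0 (negPf lb) (negPf ld) => /eqP.
Qed.

Lemma phase_solve va vb : exists u, theta xi a u = 2 * pi * va /\ theta xi b u = 2 * pi * vb.
Proof.
have lc : lam c != 0 by rewrite lamE.
have [|u [ua ub _ _]] := @frequencies_solve va vb (- ((lam a * va + lam b * vb) / lam c)) 0.
  by field.
by exists u; rewrite /theta ua ub.
Qed.

(** The velocity is [q] at phase 0 and [- p] at phase pi/2, and the phases of [a] and [b] can be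
    prescribed independently. *)
Lemma amplitude_orthogonal :
  [/\ dot (p a) (p b) = 0, dot (p a) (q b) = 0, dot (q a) (p b) = 0 & dot (q a) (q b) = 0].
Proof.
have H4 : 2 * pi * 4^-1 = pi / 2 :> R by field.
split.
- have [u [ua ub]] := phase_solve 4^-1 4^-1; have := velocity_orthogonal u.
  rewrite /J /velocity ua ub H4 sin_pihalf cos_pihalf !scale0r !addr0 !scaleN1r.
  by rewrite dotN dotC dotN opprK dotC.
- have [u [ua ub]] := phase_solve 4^-1 0; have := velocity_orthogonal u.
  rewrite /J /velocity ua ub H4 mulr0 sin0 cos0 sin_pihalf cos_pihalf oppr0 !scale0r addr0 add0r scaleN1r scale1r.
  by rewrite dotN => /eqP; rewrite oppr_eq0 => /eqP.
- have [u [ua ub]] := phase_solve 0 4^-1; have := velocity_orthogonal u.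
  rewrite /J /velocity ua ub H4 mulr0 sin0 cos0 sin_pihalf cos_pihalf oppr0 !scale0r addr0 add0r scaleN1r scale1r.
  by rewrite dotC dotN dotC => /eqP; rewrite oppr_eq0 => /eqP.
- have [u [ua ub]] := phase_solve 0 0; have := velocity_orthogonal u.
  by rewrite /J /velocity ua ub mulr0 sin0 cos0 oppr0 !scale0r !add0r !scale1r.
Qed.

End Distinct.

Lemma amplitudes_orthogonal a b : a != b ->
  [/\ dot (p a) (p b) = 0, dot (p a) (q b) = 0, dot (q a) (p b) = 0 & dot (q a) (q b) = 0].
Proof.
move=> ab; have [/A0[-> ->]|Aa] := eqVneq (A a) 0; first by rewrite !dot0l.
have [/A0[-> ->]|Ab] := eqVneq (A b) 0; first by rewrite !(dotC _ 0) !dot0l.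
have [c [d [[Ac Ad cd] [ca cb da db] supp]]] := other_two Aa Ab ab.
exact: (amplitude_orthogonal Aa Ab Ac Ad ab cd ca cb da db supp).
Qed.

(** By orthogonality the relation reduces to - lam_a lam_d |J b|^2 = K, so |J b| does not depend on
    the phase. The phases 0 and pi/2 compare the norms, and pi/4 gives the mixed product. *)
Lemma amplitudes_norm b : dot (p b) (p b) = dot (q b) (q b) /\ dot (p b) (q b) = 0.
Proof.
have [/A0[-> ->]|Ab] := eqVneq (A b) 0; first by rewrite !dot0l.
have [a Aa ab] : exists2 a, A a != 0 & a != b.
  have /card_gt1P[r [s [Ar As rs]]] : (1 < #|[pred r | A r != 0%R]|)%N by rewrite cardA.
  have [rb|rb] := eqVneq r b; last by exists r.
  by exists s => //; rewrite eq_sym -rb.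
have [c [d [[Ac Ad cd] [ca cb da db] supp]]] := other_two Aa Ab ab.
have [K HK] := velocity_relation Aa Ab Ac Ad ab cd ca cb da db supp.
have la : lam a != 0 by rewrite lamE.
have ld : lam d != 0 by rewrite lamE.
have orth r s u : r != s -> dot (J r u) (J s u) = 0.
  move=> rs; have [E1 E2 E3 E4] := amplitudes_orthogonal rs.
  by rewrite /J /velocity dotDl !dotDr !dotZl !dotZr E1 E2 E3 E4 !mulr0 !addr0.
have JK u : dot (J b u) (J b u) = - K / (lam a * lam d).
  have oad : dot (J a u) (J d u) = 0 by apply: orth; rewrite eq_sym.
  have obd : dot (J b u) (J d u) = 0 by apply: orth; rewrite eq_sym.
  move: (HK u) (orth a b u ab) oad obd; move: (J a u) (J b u) (J d u) => ja jb jd E oab oad obd.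
  rewrite -E !dotDl !dotDr !dotZl !dotZr oab oad obd; field.
  by rewrite la ld.
have ph v : exists u, theta xi b u = 2 * pi * v.
  have [u [_ ub]] := phase_solve Aa Ab Ac Ad ab cd ca cb da db 0 v.
  by exists u.
have H4 : 2 * pi * 4^-1 = pi / 2 :> R by field.
have H8 : 2 * pi * 8^-1 = pi / 4 :> R by field.
have qq : dot (q b) (q b) = - K / (lam a * lam d).
  have [u ub] := ph 0; rewrite -(JK u) /J /velocity ub mulr0 sin0 cos0.
  by rewrite oppr0 scale0r add0r scale1r.
have pp : dot (p b) (p b) = - K / (lam a * lam d).
  have [u ub] := ph 4^-1; rewrite -(JK u) /J /velocity ub H4 sin_pihalf cos_pihalf.
  by rewrite scale0r addr0 scaleN1r dotN dotC dotN opprK.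
split; first by rewrite pp qq.
have [u ub] := ph 8^-1; have := JK u; rewrite /J /velocity ub H8.
rewrite dotDl !dotDr !dotZl !dotZr (dotC (q b) (p b)) pp qq.
have cs := cos2Dsin2 (pi / 4 : R).
have pi4 : 0 < (pi / 4 : R) < pi / 2 by have := pi_gt0 R; move=> h; apply/andP; split; lra.
have s0 : 0 < sin (pi / 4 : R) by apply: sin_gt0_pihalf.
have c0 : 0 < cos (pi / 4 : R).
  by apply: cos_gt0_pihalf; have := pi_gt0 R; move=> h; apply/andP; split; lra.
move: (sin _) (cos _) s0 c0 cs (dot (p b) (q b)) (- K / _) => s c' s0 c0 cs e k E.
have : s * c' * e = 0.
  have : (c' ^+ 2 + s ^+ 2) * k - 2 * (s * c' * e) = k by rewrite -[RHS]E; ring.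
  by rewrite cs mul1r; lra.
by move/eqP; rewrite mulf_eq0 mulf_eq0 (gt_eqF s0) (gt_eqF c0) => /eqP.
Qed.

End FourFrequencies.

(** * Homogeneity and the dimension of the ambient space *)

Section FullHomogeneous.
Variable R : realType.

Lemma orthogonal_free n (s : seq 'rV[R]_n) :
  (forall i j, (i < size s)%N -> (j < size s)%N -> i != j -> dot s`_i s`_j = 0) ->
  (forall i, (i < size s)%N -> dot s`_i s`_i != 0) -> free s.
Proof.
move=> o nz; apply/(freeP (X := in_tuple s)) => k k0 i.
have : dot (\sum_(j < size s) k j *: s`_j) s`_i = 0.
  by rewrite k0 -[0](scale0r (0 : 'rV[R]_n)) dotZl mul0r.
rewrite dot_suml (bigD1 i)//= big1 ?addr0 => [|j ji]; last by rewrite dotZl o ?mulr0.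
by rewrite dotZl => /eqP; rewrite mulf_eq0 (negPf (nz i _))// orbF => /eqP.
Qed.

Lemma mxvec_sum n k (B C : 'M[R]_(n, k)) :
  \sum_i mxvec B 0 i * mxvec C 0 i = \sum_r \sum_l B r l * C r l.
Proof.
rewrite pair_bigA (reindex _ (curry_mxvec_bij n k)) /=.
by apply: eq_bigr => -[r l] _; rewrite /= !mxvecE.
Qed.

Variables (L : 'M[R]_3) (N m : nat) (xi : 'I_N -> 'rV[R]_3).
Variables (p q : 'I_N -> 'rV[R]_m.+1) (x : 'rV[R]_3 -> 'rV[R]_m.+1).
Hypothesis uxi : unit_dual_vectors L xi.
Hypothesis xE : forall u, x u = \sum_r (cos (theta xi r u) *: p r + sin (theta xi r u) *: q r).
Hypothesis pq_orth : forall a b, a != b ->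
  [/\ dot (p a) (p b) = 0, dot (p a) (q b) = 0, dot (q a) (p b) = 0 & dot (q a) (q b) = 0].
Hypothesis pq_norm : forall a, dot (p a) (p a) = dot (q a) (q a) /\ dot (p a) (q a) = 0.

Let amp (k : 'I_N * 'I_2) := if k.2 == 0 then p k.1 else q k.1.

Lemma amp_orth k l : k != l -> dot (amp k) (amp l) = 0.
Proof.
case: k l => [r k] [s l] kl; rewrite /amp /=.
have [rs|rs] := eqVneq r s; last first.
  by have [E1 E2 E3 E4] := pq_orth rs; case: ifP; case: ifP.
move: kl; rewrite rs xpair_eqE eqxx /=; have [_ E] := pq_norm s.
case: k l => [[|[|//]] Hk] [[|[|//]] Hl] //= _; by rewrite // dotC.
Qed.

(** The rows of the coefficient matrix [C] are the amplitudes in the order of [Theta], so its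
    product with its transpose is their matrix of inner products. *)
Lemma orthogonal_homogeneous : homogeneous L x.
Proof.
pose P (j : 'I_m.+1) : 'M[R]_(N, 2) := \matrix_(r, k) amp (r, k) 0 j.
pose C : 'M[R]_(N * 2, m.+1) := \matrix_(i, j) mxvec (P j) 0 i.
exists N, xi, C; split=> // [u|].
  apply/rowP => j; rewrite mxE /Theta.
  under eq_bigr do rewrite [C _ _]mxE.
  rewrite mxvec_sum xE summxE; apply: eq_bigr => r _.
  by rewrite !big_ord_recl big_ord0 addr0 !mxE.
apply/is_diag_mxP => i j; case/mxvec_indexP: i => r k; case/mxvec_indexP: j => s l ij.
have CE r' k' l' : C (mxvec_index r' k') l' = amp (r', k') 0 l' by rewrite mxE mxvecE mxE.
transitivity (dot (amp (r, k)) (amp (s, l))).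
  by rewrite mxE; apply: eq_bigr => t _; rewrite CE mxE CE.
by apply: amp_orth; apply: contraNneq ij => -[-> ->].
Qed.

(** The nonzero amplitudes are orthogonal, hence free, and they span by fullness. As |p_r| = |q_r|,
    each frequency contributes two of them or none. *)
Lemma orthogonal_full_dim : full x ->
  m.+1 = (#|[pred r | (dot (p r) (p r) + dot (q r) (q r))%R != 0%R]| * 2)%N.
Proof.
move=> fx; set Z := [pred r | _].
pose S := predX Z (predT : {pred 'I_2}).
have ampN k : dot (amp k) (amp k) = (dot (p k.1) (p k.1) + dot (q k.1) (q k.1)) / 2.
  by have [E _] := pq_norm k.1; rewrite /amp; case: ifP => _; rewrite ?E -?E; field.
pose s := [seq amp k | k <- enum S].
have SN k : k \in enum S -> dot (amp k) (amp k) != 0.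
  by rewrite mem_enum => /andP[/= kS _]; rewrite ampN mulf_neq0 ?invr_eq0 ?pnatr_eq0.
have fs : free s.
  have [k0|S0] := pickP (mem S); last first.
    have -> : s = [::] by rewrite /s (eq_enum S0) enum0.
    exact: nil_free.
  move=> _; apply: orthogonal_free => [i j|i]; rewrite size_map => Hi.
    move=> Hj ij; rewrite !(nth_map k0)//; apply: amp_orth.
    by rewrite nth_uniq ?enum_uniq.
  by rewrite (nth_map k0)//; apply: SN; rewrite mem_nth.
have spanS r k : amp (r, k) \in span s.
  have [Zr|Zr] := boolP (r \in Z).
    by apply/memv_span/map_f; rewrite mem_enum; apply/andP.
  rewrite [amp _]dot_eq0 ?mem0v// ampN.
  by move: Zr; rewrite inE negbK => /eqP ->; rewrite mul0r.
have sV : span s = fullv.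
  apply: fx => u; rewrite xE; apply: memv_suml => r _.
  by apply: memvD; apply: memvZ; [exact: (spanS r ord0) | exact: (spanS r ord_max)].
move: fs; rewrite /free sV dimvf dim_matrix -[X in X == _]/(1 * m.+1)%N mul1n => /eqP ->.
by rewrite size_map -cardE cardX card_ord.
Qed.

End FullHomogeneous.

Theorem theorem4p2 (R : realType) (L : 'M[R]_3)
    (L_basis : L \in unitmx)
    (admits : exists (m : nat) (x : 'rV[R]_3 -> 'rV[R]_m.+1),
       minimal_isometric_immersion L x) :
  [/\ in_GL (gram_field L) (gram L),
      exists2 d : nat, degree_over_rat (gram_field L) d & (d <= 4)%N
    & forall (m : nat) (x : 'rV[R]_3 -> 'rV[R]_m.+1),
        minimal_isometric_immersion L x -> full x ->
        degree_over_rat (gram_field L) 3 \/ degree_over_rat (gram_field L) 4 ->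
        m = 7%N /\ homogeneous L x].
Proof.
have [N [xi uxi]] := unit_dual_exists L_basis.
(* The alternative is needed for each immersion separately, as the frequencies it uses depend on the
   immersion; the field depends only on [L], so one immersion already bounds the degree. *)
have key m (x : 'rV[R]_3 -> 'rV[R]_m.+1) : minimal_isometric_immersion L x ->
    (exists g : 'I_2 -> R, gram_field L `<=` range (rat_comb g)) \/
    (exists g : 'I_4 -> R, gram_field L `<=` range (rat_comb g)) /\
    (full x -> m = 7%N /\ homogeneous L x).
  move=> mx; have [p [q xE]] := minimal_trig L_basis uxi mx.
  pose A r := 3 / 2 * (dot (p r) (p r) + dot (q r) (q r)).
  have A_ge0 r : 0 <= A r by rewrite mulr_ge0// addr_ge0 ?dot_ge0.
  have A0 r : A r = 0 -> p r = 0 /\ q r = 0.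
    move/eqP; rewrite mulf_eq0 paddr_eq0 ?dot_ge0// => /orP[|/andP[/eqP P /eqP Q]].
      by rewrite mulf_eq0 invr_eq0 !pnatr_eq0.
    by split; exact: dot_eq0.
  have [|[g2 [lam [lamE cardA lamP]]]] :=
    support_alternative L_basis uxi A_ge0 (minimal_moment mx xE L_basis uxi); [by left|].
  right; split=> // fx.
  have o := amplitudes_orthogonal mx xE A0 lamE cardA lamP.
  have n := amplitudes_norm mx xE A0 lamE cardA lamP.
  split; last exact: orthogonal_homogeneous uxi xE o n.
  have := orthogonal_full_dim xE o n fx.
  suff -> : #|[pred r | (dot (p r) (p r) + dot (q r) (q r))%R != 0%R]| = 4%N by case.
  rewrite -cardA; apply: eq_card => r.
  by rewrite !inE mulf_eq0 mulf_eq0 invr_eq0 !pnatr_eq0.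
split; first exact: gram_in_GL.
- case: admits => m [x /key[[g /gram_degree[d dK d2]]|[[g /gram_degree[d dK d4]] _]]].
    by exists d => //; exact: leq_trans d2 _.
  by exists d.
- move=> m x /key[[g Kg]|[_ H]] fx; last by move=> _; exact: H.
  by case=> /(degree_over_rat_leq Kg).
Qed.
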